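(* Let $R$ be a commutative ring satisfying $SR_k$ for some $k\ge2$, and let $n\ge1$. Then the partial basis complex $\mathcal{B}_n(R)$ is $(n-k)$-connected. If $k=2$, then $\mathcal{B}_n(R)$ is Cohen–Macaulay (of dimension $n-1$).
   Context: $R$ satisfies $SR_k$ ($k\ge2$) if for every $r_1,\dots,r_k\in R$ generating the unit ideal there are $t_1,\dots,t_{k-1}\in R$ such that $r_1-t_1r_k,\dots,r_{k-1}-t_{k-1}r_k$ generate the unit ideal. The partial basis complex $\mathcal{B}_n(R)$ is the simplicial complex whose vertices are the vectors of $R^n$ contained in some basis of $R^n$, with $\{v_1,\dots,v_{p+1}\}$ a $p$-simplex iff it can be completed to a basis of $R^n$. A complex $X$ is $d$-spherical if it is $d$-dimensional and $(d-1)$-connected; it is Cohen–Macaulay of dimension $d$ if it is $d$-spherical and the link of every $p$-simplex is $(d-p-1)$-spherical. *)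

(* Defs.v *)
From HB Require Import structures.
From mathcomp Require Import all_boot all_order all_algebra.
Import Order.TTheory GRing.Theory Num.Theory.
From mathcomp Require Import all_classical all_reals all_analysis.
From mathcomp Require Import Rstruct Rstruct_topology.

Set Implicit Arguments.
Unset Strict Implicit.
Unset Printing Implicit Defensive.

Local Open Scope classical_set_scope.
Local Open Scope ring_scope.

Notation RR := Rdefinitions.R.

(* The tuple (r_1,...,r_k) is represented by r 0, ..., r (k-1). *)
Definition unimodular (R : comNzRingType) (k : nat) (r : nat -> R) : Prop :=
  exists a : nat -> R, \sum_(i < k) a i * r i = 1.

Definition SR (k : nat) (R : comNzRingType) : Prop :=
  forall r : nat -> R, unimodular k r ->
    exists t : nat -> R,
      unimodular k.-1 (fun i => r i - t i * r k.-1).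

(* A simplicial complex on vertex type V is given by the predicate saying
   which finite lists of vertices (read as finite sets) are simplices. *)
Definition complex (V : Type) := seq V -> Prop.

(* Closed geometric simplex spanned by the (duplicate-free) list s, as a
   set of barycentric-coordinate functions V -> R. *)
Definition geo_simplex (V : eqType) (s : seq V) : set {ptws V -> RR} :=
  [set t | (forall v, v \notin s -> t v = 0) /\ (forall v, 0 <= t v) /\
           \sum_(v <- s) t v = 1].

Definition realization (V : eqType) (X : complex V) : set {ptws V -> RR} :=
  [set t | exists s, X s /\ uniq s /\ geo_simplex s t].

(* Open sets of the coherent (weak) topology of |X|: U is open iff its
   trace on every closed simplex |s| is open in |s| (with the Euclidean
   topology of |s|, which is the trace of the product topology). *)
Definition coherent_open (V : eqType) (X : complex V) (U : set {ptws V -> RR}) :=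
  U `<=` realization X /\
  forall s, X s -> uniq s ->
    exists W : set {ptws V -> RR}, open W /\ U `&` geo_simplex s = W `&` geo_simplex s.

Definition continuous_into (Y : topologicalType) (A : set Y) (V : eqType)
    (X : complex V) (f : Y -> {ptws V -> RR}) : Prop :=
  f @` A `<=` realization X /\
  forall U, coherent_open X U ->
    exists O : set Y, open O /\ f @^-1` U `&` A = O `&` A.

Definition unit_sphere (d : nat) : set 'rV[RR]_d.+1 :=
  [set x | \sum_(i < d.+1) x ord0 i ^+ 2 = 1].
Definition unit_disk (d : nat) : set 'rV[RR]_d.+1 :=
  [set x | \sum_(i < d.+1) x ord0 i ^+ 2 <= 1].
Arguments unit_sphere d : clear implicits.
Arguments unit_disk d : clear implicits.

Definition connected_upto (V : eqType) (X : complex V) (m : int) : Prop :=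
  ((-1 <= m)%R -> exists t, realization X t) /\
  forall d : nat, (d%:Z <= m)%R ->
    forall f, continuous_into (unit_sphere d) X f ->
      exists g, continuous_into (unit_disk d) X g /\
                forall x, unit_sphere d x -> g x = f x.

Definition has_dim (V : eqType) (X : complex V) (d : int) : Prop :=
  (exists s, X s /\ uniq s /\ (size s)%:Z = d + 1) /\
  forall s, X s -> uniq s -> ((size s)%:Z <= d + 1)%R.

Definition spherical (V : eqType) (X : complex V) (d : int) : Prop :=
  has_dim X d /\ connected_upto X (d - 1).

Definition link (V : eqType) (X : complex V) (s : seq V) : complex V :=
  fun t => X (t ++ s) /\ ~~ has (mem s) t.

Definition cohen_macaulay (V : eqType) (X : complex V) (d : int) : Prop :=
  spherical X d /\
  forall s, X s -> uniq s -> s <> [::] ->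
    spherical (link X s) (d - ((size s)%:Z - 1) - 1).

(* Vertices are vectors of R^n (row vectors); a finite set of vectors is a
   simplex iff it can be completed to a basis of R^n, i.e. all of them are
   rows of some invertible n x n matrix M (the rows of M form a basis of
   R^n iff M is invertible). *)
Arguments SR k R : clear implicits.
Definition partial_basis_complex (R : comNzRingType) (n : nat) : complex 'rV[R]_n :=
  fun s => exists M N : 'M[R]_n, M *m N = 1%:M /\ N *m M = 1%:M /\
    forall v, v \in s -> exists i : 'I_n, v = row i M.
Arguments partial_basis_complex R n : clear implicits.

(* Main.v *)
Require Import Defs.
From HB Require Import structures.
From mathcomp Require Import all_boot all_order all_algebra.
Import Order.TTheory GRing.Theory Num.Theory.
From mathcomp Require Import all_classical all_reals all_analysis.
Import numFieldNormedType.Exports.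
From mathcomp Require Import Rstruct Rstruct_topology.
From mathcomp Require Import zify ring lra.
Set Implicit Arguments.
Unset Strict Implicit.
Unset Printing Implicit Defensive.
Local Open Scope classical_set_scope.
Local Open Scope ring_scope.

(** Work with the complex [umod n] of unimodular subsets of R^n (bases of direct
    summands). As in van der Kallen's stability theorem, one shows by induction
    on n that the link of an m-element simplex is (n - m - k)-connected, both for
    the full complex and for its full subcomplex on vectors with last coordinate
    0 or 1. A link of a nonempty simplex containing w is compared with its
    restriction to the kernel of a functional taking the value 1 at w (the stable
    range condition supplies one compatible with the last coordinate), which is a
    link in R^(n-1). For the empty simplex the vectors with last coordinate 0 or 1
    are pushed into the vectors with last coordinate 0, which lie in the star of the
    last standard basis vector.

    Partial bases and unimodular families agree up to n - k + 1 vectors. A unimodular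
    family s of n - k + 2 vectors need not extend to a basis, but its boundary bounds
    in the partial basis complex: it is coned off by an explicit vector u. Hence a
    filling in the unimodular complex can be pushed off all simplices that are not
    partial bases.

    All pushing steps rest on one fact: a map from a sphere of dimension d can be
    pushed off a simplex tau if the join of the boundary of tau with the link of tau is
    (d-1)-connected. It is proved by subdividing the domain into a fine grid,
    projecting radially away from the barycentre of tau on the cells far from it,
    and extending cell by cell over the remaining ones. *)

(** * Real functions continuous on a subset *)

(** A functional identifies a link with one of lower rank only if it takes the value 1 on the vertex
    split off. This explains the values 0 and 1 for the last coordinate: a vertex of that subcomplex
    outside the hyperplane has last coordinate exactly 1, so the last-coordinate functional itself
    splits it off, and the cone vertex of the hyperplane belongs to the subcomplex as well. The
    complexes are infinite, but each map considered has a finite common support, so vertices are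
    added, and simplices removed, one at a time. The vector [u] is needed because of a defect of one
    dimension. Pushing a filling off a simplex requires an (n - k)-connected join of boundary and
    link. A bad simplex with more than n - k + 2 vertices has a boundary sphere that is connected
    enough by itself. With exactly n - k + 2 vertices the boundary is a sphere of dimension n - k,
    one step short, and a vertex in the link makes up for it. For k = 2 every unimodular family
    turns out to be a partial basis, so the links of both complexes agree. *)

Definition cont_on (R : realType) (T : topologicalType) (A : set T)
    (f : T -> R) : Prop :=
  forall x, A x -> f y @[y --> within A (nbhs x)] --> f x.

Section ContOn.
Variables (R : realType) (T : topologicalType).
Implicit Types (A B : set T) (f g : T -> R).

Lemma cont_on_cst A (a : R) : cont_on A (fun=> a).
Proof. by move=> x _; exact: cvg_cst. Qed.

Lemma cont_on_sub A B f : B `<=` A -> cont_on A f -> cont_on B f.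
Proof.
move=> BA cf x Bx; have := cf x (BA _ Bx).
by apply: cvg_trans; apply: cvg_app; exact: within_subset.
Qed.

Lemma cont_onD A f g : cont_on A f -> cont_on A g -> cont_on A (fun x => f x + g x).
Proof. by move=> cf cg x Ax; apply: cvgD; [exact: cf | exact: cg]. Qed.

Lemma cont_onN A f : cont_on A f -> cont_on A (fun x => - f x).
Proof. by move=> cf x Ax; apply: cvgN; exact: cf. Qed.

Lemma cont_onB A f g : cont_on A f -> cont_on A g -> cont_on A (fun x => f x - g x).
Proof. by move=> cf cg; apply: cont_onD => //; exact: cont_onN. Qed.

Lemma cont_onM A f g : cont_on A f -> cont_on A g -> cont_on A (fun x => f x * g x).
Proof. by move=> cf cg x Ax; apply: cvgM; [exact: cf | exact: cg]. Qed.

Lemma cont_onV A f : (forall x, A x -> f x != 0) -> cont_on A f ->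
  cont_on A (fun x => (f x)^-1).
Proof. by move=> f0 cf x Ax; apply: cvgV; [exact: f0 | exact: cf]. Qed.

Lemma cont_on_norm A f : cont_on A f -> cont_on A (fun x => `|f x|).
Proof. by move=> cf x Ax; apply: cvg_norm; exact: cf. Qed.

Lemma cont_on_eq A f g : (forall x, A x -> f x = g x) -> cont_on A f -> cont_on A g.
Proof.
move=> fg cf x Ax; rewrite -(fg x Ax).
apply: cvg_trans (cf x Ax); apply: near_eq_cvg.
by rewrite near_withinE; apply: nearW => y Ay; rewrite fg.
Qed.

Lemma cont_on_max A f g : cont_on A f -> cont_on A g ->
  cont_on A (fun x => Num.max (f x) (g x)).
Proof.
move=> cf cg; apply: (@cont_on_eq _ (fun x => (f x + g x + `|f x - g x|) * 2^-1)).
  by move=> x _; rewrite maxr_absE.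
apply: cont_onM; last exact: cont_on_cst.
by apply: cont_onD; [exact: cont_onD | apply: cont_on_norm; exact: cont_onB].
Qed.

Lemma cont_on_min A f g : cont_on A f -> cont_on A g ->
  cont_on A (fun x => Num.min (f x) (g x)).
Proof.
move=> cf cg; apply: (@cont_on_eq _ (fun x => - Num.max (- f x) (- g x))).
  by move=> x _; rewrite oppr_max !opprK.
by apply: cont_onN; apply: cont_on_max; apply: cont_onN.
Qed.

Lemma cont_on_sum A (I : Type) (s : seq I) (F : I -> T -> R) :
  (forall i, cont_on A (F i)) -> cont_on A (fun x => \sum_(i <- s) F i x).
Proof.
move=> cF; elim: s => [|i s IH].
  by apply: (@cont_on_eq _ (fun=> 0)); [move=> x _; rewrite big_nil | exact: cont_on_cst].
apply: (@cont_on_eq _ (fun x => F i x + \sum_(i <- s) F i x)).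
  by move=> x _; rewrite big_cons.
exact: cont_onD.
Qed.

Lemma cont_on_bigmax A (I : Type) (s : seq I) (F : I -> T -> R) :
  (forall i, cont_on A (F i)) -> cont_on A (fun x => \big[Num.max/0]_(i <- s) F i x).
Proof.
move=> cF; elim: s => [|i s IH].
  by apply: (@cont_on_eq _ (fun=> 0)); [move=> x _; rewrite big_nil | exact: cont_on_cst].
apply: (@cont_on_eq _ (fun x => Num.max (F i x) (\big[Num.max/0]_(i <- s) F i x))).
  by move=> x _; rewrite big_cons.
exact: cont_on_max.
Qed.

Lemma cont_on_bigmin A (I : Type) (s : seq I) (F : I -> T -> R) :
  (forall i, cont_on A (F i)) -> cont_on A (fun x => \big[Num.min/1]_(i <- s) F i x).
Proof.
move=> cF; elim: s => [|i s IH].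
  by apply: (@cont_on_eq _ (fun=> 1)); [move=> x _; rewrite big_nil | exact: cont_on_cst].
apply: (@cont_on_eq _ (fun x => Num.min (F i x) (\big[Num.min/1]_(i <- s) F i x))).
  by move=> x _; rewrite big_cons.
exact: cont_on_min.
Qed.

Lemma cont_on_continuous A f : continuous f -> cont_on A f.
Proof. by move=> cf x Ax; apply: cvg_trans (cf x); apply: cvg_app; exact: cvg_within. Qed.

Lemma cont_on_setT f : cont_on setT f -> continuous f.
Proof.
move=> cf x U Uf; have := cf x Logic.I U Uf.
by rewrite /nbhs /= /within /=; apply: filterS => y; exact.
Qed.

(** Pasting works because a limit point outside a closed piece has a neighbourhood missing that
    piece, which therefore imposes no condition there. *)
Lemma cont_on_glue A B f g : closed A -> closed B ->
  (forall x, A x -> B x -> f x = g x) -> cont_on A f -> cont_on B g ->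
  cont_on (A `|` B) (fun x => if `[< A x >] then f x else g x).
Proof.
move=> clA clB fg cf cg x ABx.
set h := fun x => _.
have hA y : A y -> h y = f y by move=> Ay; rewrite /h; case: asboolP.
have hB y : B y -> h y = g y.
  by move=> By; rewrite /h; case: asboolP => // Ay; exact: fg.
suff loc C k : closed C -> (forall y, C y -> h y = k y) -> cont_on C k ->
    forall U, nbhs (h x) U -> \forall y \near x, C y -> U (h y).
  move=> U Uh; rewrite /nbhs /= /within /=.
  have nA := loc A f clA hA cf U Uh; have nB := loc B g clB hB cg U Uh.
  by near=> y => -[Ay|By]; [apply: (near nA y) | apply: (near nB y)].
move=> clC hC ck U Uh.
have [Cx|nCx] := pselect (C x).
  have ck' := ck x Cx; rewrite (hC x Cx) in Uh.
  have := ck' U Uh; rewrite /nbhs /= /within /=.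
  by apply: filterS => y Uy Cy; rewrite hC //; exact: Uy.
have : nbhs x (~` C) by apply: open_nbhs_nbhs; split => //; rewrite openC.
by apply: filterS => y nCy.
Unshelve. all: by end_near. Qed.

End ContOn.

Lemma cont_on_comp (R : realType) (S T : topologicalType) (A : set S) (B : set T)
    (p : S -> T) (f : T -> R) :
  (forall x, A x -> B (p x)) ->
  (forall x, A x -> p y @[y --> within A (nbhs x)] --> p x) ->
  cont_on B f -> cont_on A (f \o p).
Proof.
move=> AB cp cf x Ax.
have cfx := cf _ (AB _ Ax).
apply: cvg_trans cfx => U /= Uf.
rewrite /nbhs /= /within /= in Uf *.
have := cp x Ax _ Uf; rewrite /nbhs /= /within /=.
by apply: filterS => y + Ay; apply => //; exact: AB.
Qed.

(** * Finitely supported maps into a simplicial complex *)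

Definition face_closed (V : eqType) (F : complex V) : Prop :=
  forall s t : seq V, {subset t <= s} -> F s -> F t.

Definition weights_on (R : realType) (V : eqType) (S : seq V) (t : V -> R) : Prop :=
  [/\ forall v, 0 <= t v, forall v, v \notin S -> t v = 0 & \sum_(v <- S) t v = 1].

(* On a compact set these are the maps continuous into the realization with
   its coherent topology. *)
Definition simplicial_map (R : realType) (T : topologicalType) (V : eqType)
    (A : set T) (F : complex V) (f : T -> V -> R) : Prop :=
  [/\ exists S, uniq S /\ forall x, A x -> weights_on S (f x),
      forall x, A x -> forall s, (forall v, v \in s -> 0 < f x v) -> F s &
      forall v, cont_on A (f^~ v)].

Section Weights.
Variables (R : realType) (V : eqType).
Implicit Types (t : V -> R) (S : seq V).

Lemma sum_enlarge S S' t : uniq S -> uniq S' -> {subset S <= S'} ->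
  (forall v, v \notin S -> t v = 0) -> \sum_(v <- S') t v = \sum_(v <- S) t v.
Proof.
move=> uS uS' SS' t0.
rewrite [LHS](bigID [in S]) /= [X in _ + X]big1 => [|v]; last exact: t0.
rewrite addr0 -big_filter; apply: perm_big; apply: uniq_perm => //.
  exact: filter_uniq.
by move=> v; rewrite mem_filter; case: (boolP (v \in S)) => //= /SS'.
Qed.

Lemma weights_enlarge S S' t : uniq S -> uniq S' -> {subset S <= S'} ->
  weights_on S t -> weights_on S' t.
Proof.
move=> uS uS' SS' [t0 tS t1]; split=> //; last by rewrite (sum_enlarge uS).
by move=> v /negP vS'; apply: tS; apply/negP => /SS'.
Qed.

Lemma weights_cvx S S' t t' a : uniq S -> uniq S' -> 0 <= a <= 1 ->
  weights_on S t -> weights_on S' t' ->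
  weights_on (undup (S ++ S')) (fun v => (1 - a) * t v + a * t' v).
Proof.
move=> uS uS' /andP[a0 a1] wt wt'.
have uU : uniq (undup (S ++ S')) by exact: undup_uniq.
have [] := weights_enlarge uS uU _ wt.
  by move=> v vS; rewrite mem_undup mem_cat vS.
move=> t0 tS t1.
have [] := weights_enlarge uS' uU _ wt'.
  by move=> v vS; rewrite mem_undup mem_cat vS orbT.
move=> t0' tS' t1'; split.
- by move=> v; rewrite addr_ge0 // mulr_ge0 // subr_ge0.
- by move=> v vS; rewrite tS // tS' // !mulr0 addr0.
- by rewrite big_split -!mulr_sumr /= t1 t1' !mulr1 subrK.
Qed.

Lemma weights_dirac (v : V) : weights_on [:: v] (fun u => (u == v)%:R : R).
Proof.
split=> [u|u|]; first exact: ler0n.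
  by rewrite inE => /negPf ->.
by rewrite big_seq1 eqxx.
Qed.

End Weights.

Section SimplicialMap.
Variables (R : realType) (T : topologicalType) (V : eqType).
Implicit Types (A B : set T) (F G : complex V) (f g : T -> V -> R).

Lemma smap_weights A F f : simplicial_map A F f ->
  exists S, uniq S /\ forall x, A x -> weights_on S (f x).
Proof. by case. Qed.

Lemma smap_sub A B F f : B `<=` A -> simplicial_map A F f -> simplicial_map B F f.
Proof.
move=> BA [[S [uS wS]] Ff cf]; split.
- by exists S; split=> // x /BA; exact: wS.
- by move=> x /BA; exact: Ff.
- by move=> v; exact: cont_on_sub BA (cf v).
Qed.

Lemma smap_mono A F G f : (forall s, F s -> G s) ->
  simplicial_map A F f -> simplicial_map A G f.
Proof. by move=> FG [Sf Ff cf]; split=> // x Ax s /(Ff x Ax)/FG. Qed.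

Lemma smap_glue A B F f g : closed A -> closed B ->
  (forall x, A x -> B x -> f x = g x) ->
  simplicial_map A F f -> simplicial_map B F g ->
  simplicial_map (A `|` B) F (fun x => if `[< A x >] then f x else g x).
Proof.
move=> clA clB fg [[S [uS wS]] Ff cf] [[S' [uS' wS']] Fg cg]; split.
- exists (undup (S ++ S')); split; first exact: undup_uniq.
  have SU : {subset S <= undup (S ++ S')}.
    by move=> v vS; rewrite mem_undup mem_cat vS.
  have SU' : {subset S' <= undup (S ++ S')}.
    by move=> v vS; rewrite mem_undup mem_cat vS orbT.
  move=> x ABx; case: asboolP => Ax.
    exact: weights_enlarge uS (undup_uniq _) SU (wS x Ax).
  by case: ABx => // Bx; exact: weights_enlarge uS' (undup_uniq _) SU' (wS' x Bx).
- move=> x ABx s; case: asboolP => Ax; first exact: Ff.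
  by case: ABx => // Bx; exact: Fg.
- move=> v; apply: (@cont_on_eq _ _ _ (fun x => if `[< A x >] then f x v else g x v)).
    by move=> x _; case: asboolP.
  by apply: cont_on_glue => // x Ax Bx; rewrite fg.
Qed.

Lemma smap_cvx A F f g (a : T -> R) :
  (exists S, uniq S /\ forall x, A x -> weights_on S (f x)) ->
  (exists S, uniq S /\ forall x, A x -> weights_on S (g x)) ->
  (forall v, cont_on A (f^~ v)) -> (forall v, cont_on A (g^~ v)) ->
  cont_on A a -> (forall x, A x -> 0 <= a x <= 1) ->
  (forall x, A x -> forall s,
     (forall v, v \in s -> 0 < (1 - a x) * f x v + a x * g x v) -> F s) ->
  simplicial_map A F (fun x v => (1 - a x) * f x v + a x * g x v).
Proof.
move=> [S [uS wS]] [S' [uS' wS']] cf cg ca a01 Ffg; split=> //.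
- exists (undup (S ++ S')); split; first exact: undup_uniq.
  by move=> x Ax; apply: weights_cvx => //; [exact: a01|exact: wS|exact: wS'].
- move=> v; apply: cont_onD; apply: cont_onM => //.
  by apply: cont_onB => //; exact: cont_on_cst.
Qed.

End SimplicialMap.

Lemma smap_comp (R : realType) (T T' : topologicalType) (V : eqType) (A : set T)
    (B : set T') (F : complex V) (p : T -> T') (f : T' -> V -> R) :
  (forall x, A x -> B (p x)) ->
  (forall x, A x -> p y @[y --> within A (nbhs x)] --> p x) ->
  simplicial_map B F f -> simplicial_map A F (f \o p).
Proof.
move=> AB cp [[S [uS wS]] Ff cf]; split.
- by exists S; split=> // x /AB; exact: wS.
- by move=> x /AB; exact: Ff.
- by move=> v; exact: (cont_on_comp AB cp (cf v)).
Qed.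

(** * Boxes and connectivity *)

Section Box.
Variables (R : realType) (N : nat).
Implicit Types lo hi x : 'rV[R]_N.+1.

Definition box lo hi : set 'rV[R]_N.+1 :=
  [set x | forall i, lo ord0 i <= x ord0 i <= hi ord0 i].

(** Only nondegenerate coordinates count: for a lower-dimensional box this is the relative boundary,
    and it is empty for a point. The cells of a grid are thus boxes in the same ambient space. *)
Definition box_boundary lo hi : set 'rV[R]_N.+1 :=
  [set x | box lo hi x /\ exists i, lo ord0 i < hi ord0 i /\
     (x ord0 i = lo ord0 i \/ x ord0 i = hi ord0 i)].

Definition box_dim lo hi : nat := #|[pred i | lo ord0 i < hi ord0 i]|.

Lemma cont_on_coord (A : set 'rV[R]_N.+1) i : cont_on A (fun x => x ord0 i).
Proof. by apply: cont_on_continuous; exact: coord_continuous. Qed.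

Lemma closed_coord_le (a : R) i : closed [set x : 'rV[R]_N.+1 | x ord0 i <= a].
Proof.
have := @closed_comp _ _ (fun x : 'rV[R]_N.+1 => x ord0 i) [set y | y <= a].
apply=> //; first by move=> x _; exact: coord_continuous.
Qed.

Lemma closed_coord_ge (a : R) i : closed [set x : 'rV[R]_N.+1 | a <= x ord0 i].
Proof.
have := @closed_comp _ _ (fun x : 'rV[R]_N.+1 => x ord0 i) [set y | a <= y].
apply=> //; first by move=> x _; exact: coord_continuous.
Qed.

Lemma closed_box lo hi : closed (box lo hi).
Proof.
have -> : box lo hi = \bigcap_i ([set x | lo ord0 i <= x ord0 i] `&`
    [set x | x ord0 i <= hi ord0 i]).
  apply/seteqP; split=> x /= H i; first by move=> _; have /andP[] := H i.
  by have [? ?] := H i I; apply/andP.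
by apply: closed_bigI => i _; apply: closedI; [exact: closed_coord_ge|exact: closed_coord_le].
Qed.

Lemma compact_box lo hi : compact (box lo hi).
Proof.
have -> : box lo hi = [set v : 'rV[R]_N.+1 | forall i, `[lo ord0 i, hi ord0 i]%classic (v ord0 i)].
  by apply/seteqP; split=> x /= H i; have := H i; rewrite in_itv.
by apply: (rV_compact (A := fun i => `[lo ord0 i, hi ord0 i]%classic)) => i; exact: segment_compact.
Qed.

Lemma closed_boundary lo hi : closed (box_boundary lo hi).
Proof.
have -> : box_boundary lo hi = box lo hi `&` \bigcup_(i in [set i | lo ord0 i < hi ord0 i])
   (([set x | lo ord0 i <= x ord0 i] `&` [set x | x ord0 i <= lo ord0 i]) `|`
    ([set x | hi ord0 i <= x ord0 i] `&` [set x | x ord0 i <= hi ord0 i])).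
  apply/seteqP; split=> x /= [bx].
    by move=> [i [lt_i xi]]; split=> //; exists i => //=; case: xi => ->; [left|right].
  move=> [i /= lt_i xi]; split=> //; exists i; split=> //.
  by case: xi => -[/= h1 h2]; [left|right]; apply/eqP; rewrite eq_le h1 h2.
apply: closedI; first exact: closed_box.
apply: closed_bigcup => [|i _]; first exact: finite_finset.
apply: closedU; apply: closedI; (exact: closed_coord_le || exact: closed_coord_ge).
Qed.

Lemma compact_boundary lo hi : compact (box_boundary lo hi).
Proof.
have sub : box_boundary lo hi `<=` box lo hi by move=> x [].
exact: (subclosed_compact (@closed_boundary lo hi) (@compact_box lo hi) sub).
Qed.

End Box.
Arguments closed_box {R N} lo hi.
Arguments closed_boundary {R N} lo hi.
Arguments compact_box {R N} lo hi.
Arguments compact_boundary {R N} lo hi.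

(* [conn F e] is (e - 2)-connectedness: a boundary of a box with [i]
   nondegenerate coordinates is a sphere of dimension [i - 1]. *)
Definition conn (R : realType) (V : eqType) (F : complex V) (e : nat) : Prop :=
  forall (N : nat) (lo hi : 'rV[R]_N.+1), (forall i, lo ord0 i <= hi ord0 i) ->
  (box_dim lo hi < e)%N ->
  forall f : 'rV[R]_N.+1 -> V -> R, simplicial_map (box_boundary lo hi) F f ->
  exists g : 'rV[R]_N.+1 -> V -> R, simplicial_map (box lo hi) F g /\
    forall x, box_boundary lo hi x -> g x = f x.


(** * Collars of boxes and homotopy extension *)

Section Collar.
Variables (R : realType) (N : nat) (lo hi : 'rV[R]_N.+1).
Hypothesis lohi : forall i, lo ord0 i <= hi ord0 i.
Implicit Type x : 'rV[R]_N.+1.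

Let mid : 'rV[R]_N.+1 := 2^-1 *: (lo + hi).
Let half i : R := (hi ord0 i - lo ord0 i) / 2.

(* Sup-norm distance to the centre, normalized to be 1 on the boundary; the
   convention [x / 0 = 0] removes the degenerate coordinates. *)
Definition box_rad (x : 'rV[R]_N.+1) : R :=
  \big[Num.max/0]_i (`|x ord0 i - mid ord0 i| / half i).

(** Radial stretching from the centre: the half-size box is dilated by 2 onto the whole box, and the
    collar [box_rad >= 1/2] is sent to the boundary. *)
Definition box_push (x : 'rV[R]_N.+1) : 'rV[R]_N.+1 :=
  mid + (Num.max (box_rad x) 2^-1)^-1 *: (x - mid).

Let midE i : mid ord0 i = (lo ord0 i + hi ord0 i) / 2.
Proof. by rewrite !mxE mulrC. Qed.

Let half_ge0 i : 0 <= half i.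
Proof. by rewrite divr_ge0 // subr_ge0. Qed.

Let boxP x : box lo hi x <-> forall i, `|x ord0 i - mid ord0 i| <= half i.
Proof.
split=> H i; have := H i; rewrite midE /half.
  by move=> /andP[h1 h2]; rewrite ler_norml; apply/andP; split; lra.
by rewrite ler_norml => /andP[h1 h2]; apply/andP; split; lra.
Qed.

Let rad_coord x i : `|x ord0 i - mid ord0 i| / half i <= box_rad x.
Proof. exact: le_bigmax. Qed.

Lemma cont_box_rad A : cont_on A box_rad.
Proof.
apply: cont_on_bigmax => i; apply: cont_onM; last exact: cont_on_cst.
by apply: cont_on_norm; apply: cont_onB; [exact: cont_on_coord | exact: cont_on_cst].
Qed.

Lemma box_rad_le1 x : box lo hi x -> box_rad x <= 1.
Proof.
move=> /boxP bx; apply: bigmax_le => // i _.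
have [h0|h0] := eqVneq (half i) 0; first by rewrite h0 invr0 mulr0.
by rewrite ler_pdivrMr ?mul1r // lt_neqAle eq_sym h0 half_ge0.
Qed.

Lemma box_rad_boundary x : box_boundary lo hi x -> box_rad x = 1.
Proof.
move=> [bx [i [lt_i xi]]]; apply/eqP; rewrite eq_le box_rad_le1 //=.
apply: le_trans (rad_coord x i).
have hp : 0 < half i by rewrite divr_gt0 // subr_gt0.
rewrite ler_pdivlMr // mul1r midE /half.
case: xi => ->; last first.
  rewrite ger0_norm; lra.
rewrite ler0_norm; lra.
Qed.

Let m_gt0 x : 0 < Num.max (box_rad x) 2^-1.
Proof. by rewrite lt_max invr_gt0 ltr0n orbT. Qed.

Let pushE x i : box_push x ord0 i - mid ord0 i =
  (Num.max (box_rad x) 2^-1)^-1 * (x ord0 i - mid ord0 i).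
Proof. by rewrite !mxE; ring. Qed.

Lemma box_push_box x : box lo hi x -> box lo hi (box_push x).
Proof.
move=> /boxP bx; apply/boxP => i; rewrite pushE normrM gtr0_norm ?invr_gt0 //.
rewrite ler_pdivrMl //.
have [h0|h0] := eqVneq (half i) 0.
  by have := bx i; rewrite h0 mulr0.
have hp : 0 < half i by rewrite lt_neqAle eq_sym h0 half_ge0.
rewrite -ler_pdivrMr // le_max; apply/orP; left; exact: rad_coord.
Qed.

Lemma box_push_boundary x : box lo hi x -> 2^-1 <= box_rad x ->
  box_boundary lo hi (box_push x).
Proof.
move=> bx rx; split; first exact: box_push_box.
have [i _ ri] : {i0 : 'I_N.+1 | i0 \in predT & box_rad x = `|x ord0 i0 - mid ord0 i0| / half i0}.
  by apply: (eq_bigmax ord0) => // i _; rewrite divr_ge0.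
have r0 : 0 < box_rad x by apply: lt_le_trans rx; rewrite invr_gt0 ltr0n.
have h0 : half i != 0.
  by apply/eqP => h0; move: r0; rewrite ri h0 invr0 mulr0 ltxx.
have hp : 0 < half i by rewrite lt_neqAle eq_sym h0 half_ge0.
exists i; split; first by move: hp; rewrite /half; lra.
have := pushE x i; rewrite (max_idPl rx) => E.
have : `|box_push x ord0 i - mid ord0 i| = half i.
  rewrite E normrM gtr0_norm ?invr_gt0 // -[X in _ * X](divfK h0) -ri.
  by rewrite mulrA mulVf ?mul1r // gt_eqF.
move: hp; rewrite midE /half.
case: ger0P => _ hp E'; [right|left]; lra.
Qed.

Lemma box_push_id x : box_rad x = 1 -> box_push x = x.
Proof.
move=> rx; rewrite /box_push rx.
have -> : Num.max 1 2^-1 = 1 :> R by apply/max_idPl; lra.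
by rewrite invr1 scale1r addrC subrK.
Qed.

Lemma cont_box_push A x : A x -> box_push y @[y --> within A (nbhs x)] --> box_push x.
Proof.
move=> Ax; apply: cvgD; first exact: cvg_cst.
apply: cvgZ; last by apply: cvgB; [exact: cvg_within | exact: cvg_cst].
apply: (cont_onV _ _ Ax); first by move=> y _; rewrite gt_eqF.
by apply: cont_on_max; [exact: cont_box_rad | exact: cont_on_cst].
Qed.

Variables (V : eqType) (F : complex V).

(* The straight-line homotopy is spread over the collar [box_rad >= 1/2]. *)
Lemma slide_extend (f0 f1 g1 : 'rV[R]_N.+1 -> V -> R) :
  simplicial_map (box_boundary lo hi) F f0 ->
  simplicial_map (box lo hi) F g1 ->
  (forall x, box_boundary lo hi x -> g1 x = f1 x) ->
  (forall x, box_boundary lo hi x -> forall s,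
     (forall v, v \in s -> 0 < f0 x v \/ 0 < f1 x v) -> F s) ->
  exists g0, simplicial_map (box lo hi) F g0 /\
    forall x, box_boundary lo hi x -> g0 x = f0 x.
Proof.
move=> sf0 sg1 g1f1 F01.
pose A := box lo hi `&` [set x | box_rad x <= 2^-1].
pose B := box lo hi `&` [set x | 2^-1 <= box_rad x].
have crad : continuous box_rad.
  by apply: cont_on_setT; exact: cont_box_rad.
have clA : closed A.
  apply: closedI; first exact: closed_box.
  by apply: (closed_comp _ (@closed_le R 2^-1)) => x _; exact: crad.
have clB : closed B.
  apply: closedI; first exact: closed_box.
  by apply: (closed_comp _ (@closed_ge R 2^-1)) => x _; exact: crad.
have AB : A `|` B = box lo hi.
  apply/seteqP; split=> x; first by case=> -[].
  by move=> bx; have [|/ltW] := leP (box_rad x) 2^-1; [left|right].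
(* The parameter runs from 1 on the inner wall [box_rad = 1/2] of the collar, where [g1] takes over,
   to 0 on the boundary, where [f0] is prescribed. *)
pose a x : R := 2 * (1 - box_rad x).
have Bpush x : B x -> box_boundary lo hi (box_push x).
  by move=> [bx rx]; exact: box_push_boundary.
have sB : simplicial_map B F
    (fun x v => (1 - a x) * (f0 \o box_push) x v + a x * (g1 \o box_push) x v).
  have s0 : simplicial_map B F (f0 \o box_push).
    by apply: smap_comp sf0 => // x Bx; exact: cont_box_push.
  have s1 : simplicial_map B F (g1 \o box_push).
    apply: (smap_comp (B := box lo hi)) sg1; first by move=> x [bx _]; exact: box_push_box.
    by move=> x Bx; exact: cont_box_push.
  have a01 x : B x -> 0 <= a x <= 1.
    by move=> [bx /= rx]; rewrite /a; have := box_rad_le1 bx; move=> h; apply/andP; split; lra.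
  apply: smap_cvx => //.
  - exact: smap_weights s0.
  - exact: smap_weights s1.
  - by case: s0.
  - by case: s1.
  - apply: cont_onM; first exact: cont_on_cst.
    by apply: cont_onB; [exact: cont_on_cst | exact: cont_box_rad].
  - move=> x Bx s sp; apply: (F01 _ (Bpush x Bx)) => v /sp /=.
    rewrite (g1f1 _ (Bpush x Bx)).
    have [f0x|f0x] := ltP 0 (f0 (box_push x) v); first by left.
    have [f1x|f1x] := ltP 0 (f1 (box_push x) v); first by right.
    have /andP[a0 a1] := a01 x Bx => H; exfalso.
    have : (1 - a x) * f0 (box_push x) v <= 0 by rewrite mulr_ge0_le0 // subr_ge0.
    have : a x * f1 (box_push x) v <= 0 by rewrite mulr_ge0_le0.
    lra.
have sA : simplicial_map A F (g1 \o box_push).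
  apply: (smap_comp (B := box lo hi)) sg1; first by move=> x [bx _]; exact: box_push_box.
  by move=> x Ax; exact: cont_box_push.
have agree x : A x -> B x -> (g1 \o box_push) x =
    (fun v => (1 - a x) * (f0 \o box_push) x v + a x * (g1 \o box_push) x v).
  move=> [_ /= r1] [_ /= r2]; apply/funext => v /=.
  have -> : a x = 1 by rewrite /a; lra.
  by rewrite subrr mul0r add0r mul1r.
have := smap_glue clA clB agree sA sB; rewrite AB.
set g := (X in simplicial_map _ _ X) => sg; exists g; split=> // x bx.
have rx := box_rad_boundary bx; apply/funext => v; rewrite /g.
case: asboolP => [[_ /=]|_]; first by rewrite rx leNgt invf_lt1 ?ltr1n ?ltr0n.
by rewrite /= box_push_id // /a rx subrr mulr0 subr0 mul1r mul0r addr0.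
Qed.

End Collar.

(** A map into a cone spans simplices with the apex [v] pointwise, so it slides to the constant map
    at [v], which extends over the box. *)
Lemma conn_cone (R : realType) (V : eqType) (F : complex V) (v : V) e :
  (forall s, F s -> F (v :: s)) -> F [::] -> face_closed F -> @conn R V F e.
Proof.
move=> Fv F0 cF N lo hi lohi _ f sf.
have sg : simplicial_map (box lo hi) F (fun _ u => (u == v)%:R : R).
  split.
  - by exists [:: v]; split=> // x _; exact: weights_dirac.
  - move=> x _ s sp; apply: cF (Fv _ F0) => u /sp.
    by rewrite inE; case: (u == v); rewrite ?ltxx.
  - by move=> u; exact: cont_on_cst.
apply: (slide_extend lohi sf sg (f1 := fun _ u => (u == v)%:R)) => // x bx s sp.
have [_ Ff _] := sf.
have : F (v :: [seq u <- s | 0 < f x u]).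
  by apply: Fv; apply: (Ff x bx) => u; rewrite mem_filter => /andP[].
apply: cF => u us; rewrite inE mem_filter us andbT.
by case: (sp u us) => [->|]; rewrite ?orbT //; case: (u == v); rewrite ?ltxx.
Qed.


(** * Subdividing a box into a grid *)

Section Grid.
Variables (R : realType) (N M : nat) (lo hi : 'rV[R]_N.+1).
Hypothesis lohi : forall i, lo ord0 i <= hi ord0 i.
Hypothesis M0 : (0 < M)%N.

Definition grid_pt (i : 'I_N.+1) (a : nat) : R :=
  lo ord0 i + (hi ord0 i - lo ord0 i) * (a%:R / M%:R).

(* In each coordinate the index [2a] stands for the grid point [a] and [2a+1]
   for the interval from [a] to [a+1]. *)
Definition cell_index := {ffun 'I_N.+1 -> 'I_(M.*2.+1)}.
Implicit Types k l : cell_index.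

Definition cell_lo k : 'rV[R]_N.+1 := \row_i grid_pt i (k i)./2.
Definition cell_hi k : 'rV[R]_N.+1 := \row_i grid_pt i (uphalf (k i)).
Definition cell k := box (cell_lo k) (cell_hi k).
(** All grid points of a degenerate coordinate coincide. Forcing the index 0 there makes the index
    of a cell unique and makes odd indices mark exactly the nondegenerate coordinates of the
    cell. *)
Definition cell_valid k := forall i, lo ord0 i = hi ord0 i -> k i = 0%N :> nat.
Definition cell_dim k := box_dim (cell_lo k) (cell_hi k).

(** The boolean lets one argument treat maps of spheres ([true]) and of discs ([false]). *)
Definition box_part (b : bool) := if b then box_boundary lo hi else box lo hi.
Definition cell_in (b : bool) k := cell_valid k /\
  (b -> exists i, lo ord0 i < hi ord0 i /\ (k i = 0%N :> nat \/ k i = M.*2 :> nat)).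

Let MR : (0 : R) < M%:R. Proof. by rewrite ltr0n. Qed.

Lemma grid_pt_le i a b : (a <= b)%N -> grid_pt i a <= grid_pt i b.
Proof.
by move=> ab; rewrite lerD2l ler_wpM2l ?subr_ge0 // ler_pM2r ?invr_gt0 // ler_nat.
Qed.

Lemma grid_pt_inj i a b : lo ord0 i < hi ord0 i -> grid_pt i a = grid_pt i b -> a = b.
Proof.
move=> lt_i /addrI /(mulfI _) E; apply/eqP; rewrite -(eqr_nat R); apply/eqP.
have /mulIf : M%:R^-1 != 0 :> R by rewrite invr_eq0 gt_eqF.
by apply; apply: E; rewrite subr_eq0 gt_eqF.
Qed.

Lemma grid_pt0 i : grid_pt i 0 = lo ord0 i.
Proof. by rewrite /grid_pt mul0r mulr0 addr0. Qed.

Lemma grid_ptM i : grid_pt i M = hi ord0 i.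
Proof. by rewrite /grid_pt divff ?gt_eqF // mulr1 addrC subrK. Qed.

Lemma cell_lohi k i : cell_lo k ord0 i <= cell_hi k ord0 i.
Proof. by rewrite !mxE grid_pt_le // uphalf_half leq_addl. Qed.

Lemma cellP k x : cell k x <->
  forall i, grid_pt i (k i)./2 <= x ord0 i <= grid_pt i (uphalf (k i)).
Proof. by split=> H i; have := H i; rewrite !mxE. Qed.

Let uphalf_leM (a : nat) : (a <= M.*2)%N -> (uphalf a <= M)%N.
Proof. by move=> ?; lia. Qed.

Let ord_leM (a : 'I_(M.*2.+1)) : (a <= M.*2)%N.
Proof. by rewrite -ltnS ltn_ord. Qed.

Lemma cell_sub_box k x : cell k x -> box lo hi x.
Proof.
move=> /cellP kx i; have /andP[h1 h2] := kx i; apply/andP; split.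
  by apply: le_trans h1; rewrite -grid_pt0 grid_pt_le.
by apply: (le_trans h2); rewrite -grid_ptM grid_pt_le // uphalf_leM.
Qed.

Lemma cell_sub_part b k x : cell_in b k -> cell k x -> box_part b x.
Proof.
case: b => -[_ kin] kx; last exact: cell_sub_box kx.
split; first exact: cell_sub_box kx.
have [i [lt_i ki]] := kin isT; exists i; split=> //.
have /cellP/(_ i) := kx; case: ki => -> /=.
  by rewrite grid_pt0 => h; left; apply/eqP; rewrite eq_le andbC.
by rewrite uphalf_double doubleK grid_ptM => h; right; apply/eqP; rewrite eq_le andbC.
Qed.

Let locate i (x : R) m : grid_pt i 0 <= x -> x <= grid_pt i m -> (0 < m)%N ->
  exists a, (a < m)%N /\ grid_pt i a <= x <= grid_pt i a.+1.
Proof.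
move=> x0; elim: m => // m IH xm _.
have [xm'|/ltW mx] := leP x (grid_pt i m); last by exists m; rewrite ltnSn mx xm.
case: m IH xm xm' => [|m] IH xm xm'; first by exists 0%N; rewrite x0 xm.
by have [a [am ax]] := IH xm' isT; exists a; split=> //; exact: ltnW.
Qed.

Lemma part_covered b x : box_part b x -> exists k, cell_in b k /\ cell k x.
Proof.
move=> bx.
have bx' : box lo hi x by case: b bx => // -[].
have H i : exists a : 'I_(M.*2.+1),
    [/\ grid_pt i a./2 <= x ord0 i <= grid_pt i (uphalf a),
        lo ord0 i = hi ord0 i -> a = 0%N :> nat &
        x ord0 i = lo ord0 i \/ x ord0 i = hi ord0 i ->
        (a = 0%N :> nat \/ a = M.*2 :> nat)].
  have /andP[xlo xhi] := bx' i.
  (* An end point must receive an extreme even index; otherwise a boundary point could be put into a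
     cell that is not contained in the boundary. *)
  have [xl|xl] := eqVneq (x ord0 i) (lo ord0 i).
    exists ord0; split=> //=; last by left.
    by rewrite grid_pt0 xl lexx.
  have [xh|xh] := eqVneq (x ord0 i) (hi ord0 i).
    exists ord_max; split=> //=; last by right.
      by rewrite uphalf_double doubleK grid_ptM xh lexx.
    by move=> E; case/eqP: xl; rewrite E xh.
  have [|||a [aM ax]] := @locate i (x ord0 i) M => //.
  - by rewrite grid_pt0.
  - by rewrite grid_ptM.
  have aM2 : (a.*2.+1 < M.*2.+1)%N by rewrite ltnS ltn_double.
  exists (Ordinal aM2); split=> /=.
  - by rewrite uphalf_double doubleK.
  - move=> E; case/eqP: xl; apply/eqP; rewrite eq_le xlo andbT.
    by rewrite E.
  - by case=> E; [case/eqP: xl|case/eqP: xh].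
have [kf Hk] := choice H.
exists [ffun i => kf i]; split.
  split=> [i E|bT]; first by rewrite ffunE; have [_ + _] := Hk i; apply.
  case: b bx bT => // -[_ [i [lt_i xi]]] _.
  by exists i; split=> //; rewrite ffunE; have [_ _] := Hk i; apply.
by apply/cellP => i; rewrite ffunE; have [] := Hk i.
Qed.

Lemma cell_ltE k i : cell_valid k -> (cell_lo k ord0 i < cell_hi k ord0 i) = odd (k i).
Proof.
move=> vk; rewrite !mxE.
have [ok|ek] := boolP (odd (k i)).
  have lt_i : lo ord0 i < hi ord0 i.
    rewrite lt_neqAle lohi andbT; apply/eqP => /vk E; by rewrite E in ok.
  rewrite lt_neqAle grid_pt_le ?andbT; last by lia.
  by apply/eqP => /(grid_pt_inj lt_i); lia.
have -> : uphalf (k i) = (k i)./2 by lia.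
by rewrite ltxx.
Qed.

Lemma cell_dimE k : cell_valid k -> cell_dim k = #|[pred i | odd (k i)]|.
Proof. by move=> vk; apply: eq_card => i; rewrite !inE cell_ltE. Qed.

Lemma cell_dim_lt b k : cell_in b k -> (cell_dim k + b <= box_dim lo hi)%N.
Proof.
move=> [vk kin]; rewrite cell_dimE //.
have oddlt i : odd (k i) -> lo ord0 i < hi ord0 i.
  by move=> ok; rewrite lt_neqAle lohi andbT; apply/eqP => /vk E; rewrite E in ok.
case: b kin => [/(_ isT) [j [lt_j kj]]|_]; last first.
  by rewrite addn0; apply: subset_leq_card; apply/fintype.subsetP => i; rewrite !inE; exact: oddlt.
rewrite addn1; apply: proper_card; apply/fintype.properP; split.
  by apply/fintype.subsetP => i; rewrite !inE; exact: oddlt.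
by exists j; rewrite !inE //; case: kj => ->; rewrite ?odd_double.
Qed.

(** In a coordinate where [x] is extremal the odd index is replaced by its even neighbour. A
    coordinate showing that the cell lies in the boundary of the large box has an even index and is
    not affected. *)
Lemma cell_face b k x : cell_in b k -> box_boundary (cell_lo k) (cell_hi k) x ->
  exists l, [/\ cell_in b l, cell l x & (cell_dim l < cell_dim k)%N].
Proof.
move=> [vk kin] [/cellP kx [i []]]; rewrite cell_ltE // !mxE => oki xi.
have ki : (0 < k i)%N by case: (k i : nat) oki.
have kM : (k i < M.*2)%N.
  by rewrite ltn_neqAle ord_leM andbT; apply/eqP => E; rewrite E odd_double in oki.
have [a [ea [aM xa]]] : exists a, ~~ odd a /\ (a < M.*2.+1)%N /\ x ord0 i = grid_pt i a./2.
  case: xi => ->; [exists (k i).-1|exists (k i).+1]; split; try lia; split; try lia.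
    by congr grid_pt; lia.
  by congr grid_pt; lia.
pose l : cell_index := [ffun j => if j == i then Ordinal aM else k j].
have li : l i = a :> nat by rewrite ffunE eqxx.
have lj j : j != i -> l j = k j by move=> ji; rewrite ffunE (negPf ji).
have vl : cell_valid l.
  move=> j E; have [ji|ji] := eqVneq j i; last by rewrite lj //; exact: vk.
  by have := vk j E; rewrite ji => E'; rewrite E' in ki.
exists l; split.
- split=> // /kin [j [lt_j kj]]; exists j; split=> //; rewrite lj //.
  by apply/eqP => E; move: kj; rewrite E; case=> E'; rewrite E' ?odd_double in oki.
- apply/cellP => j; have [->|ji] := eqVneq j i; last by rewrite lj.
  rewrite li xa; have -> : uphalf a = a./2 by lia.
  by rewrite lexx.
- rewrite !cell_dimE //; apply: proper_card; apply/fintype.properP; split.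
    apply/fintype.subsetP => j; rewrite !inE; have [->|ji] := eqVneq j i; last by rewrite lj.
    by rewrite li (negPf ea).
  by exists i; rewrite !inE // li.
Qed.

(** A relative interior point of [cell k] meets only cells having [cell k] as a face: where [k] has
    an odd index no other index is possible at that point, and where it has an even one the
    coordinate is pinned to a grid point. *)
Lemma cell_meet k l x : cell_valid k -> cell_valid l -> cell k x -> cell l x ->
  box_boundary (cell_lo k) (cell_hi k) x \/
  (cell k `<=` cell l /\ forall i, odd (k i) -> l i = k i).
Proof.
move=> vk vl kx lx.
have [[i [oki xi]]|H] := pselect (exists i, odd (k i) /\
   (x ord0 i = grid_pt i (k i)./2 \/ x ord0 i = grid_pt i (uphalf (k i)))).
  by left; split=> //; exists i; rewrite cell_ltE // !mxE.
right.
have nH i : odd (k i) -> x ord0 i != grid_pt i (k i)./2 /\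
    x ord0 i != grid_pt i (uphalf (k i)).
  by move=> oki; split; apply/eqP => E; apply: H; exists i; split=> //; [left|right].
have /cellP kx' := kx; have /cellP lx' := lx.
have key i : [/\ grid_pt i (l i)./2 <= grid_pt i (k i)./2,
    grid_pt i (uphalf (k i)) <= grid_pt i (uphalf (l i)) &
    odd (k i) -> l i = k i].
  have /andP[k1 k2] := kx' i; have /andP[l1 l2] := lx' i.
  have [kl|lk|E] := ltngtP (k i) (l i).
  - have x1 : x ord0 i = grid_pt i (uphalf (k i)).
      apply/eqP; rewrite eq_le k2 (le_trans _ l1) // grid_pt_le //; lia.
    have ek : ~~ odd (k i).
      by apply/negP => /nH [_]; rewrite x1 eqxx.
    have e2 : (k i)./2 = uphalf (k i) by lia.
    by split; [rewrite e2 -x1 | rewrite -x1 | move=> o; rewrite o in ek].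
  - have x1 : x ord0 i = grid_pt i (k i)./2.
      apply/eqP; rewrite eq_le k1 andbT (le_trans l2) // grid_pt_le //; lia.
    have ek : ~~ odd (k i).
      by apply/negP => /nH []; rewrite x1 eqxx.
    have e2 : uphalf (k i) = (k i)./2 by lia.
    by split; [rewrite -x1 | rewrite e2 -x1 | move=> o; rewrite o in ek].
  - by rewrite (val_inj E).
split; last by move=> i; have [] := key i.
move=> y /cellP ky; apply/cellP => i; have [h1 h2 _] := key i.
by have /andP[y1 y2] := ky i; rewrite (le_trans h1 y1) (le_trans y2 h2).
Qed.

(** This allows a map to be extended over a cell of maximal dimension without disturbing the cells
    already treated. *)
Lemma cell_meet_dim k l x : cell_valid k -> cell_valid l -> cell k x -> cell l x ->
  (cell_dim l <= cell_dim k)%N -> k = l \/ box_boundary (cell_lo k) (cell_hi k) x.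
Proof.
move=> vk vl kx lx; rewrite !cell_dimE // => dim.
have [|[_ okl]] := cell_meet vk vl kx lx; first by right.
left; apply/ffunP => i.
have /subset_leqif_card [_ E] : [pred i | odd (k i)] \subset [pred i | odd (l i)].
  by apply/fintype.subsetP => j; rewrite !inE => oj; rewrite okl.
have : [pred i | odd (l i)] \subset [pred i | odd (k i)].
  by rewrite -E eqn_leq dim andbT; apply: subset_leq_card; apply/fintype.subsetP => j;
     rewrite !inE => oj; rewrite okl.
move=> /fintype.subsetP/(_ i); rewrite !inE => oil.
have [oki|nki] := boolP (odd (k i)); first by rewrite okl.
have nli : ~~ odd (l i) by apply/negP => /oil o; rewrite o in nki.
apply: val_inj => /=.
have [E'|lt_i] := eqVneq (lo ord0 i) (hi ord0 i); first by rewrite vk // vl.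
have lt_i' : lo ord0 i < hi ord0 i by rewrite lt_neqAle lt_i lohi.
have /cellP/(_ i) := kx; have /cellP/(_ i) := lx.
have -> : uphalf (l i) = (l i)./2 by lia.
have -> : uphalf (k i) = (k i)./2 by lia.
move=> /andP[l1 l2] /andP[k1 k2].
have := @grid_pt_inj i (k i)./2 (l i)./2 lt_i'.
have -> : grid_pt i (k i)./2 = x ord0 i by apply/eqP; rewrite eq_le k1 k2.
have -> : grid_pt i (l i)./2 = x ord0 i by apply/eqP; rewrite eq_le l1 l2.
move=> /(_ erefl); lia.
Qed.

Lemma cell_diam k x y i : cell k x -> cell k y ->
  `|x ord0 i - y ord0 i| <= (hi ord0 i - lo ord0 i) / M%:R.
Proof.
move=> /cellP/(_ i)/andP[x1 x2] /cellP/(_ i)/andP[y1 y2].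
have : grid_pt i (uphalf (k i)) <= grid_pt i (k i)./2 + (hi ord0 i - lo ord0 i) / M%:R.
  apply: (@le_trans _ _ (grid_pt i (k i)./2.+1)).
    by apply: grid_pt_le; lia.
  rewrite [X in X <= _](_ : _ = grid_pt i (k i)./2 + (hi ord0 i - lo ord0 i) / M%:R) //.
  by rewrite /grid_pt -natr1; ring.
by move=> h; rewrite ler_norml; apply/andP; split; lra.
Qed.

Lemma closed_cells (P : set cell_index) : closed (\bigcup_(k in P) cell k).
Proof. by apply: closed_bigcup => [|k _]; [exact: finite_finset | exact: closed_box]. Qed.

End Grid.

(** Heine-Cantor, from the covering form of compactness with the modulus [d] as the parameter
    tending to 0. *)
Lemma cont_on_uniform (R : realType) (N : nat) (K : set 'rV[R]_N.+1) (h : 'rV[R]_N.+1 -> R)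
    (eps : R) : compact K -> cont_on K h -> 0 < eps ->
  exists2 d : R, 0 < d & forall x y, K x -> K y ->
    (forall i, `|x ord0 i - y ord0 i| < d) -> `|h x - h y| < eps.
Proof.
move=> cK ch e0.
pose P (d : R) (x : 'rV[R]_N.+1) := K x -> forall y, K y ->
  (forall i, `|x ord0 i - y ord0 i| < d) -> `|h x - h y| < eps.
have /compact_near_coveringP cov := cK.
have : \forall d \near (0 : R)^'+, K `<=` P d.
  apply: cov => x Kx.
  have e2 : 0 < eps / 2 by rewrite divr_gt0.
  have /cvgr_dist_lt/(_ _ e2) := ch x Kx.
  rewrite near_withinE => /nbhs_ballP [r /= r0 rx].
  have r2 : 0 < r / 2 by rewrite divr_gt0.
  exists (ball x (r / 2), [set d : R | d < r / 2]) => /=.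
    split; first exact: nbhsx_ballx.
    exact: nbhs_right_lt.
  move=> [y d] /= [xy dr] Ky z Kz yz.
  have h1 := rx y (le_ball (ltW (_ : r / 2 < r)) xy) Ky.
  have h2 : `|h x - h z| < eps / 2.
    apply: (rx z) => //; split=> // i j; rewrite ord1.
    have [_ /(_ ord0 j)] := xy; rewrite /ball /= => xyj.
    have := yz j => yzj.
    rewrite -(subrK (y ord0 j) (x ord0 j)) -addrA.
    apply: (le_lt_trans (ler_normD _ _)); lra.
  rewrite -(subrK (h x) (h y)) -addrA; apply: (le_lt_trans (ler_normD _ _)).
  rewrite distrC; have := h1 _; move=> h1'; have : `|h x - h y| < eps / 2 by apply: h1'; lra.
  lra.
case=> r /= r0 H; exists (r / 2); first by rewrite divr_gt0.
have rr : ball (0 : R) r (r / 2).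
  by rewrite /ball /= sub0r normrN gtr0_norm ?divr_gt0 //; lra.
by move=> x y Kx; apply: (H (r / 2) rr _ x Kx Kx); rewrite divr_gt0.
Qed.


(** * Pushing maps off a simplex *)

Definition del_face (V : eqType) (F : complex V) (tau : seq V) : complex V :=
  fun s => F s /\ ~ {subset tau <= s}.

(* The join of the boundary of [tau] with the link of [tau]. *)
Definition link_boundary (V : eqType) (F : complex V) (tau : seq V) : complex V :=
  fun s => F (s ++ tau) /\ ~ {subset tau <= s}.

Section Height.
Variables (R : realType) (V : eqType) (tau : seq V).
Implicit Types t : V -> R.

Definition min_weight t : R := \big[Num.min/1]_(v <- tau) t v.

(* Barycentric weight of the barycentre of [tau] in the subdivision of the
   realization at that point. *)
Definition height t : R := (size tau)%:R * min_weight t.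

(* Radial projection away from the barycentre of [tau]; the maximum only
   matters where [height t > 3/4], and makes the formula continuous. *)
Definition radial t (v : V) : R :=
  (t v - (v \in tau)%:R * min_weight t) / Num.max (1 - height t) 4^-1.

Lemma min_weight_le t v : v \in tau -> min_weight t <= t v.
Proof.
rewrite /min_weight; elim: tau => [//|u s IH]; rewrite big_cons inE ge_min.
by case/predU1P => [->|/IH ->]; rewrite ?lexx ?orbT.
Qed.

Lemma min_weight_ge0 t : (forall v, 0 <= t v) -> 0 <= min_weight t.
Proof.
move=> t0; rewrite /min_weight; elim: tau => [|u s IH]; first by rewrite big_nil.
by rewrite big_cons le_min t0.
Qed.

(** The default value 1 of the iterated minimum is harmless because weights never exceed 1. *)
Lemma min_weight_attained t : tau != [::] -> (forall v, t v <= 1) ->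
  exists2 v, v \in tau & min_weight t = t v.
Proof.
move=> + t1; rewrite /min_weight; elim: tau => [//|u [|w s] IH] _.
  by exists u; rewrite ?inE ?eqxx // big_cons big_nil (min_idPl (t1 u)).
have [//|v vs E] := IH.
rewrite big_cons E; case: (leP (t u) (t v)) => _; first by exists u; rewrite // inE eqxx.
by exists v; rewrite // inE vs orbT.
Qed.

Lemma weights_le1 S t : weights_on S t -> forall v, t v <= 1.
Proof.
move=> [t0 tS t1] v; have [vS|/tS->] := boolP (v \in S); last exact: ler01.
rewrite -t1 (big_rem v) //= lerDl sumr_ge0 //.
Qed.

Lemma height_gt0 t : (forall v, 0 <= t v) -> 0 < height t ->
  forall v, v \in tau -> 0 < t v.
Proof.
move=> t0 h v vt; apply: lt_le_trans (min_weight_le t vt).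
rewrite lt_neqAle min_weight_ge0 // andbT; apply/eqP => E.
by rewrite /height -E mulr0 ltxx in h.
Qed.

Lemma height0 t v : tau != [::] -> (forall v, 0 <= t v) -> v \in tau -> t v = 0 -> height t = 0.
Proof.
move=> tau0 t0 vt tv; apply/eqP; rewrite mulf_eq0; apply/orP; right.
by rewrite eq_le min_weight_ge0 // andbT -tv min_weight_le.
Qed.

Let den_gt0 t : 0 < Num.max (1 - height t) 4^-1.
Proof. by rewrite lt_max invr_gt0 ltr0n orbT. Qed.

Lemma radial_ge0 t v : (forall v, 0 <= t v) -> 0 <= radial t v.
Proof.
move=> t0; apply: divr_ge0; last exact: ltW.
case: (boolP (v \in tau)) => vt; last by rewrite mul0r subr0.
by rewrite mul1r subr_ge0 min_weight_le.
Qed.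

Lemma radial_supp t v : (forall v, 0 <= t v) -> 0 < radial t v -> 0 < t v.
Proof.
move=> t0; rewrite pmulr_lgt0 ?invr_gt0 //; rewrite subr_gt0; apply: le_lt_trans.
by rewrite mulr_ge0 // min_weight_ge0.
Qed.

(** Subtracting the minimal weight at every vertex of [tau] removes the total mass [height t]; up to
    height 3/4 the denominator is exactly the remaining mass [1 - height t]. *)
Lemma radial_weights S t : uniq tau -> uniq S -> weights_on S t -> height t <= 3 / 4 ->
  weights_on S (radial t).
Proof.
move=> ut uS [t0 tS t1] h34; split.
- by move=> v; exact: radial_ge0.
- move=> v vS; rewrite /radial tS // sub0r; case: (boolP (v \in tau)) => vt; last first.
    by rewrite mul0r oppr0 mul0r.
  have -> : min_weight t = 0.
    by apply/eqP; rewrite eq_le min_weight_ge0 // andbT -(tS _ vS) min_weight_le.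
  by rewrite mulr0 oppr0 mul0r.
- rewrite -mulr_suml sumrB t1 -mulr_suml.
  have -> : (\sum_(v <- S) (v \in tau)%:R) * min_weight t = height t.
    have [m0|m0] := eqVneq (min_weight t) 0; first by rewrite /height m0 !mulr0.
    congr (_ * _).
    have tauS : {subset tau <= S}.
      move=> v vt; apply/negPn/negP => /tS tv; case/eqP: m0.
      by apply/eqP; rewrite eq_le min_weight_ge0 // andbT -tv min_weight_le.
    rewrite (sum_enlarge ut uS tauS); last by move=> v /negPf ->.
    rewrite big_seq (eq_bigr (fun=> 1)); last by move=> v ->.
    by rewrite -big_seq big_const_seq count_predT iter_addr_0.
  rewrite (max_idPl _); last lra.
  by rewrite divff //; apply/eqP; lra.
Qed.

Lemma radial0 t : height t = 0 -> (tau != [::]) -> radial t = t.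
Proof.
move=> h0 t0; apply/funext => v; rewrite /radial h0 subr0 (max_idPl _); last lra.
move: h0 => /eqP; rewrite mulf_eq0 pnatr_eq0 size_eq0 (negPf t0) /= => /eqP ->.
by rewrite mulr0 subr0 divr1.
Qed.

Variables (T : topologicalType) (A : set T) (f : T -> V -> R).
Hypothesis cf : forall v, cont_on A (f^~ v).

Lemma cont_min_weight : cont_on A (fun x => min_weight (f x)).
Proof. by apply: cont_on_bigmin. Qed.

Lemma cont_height : cont_on A (fun x => height (f x)).
Proof. by apply: cont_onM; [exact: cont_on_cst | exact: cont_min_weight]. Qed.

Lemma cont_radial v : cont_on A (fun x => radial (f x) v).
Proof.
apply: cont_onM.
  by apply: cont_onB => //; apply: cont_onM; [exact: cont_on_cst | exact: cont_min_weight].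
apply: cont_onV; first by move=> x _; rewrite gt_eqF.
apply: cont_on_max; last exact: cont_on_cst.
by apply: cont_onB; [exact: cont_on_cst | exact: cont_height].
Qed.

End Height.

Section PushOff.
Variables (R : realType) (V : eqType) (F : complex V) (tau : seq V).
Hypotheses (cF : face_closed F) (tau0 : tau != [::]) (ut : uniq tau).

Lemma face_closed_del : face_closed (del_face F tau).
Proof.
move=> s t ts [Fs ns]; split; first exact: cF Fs.
by move=> H; apply: ns => v /H/ts.
Qed.

Lemma link_boundary_sub s : link_boundary F tau s -> del_face F tau s.
Proof. by move=> [Fs ns]; split=> //; apply: cF Fs => v; rewrite mem_cat => ->. Qed.

(** A vertex of [tau] where the minimal weight is attained receives weight 0. *)
Lemma radial_omits (t : V -> R) (S s : seq V) : weights_on S t ->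
  (forall v, v \in s -> 0 < radial tau t v) -> ~ {subset tau <= s}.
Proof.
move=> wt sp sub; have [v vt E] := min_weight_attained tau0 (weights_le1 wt).
have := sp v (sub v vt); rewrite /radial vt mul1r E subrr mul0r ltxx //.
Qed.

(** On a grid cell that reaches height 3/4 the map is replaced by one into [link_boundary F tau],
    extended cell by cell using the connectivity of that complex; on the other cells it is projected
    radially. The second alternative of the conclusion keeps the lower bound 1/2 on the height, so
    that the new map can still be compared with [f]. *)
Lemma push_off_cells (b : bool) e N (lo hi : 'rV[R]_N.+1) (f : 'rV[R]_N.+1 -> V -> R) :
  (forall i, lo ord0 i <= hi ord0 i) ->
  (box_dim lo hi < e + b)%N -> conn R (link_boundary F tau) e ->
  simplicial_map (box_part lo hi b) F f ->
  exists G, simplicial_map (box_part lo hi b) (del_face F tau) G /\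
    forall x, box_part lo hi b x ->
      (height tau (f x) <= 3 / 4 /\ G x = radial tau (f x)) \/
      (2^-1 < height tau (f x) /\
       forall s, (forall v, v \in s -> 0 < G x v) -> link_boundary F tau s).
Proof.
move=> lohi dim cL sf.
have [[S [uS wS]] Ff cf] := sf.
pose h x := height tau (f x).
have ch : cont_on (box_part lo hi b) h by exact: cont_height.
have cW : compact (box_part lo hi b).
  by case: (b); [exact: compact_boundary | exact: compact_box].
(* Heights vary by less than 1/4 on a cell. A cell reaching 3/4 thus stays above 1/2, where all of
   [tau] is in the support, and on every other cell the radial formula is normalized correctly. *)
have e4 : (0 : R) < 4^-1 by rewrite invr_gt0 ltr0n.
have [d d0 hd] := cont_on_uniform cW ch e4.
pose D := \sum_i (hi ord0 i - lo ord0 i).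
have D0 : 0 <= D by apply: sumr_ge0 => i _; rewrite subr_ge0.
pose M := (Num.bound (D / d)).+1.
have M0 : (0 < M)%N by [].
have MD i : (hi ord0 i - lo ord0 i) / M%:R < d.
  rewrite ltr_pdivrMr ?ltr0n // mulrC -ltr_pdivrMr //.
  have le_i : (hi ord0 i - lo ord0 i) / d <= D / d.
    rewrite ler_pM2r ?invr_gt0 // /D (bigD1 i) //= lerDl.
    by apply: sumr_ge0 => j _; rewrite subr_ge0.
  apply: (le_lt_trans le_i); apply: (@lt_trans _ _ (Num.bound (D / d))%:R).
    by apply: archi_boundP; rewrite divr_ge0 // ltW.
  by rewrite ltr_nat.
pose C := cell_index N M.
pose ce (k : C) := cell lo hi k.
pose inb (k : C) := cell_in lo hi b k.
pose dm (k : C) := cell_dim lo hi k.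
have ce_part k x : inb k -> ce k x -> box_part lo hi b x by exact: cell_sub_part.
pose high (k : C) := exists x, ce k x /\ 3 / 4 <= h x.
have high_h k x : inb k -> high k -> ce k x -> 2^-1 < h x.
  move=> ik [y [ky hy]] kx.
  have : `|h y - h x| < 4^-1.
    apply: hd; [exact: ce_part ky|exact: ce_part kx|] => i.
    by apply: le_lt_trans (MD i); exact: cell_diam.
  by rewrite ltr_norml => /andP[_]; lra.
have low_h k x : ~ high k -> ce k x -> h x <= 3 / 4.
  by move=> nk kx; rewrite leNgt; apply/negP => hx; apply: nk; exists x; rewrite ltW.
pose low_set := \bigcup_(k in [set k | inb k /\ ~ high k]) ce k.
have cl_low : closed low_set by exact: closed_cells.
pose rf x := radial tau (f x).
have srf (B : set 'rV[R]_N.+1) : B `<=` box_part lo hi b -> (forall x, B x -> h x <= 3 / 4) ->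
    simplicial_map B (del_face F tau) rf.
  move=> BW hB; split.
  - by exists S; split=> // x Bx; apply: radial_weights => //; [exact: wS (BW x Bx) | exact: hB].
  - move=> x Bx s sp; have wx := wS x (BW x Bx); split; last exact: radial_omits wx sp.
    by apply: (Ff x (BW x Bx)) => v /sp; apply: radial_supp; case: wx.
  - by move=> v; apply: cont_radial => u; exact: cont_on_sub BW (cf u).
have srfL (B : set 'rV[R]_N.+1) : B `<=` box_part lo hi b ->
    (forall x, B x -> 2^-1 < h x <= 3 / 4) ->
    simplicial_map B (link_boundary F tau) rf.
  move=> BW hB.
  have [w1 s1 c1] : simplicial_map B (del_face F tau) rf.
    by apply: srf => // x /hB/andP[].
  split=> // x Bx s sp; have wx := wS x (BW x Bx); split; last exact: radial_omits wx sp.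
  have [t0 _ _] := wx; have /andP[hx _] := hB x Bx.
  apply: (Ff x (BW x Bx)) => v; rewrite mem_cat => /orP[/sp|]; first exact: radial_supp.
  by apply: height_gt0 => //; apply: lt_trans hx; rewrite invr_gt0 ltr0n.
(* Induction on a set of high cells containing every high cell of smaller dimension than one of its
   members. The cell [k] removed has maximal dimension, so each point of its boundary lies in a
   smaller cell that is either in [K'] or low; both prescribe values in [link_boundary F tau]. *)
have main n : forall K : {set C}, #|K| = n -> (forall k, k \in K -> inb k /\ high k) ->
    (forall k l, k \in K -> inb l -> high l -> (dm l < dm k)%N -> l \in K) ->
    exists G, simplicial_map (\bigcup_(k in [set k | k \in K]) ce k) (link_boundary F tau) G /\
      forall x, (\bigcup_(k in [set k | k \in K]) ce k) x -> low_set x -> G x = rf x.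
  elim: n => [|n IH] K Kn Khigh Kface.
    have K0 x : ~ (\bigcup_(k in [set k | k \in K]) ce k) x.
      by move=> [k /= kK _]; rewrite (cards0_eq Kn) inE in kK.
    exists (fun _ _ => 0); split=> [|x /K0//]; split.
    + by exists [::]; split=> // x /K0.
    + by move=> x /K0.
    + by move=> v x /K0.
  have [k0 k0K] : exists k, k \in K by apply/set0Pn; rewrite -card_gt0 Kn.
  have [k kK kmax] := @arg_maxnP _ k0 [in K] dm k0K.
  have [ik hk] := Khigh k kK.
  pose K' := K :\ k.
  have K'K l : l \in K' -> l \in K by rewrite inE => /andP[].
  have [|||G [sG Grf]] := IH K'.
  - have := cardsD1 k K; have -> : k \in K by exact: kK.
    by rewrite Kn add1n => -[].
  - by move=> l /K'K/Khigh.
  - move=> l l' lK il' hl' ll'; rewrite !inE (Kface l l') ?K'K // andbT.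
    apply/eqP => E; have : (dm l <= dm k)%N := kmax l (K'K _ lK).
    by rewrite leqNgt -E ll'.
  set U := \bigcup_(l in [set l | l \in K']) ce l in sG Grf.
  have clU : closed U by exact: closed_cells.
  pose bk := box_boundary (cell_lo lo hi k) (cell_hi lo hi k).
  have bk_ce x : bk x -> ce k x by case.
  pose B1 := U `&` bk; pose B2 := low_set `&` bk.
  have clbk : closed bk by exact: closed_boundary.
  have clB1 : closed B1 by exact: closedI.
  have clB2 : closed B2 by exact: closedI.
  have sB1 : simplicial_map B1 (link_boundary F tau) G by apply: smap_sub sG => x [].
  have sB2 : simplicial_map B2 (link_boundary F tau) rf.
    apply: srfL => x [lx bx]; first exact: ce_part ik (bk_ce _ bx).
    rewrite (high_h k) //=; last exact: bk_ce.
    by case: lx => l [_ nl] lx; exact: low_h lx.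
  have agree x : B1 x -> B2 x -> G x = rf x by move=> [Ux _] [lx _]; exact: Grf.
  have B12 : B1 `|` B2 = bk.
    apply/seteqP; split=> x; first by case=> -[].
    move=> bx; have [l [il lx ldim]] := cell_face lohi M0 ik bx.
    have [hl|nl] := pselect (high l); last by right; split=> //; exists l.
    left; split=> //; exists l => //=; rewrite !inE (Kface k l) // andbT.
    by apply/eqP => E; rewrite E ltnn in ldim.
  have := smap_glue clB1 clB2 agree sB1 sB2; rewrite B12.
  set g := (X in simplicial_map _ _ X) => sg.
  have kdim : (box_dim (cell_lo lo hi k) (cell_hi lo hi k) < e)%N.
    have := cell_dim_lt lohi M0 ik; rewrite /cell_dim; move: dim; clear; case: b; lia.
  have [g' [sg' g'g]] := cL N _ _ (cell_lohi lohi M0 k) kdim g sg.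
  have agree2 x : U x -> ce k x -> G x = g' x.
    move=> Ux kx.
    have bx : bk x.
      case: (Ux) => l /= lK' lx.
      have [il hl] := Khigh l (K'K _ lK').
      have [E|//] := cell_meet_dim lohi M0 (proj1 ik) (proj1 il) kx lx (kmax _ (K'K _ lK')).
      by move: lK'; rewrite -E !inE eqxx.
    by rewrite g'g // /g; case: asboolP => // -[]; split.
  have := smap_glue clU (closed_box _ _) agree2 sG sg'.
  set G' := (X in simplicial_map _ _ X) => sG'.
  have UK : \bigcup_(l in [set l | l \in K]) ce l = U `|` ce k.
    apply/seteqP; split=> x.
      move=> [l /= lK lx]; have [E|lk] := eqVneq l k; first by right; rewrite -E.
      by left; exists l => //=; rewrite !inE lk.
    by case=> [[l /= lK' lx]|kx]; [exists l => //=; exact: K'K | exists k].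
  exists G'; rewrite UK; split=> // x Ux lx.
  rewrite /G'; case: asboolP => [Ux'|nUx]; first exact: Grf.
  have {Ux} kx : ce k x by case: Ux.
  have bx : bk x.
    (* A low cell through a relative interior point of the high cell [k] would contain [k], and so
       be high itself. *)
    case: (lx) => l /= [il nl] lx'.
    have [//|[sub _]] := cell_meet lohi M0 (proj1 ik) (proj1 il) kx lx'.
    by exfalso; apply: nl; case: hk => y [ky hy]; exists y; split=> //; exact: sub.
  by rewrite g'g // /g; case: asboolP => [[/nUx]|].
pose K : {set C} := finset (fun k : C => `[< inb k /\ high k >]).
have KP k : k \in K <-> inb k /\ high k.
  by rewrite inE; split=> [/asboolP|H]; last apply/asboolP.
have [||G [sG Grf]] := main #|K| K erefl.
- by move=> k /KP.
- by move=> k l _ il hl _; apply/KP.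
set U := \bigcup_(l in [set l | l \in K]) ce l in sG Grf.
have clU : closed U by exact: closed_cells.
have low_part x : low_set x -> box_part lo hi b x.
  by move=> [k [ik _] kx]; exact: ce_part kx.
have U_part x : U x -> box_part lo hi b x.
  by move=> [k /KP[ik _] kx]; exact: ce_part kx.
have Wcov : U `|` low_set = box_part lo hi b.
  apply/seteqP; split=> x; first by case=> [/U_part|/low_part].
  move=> /(part_covered M0)[k [ik kx]].
  have [hk|nk] := pselect (high k); last by right; exists k.
  by left; exists k => //; apply/KP.
have low34 x : low_set x -> h x <= 3 / 4 by move=> [k [_ nk] kx]; exact: low_h kx.
have sG' := smap_mono link_boundary_sub sG.
have := smap_glue clU cl_low Grf sG' (srf _ low_part low34); rewrite Wcov.
set G' := (X in simplicial_map _ _ X) => sG''.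
exists G'; split=> // x Wx; rewrite /G'; case: asboolP => Ux; last first.
  left; have lx : low_set x by move: Wx; rewrite -Wcov => -[].
  by split; [exact: low34 | ].
right; split; last by move=> s; case: sG => _ + _; apply.
by case: (Ux) => k /KP[ik hk] kx; exact: high_h kx.
Qed.

End PushOff.


Definition extends (R : realType) (V : eqType) (F : complex V) N (lo hi : 'rV[R]_N.+1)
    (f : 'rV[R]_N.+1 -> V -> R) : Prop :=
  exists g : 'rV[R]_N.+1 -> V -> R, simplicial_map (box lo hi) F g /\
    forall x, box_boundary lo hi x -> g x = f x.

Lemma extends_mono (R : realType) (V : eqType) (F G : complex V) N (lo hi : 'rV[R]_N.+1) f :
  (forall s, F s -> G s) -> extends F lo hi f -> extends G lo hi f.
Proof. by move=> FG [g [sg gf]]; exists g; split=> //; exact: smap_mono FG sg. Qed.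

Section PushOffSphere.
Variables (R : realType) (V : eqType) (F : complex V) (tau : seq V).
Hypotheses (cF : face_closed F) (tau0 : tau != [::]) (ut : uniq tau).

(** At high points the supports of [f] and [f1] need not span a common simplex, so the two maps are
    compared through [f'], which moves [f1] towards the barycentre of [tau] there. The support of
    [f1] can be joined to [tau] wherever this happens, and the support of [f'] lies in that of [f].
    Extensions are then carried from [f1] to [f'] and from [f'] to [f]. *)
Lemma push_off_sphere e N (lo hi : 'rV[R]_N.+1) (f : 'rV[R]_N.+1 -> V -> R) :
  (forall i, lo ord0 i <= hi ord0 i) ->
  (box_dim lo hi < e.+1)%N -> conn R (link_boundary F tau) e ->
  simplicial_map (box_boundary lo hi) F f ->
  exists f1, simplicial_map (box_boundary lo hi) (del_face F tau) f1 /\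
    forall G : complex V, (forall s, F s -> G s) -> extends G lo hi f1 -> extends G lo hi f.
Proof.
move=> lohi dim cL sf.
have {}dim : (box_dim lo hi < e + true)%N by rewrite addn1.
have [f1 [sf1 H]] := push_off_cells (b := true) cF tau0 ut lohi dim cL sf.
exists f1; split=> // G FG ext1.
have [[S [uS wS]] Ff cf] := sf; have [_ _ cf1] := sf1.
have st0 : (0 : R) < (size tau)%:R by rewrite ltr0n lt0n size_eq0.
pose h x := height tau (f x).
(* This is 0 up to height 1/4 and 1 from height 1/2 on. Hence [f'] is the barycentre wherever [f1]
   is not known to be the radial projection, and [tau] is in the support of [f] wherever [eta] is
   positive. *)
pose eta x : R := Num.min 1 (Num.max 0 (4 * h x - 1)).
pose bary (v : V) : R := (v \in tau)%:R / (size tau)%:R.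
have wbary : weights_on tau bary.
  split.
  - by move=> v; rewrite divr_ge0 // ler0n.
  - by move=> v /negPf vt; rewrite /bary vt mul0r.
  - rewrite -mulr_suml big_seq (eq_bigr (fun=> 1)); last by move=> v ->.
    by rewrite -big_seq big_const_seq count_predT iter_addr_0 divff // gt_eqF.
have eta01 x : 0 <= eta x <= 1.
  by rewrite /eta le_min ler01 le_max lexx /= ge_min lexx.
have eta_h x : 0 < eta x -> 4^-1 < h x.
  by rewrite /eta lt_min lt_max ltxx /= => /andP[_]; lra.
have h_eta x : 2^-1 < h x -> eta x = 1.
  by move=> hx; rewrite /eta (max_idPr _) ?(min_idPl _) //; lra.
have ceta : cont_on (box_boundary lo hi) eta.
  apply: cont_on_min; first exact: cont_on_cst.
  apply: cont_on_max; first exact: cont_on_cst.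
  apply: cont_onB; last exact: cont_on_cst.
  by apply: cont_onM; [exact: cont_on_cst | exact: cont_height].
pose f' x v := (1 - eta x) * f1 x v + eta x * bary v.
have f'_supp x v : box_boundary lo hi x -> 0 < f' x v ->
    (eta x = 0 /\ 0 < f1 x v) \/ (0 < eta x /\ (0 < f1 x v \/ v \in tau)).
  move=> bx; have /andP[e0 e1] := eta01 x; rewrite /f' /bary.
  have [S1 [_ /(_ x bx) [f10 _ _]]] := smap_weights sf1.
  have [->|en0] := eqVneq (eta x) 0.
    by rewrite subr0 mul1r mul0r addr0 => fv; left.
  have ep : 0 < eta x by rewrite lt_neqAle eq_sym en0.
  move=> fv; right; split=> //; case: (boolP (v \in tau)) => vt; first by right.
  left; rewrite lt_neqAle f10 andbT eq_sym; apply/eqP => E.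
  by move: fv; rewrite E (negPf vt) mulr0 mul0r mulr0 addr0 ltxx.
have fsupp x v : box_boundary lo hi x -> 0 < f' x v -> 0 < f x v.
  move=> bx f'v; have [t0 _ _] := wS x bx.
  have hx_tau : 0 < eta x -> v \in tau -> 0 < f x v.
    by move=> /eta_h hx; apply: height_gt0 => //; apply: lt_trans hx; rewrite invr_gt0 ltr0n.
  have [[h34 f1E]|[h12 _]] := H x bx.
    case: (f'_supp x v bx f'v) => [[_]|[ep [|vt]]]; last exact: hx_tau.
      by rewrite f1E; exact: radial_supp.
    by rewrite f1E; exact: radial_supp.
  have e1 := h_eta x h12; apply: hx_tau; first by rewrite e1.
  by move: f'v; rewrite /f' e1 subrr mul0r add0r mul1r /bary; case: (v \in tau); rewrite ?mul0r ?ltxx.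
have sf' : simplicial_map (box_boundary lo hi) F f'.
  apply: smap_cvx => //.
  - exact: smap_weights sf1.
  - by exists tau; split=> // x _.
  - by move=> v; exact: cont_on_cst.
  - by move=> x bx s sp; apply: (Ff x bx) => v /sp; exact: fsupp.
have sf'G := smap_mono FG sf'; have sfG := smap_mono FG sf.
have [g1 [sg1 g1f1]] := ext1.
have [g' [sg' g'f']] : extends G lo hi f'.
  apply: (slide_extend lohi sf'G sg1 g1f1) => x bx s sp; apply: FG.
  have [_ F1 _] := sf1.
  have f1L : 0 < eta x -> forall s, (forall v, v \in s -> 0 < f1 x v) -> link_boundary F tau s.
    move=> /eta_h hx s' s'p; have [[h34 f1E]|[_]] := H x bx; last exact.
    have [t0 _ _] := wS x bx.
    split; last by apply: (radial_omits tau0 (wS x bx)) => v; rewrite -f1E; exact: s'p.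
    apply: (Ff x bx) => v; rewrite mem_cat => /orP[/s'p|].
      by rewrite f1E; exact: radial_supp.
    by apply: height_gt0 => //; apply: lt_trans hx; rewrite invr_gt0 ltr0n.
  have [e0|en0] := eqVneq (eta x) 0.
    have [] // := F1 x bx s _ => v /sp [|//]; rewrite /f' e0.
    by rewrite subr0 mul1r mul0r addr0.
  have ep : 0 < eta x by rewrite lt_neqAle eq_sym en0; have /andP[] := eta01 x.
  have [Fs' _] := f1L ep [seq v <- s | 0 < f1 x v] (fun v => ltac:(by rewrite mem_filter => /andP[])).
  apply: cF Fs' => v vs; rewrite mem_cat mem_filter vs andbT.
  case: (sp v vs) => [|->//] /(f'_supp x v bx) [[_ ->//]|[_ [->//|->]]].
  by rewrite orbT.
apply: (slide_extend lohi sfG sg' g'f') => x bx s sp; apply: FG.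
by apply: (Ff x bx) => v /sp [//|]; exact: fsupp.
Qed.

(** Where a vertex of [tau] has weight 0 the height is 0 and the radial projection is the identity.
    The whole box is subdivided instead of its boundary, which costs one more degree of connectivity
    than [push_off_sphere]. *)
Lemma push_off_rel e N (lo hi : 'rV[R]_N.+1) (g : 'rV[R]_N.+1 -> V -> R) :
  (forall i, lo ord0 i <= hi ord0 i) ->
  (box_dim lo hi < e)%N -> conn R (link_boundary F tau) e ->
  simplicial_map (box lo hi) F g ->
  exists g1, simplicial_map (box lo hi) (del_face F tau) g1 /\
    forall x, box lo hi x -> (exists2 v, v \in tau & g x v = 0) -> g1 x = g x.
Proof.
move=> lohi dim cL sg.
have {}dim : (box_dim lo hi < e + false)%N by rewrite addn0.
have [g1 [sg1 H]] := push_off_cells (b := false) cF tau0 ut lohi dim cL sg.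
exists g1; split=> // x bx [v vt gv].
have [S [uS /(_ x bx) [t0 _ _]]] := smap_weights sg.
have h0 := height0 tau0 t0 vt gv.
have [[_ ->]|[]] := H x bx; first exact: radial0.
by rewrite h0 => h; exfalso; lra.
Qed.

End PushOffSphere.

(** * Connectivity through links, joins and full subcomplexes *)

Section ConnBasics.
Variables (R : realType) (V : eqType).
Implicit Types F G : complex V.

Lemma conn_le F e e' : (e' <= e)%N -> conn R F e -> conn R F e'.
Proof. by move=> ee cF N lo hi lohi dim; apply: cF => //; exact: leq_trans ee. Qed.

Lemma conn0 F : conn R F 0.
Proof. by move=> N lo hi lohi; rewrite ltn0. Qed.

Lemma conn_ext F G e : (forall s, F s <-> G s) -> conn R F e -> conn R G e.
Proof.
move=> FG cF N lo hi lohi dim f sf.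
have sfF : simplicial_map (box_boundary lo hi) F f by apply: smap_mono sf => s /FG.
have [g [sg gf]] := cF N lo hi lohi dim f sfF.
by exists g; split=> //; apply: smap_mono sg => s /FG.
Qed.

Lemma conn1 F v : face_closed F -> F [:: v] -> conn R F 1.
Proof.
move=> cF Fv N lo hi lohi; rewrite ltnS leqn0 => /eqP/card0_eq dim0 f _.
exists (fun _ u => (u == v)%:R); split; last first.
  move=> x [_ [i [lt_i _]]]; exfalso.
  by have := dim0 i; rewrite !inE lt_i.
split.
- by exists [:: v]; split=> // x _; exact: weights_dirac.
- move=> x _ s sp; apply: cF Fv => u /sp.
  by rewrite inE; case: (u == v); rewrite ?ltxx.
- by move=> u; exact: cont_on_cst.
Qed.

Lemma conn_del F tau e : face_closed F -> tau != [::] -> uniq tau ->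
  conn R (link_boundary F tau) e.-1 -> conn R (del_face F tau) e -> conn R F e.
Proof.
move=> cF tau0 ut cL cD N lo hi lohi dim f sf.
have dim' : (box_dim lo hi < e.-1.+1)%N by rewrite prednK //; exact: leq_trans dim.
have [f1 [sf1 H]] := push_off_sphere cF tau0 ut lohi dim' cL sf.
apply: (H F) => //; have [g [sg gf]] := cD N lo hi lohi dim f1 sf1.
by exists g; split=> //; apply: smap_mono sg => s [].
Qed.

(** For [F] without vertices in [tau] this is the join of [F] with the boundary of [tau], a simplex
    being one list whose part outside [tau] lies in [F]. *)
Definition boundary_join F (tau : seq V) : complex V :=
  fun s => F [seq v <- s | v \notin tau] /\ ~ {subset tau <= s}.

Lemma face_closed_boundary_join F tau : face_closed F -> face_closed (boundary_join F tau).
Proof.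
move=> cF s t ts [Fs ns]; split; last by move=> H; apply: ns => v /H/ts.
by apply: cF Fs => v; rewrite !mem_filter => /andP[-> /ts ->].
Qed.

(** Joining with a sphere of dimension [size tau - 2] gains [size tau - 1] degrees. Deleting the
    first vertex [v] leaves a cone whose apex is any other vertex of [tau], and the link of [v] is
    the join with the boundary of the remaining simplex. *)
Lemma conn_boundary_join F tau e : face_closed F -> F [::] -> uniq tau -> tau != [::] ->
  (forall s, F s -> ~~ has [in tau] s) -> conn R F e ->
  conn R (boundary_join F tau) (e + size tau).-1.
Proof.
move=> cF F0 ut tau0 Fdisj cFe.
elim: tau ut tau0 Fdisj => // v tau IH /= /andP[vt ut] _ Fdisj.
have [tau0|taun0] := eqVneq tau [::].
  rewrite tau0 /= addn1 /=; apply: conn_ext cFe => s; split.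
    move=> Fs; have := Fdisj s Fs; rewrite tau0 => /hasPn ns; split.
      rewrite (_ : [seq _ <- _ | _] = s) //; apply/all_filterP/allP => u us.
      exact: ns.
    by move=> /(_ v); rewrite inE eqxx => /(_ isT)/ns; rewrite inE eqxx.
  move=> [Fs ns]; apply: cF Fs => u us; rewrite mem_filter us andbT inE.
  by apply/eqP => E; apply: ns => w; rewrite inE => /eqP ->; rewrite -E.
rewrite addnS /=.
have cJ := @face_closed_boundary_join F (v :: tau) cF.
apply: (@conn_del _ [:: v]) => //.
  have Fdisj' s : F s -> ~~ has [in tau] s.
    move=> /Fdisj /hasPn ns; apply/hasPn => u /ns.
    by rewrite /= inE negb_or => /andP[].
  apply: conn_ext (IH ut taun0 Fdisj') => s; split.
    move=> [Fs ns].
    have nv : v \notin s.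
      apply/negP => vs; have /hasPn/(_ v) := Fdisj _ Fs.
      by rewrite mem_filter vt vs => /(_ isT); rewrite /= inE eqxx.
    split; last by move=> H; have := H v; rewrite inE eqxx => /(_ isT) vs; rewrite vs in nv.
    split.
      apply: cF Fs => u; rewrite !mem_filter mem_cat !inE negb_or.
      by case: (eqVneq u v) => //= _; rewrite orbF.
    move=> H; apply: ns => u ut'.
    have := H u; rewrite inE ut' orbT mem_cat inE => /(_ isT) /orP[//|/eqP E].
    by rewrite -E ut' in vt.
  move=> [[Fs ns] nv].
  have nv' : v \notin s by apply/negP => vs; apply: nv => u; rewrite inE => /eqP ->.
  split.
    apply: cF Fs => u; rewrite !mem_filter mem_cat !inE negb_or => /andP[-> us].
    rewrite us /= !andbT; by apply: contraNneq nv' => <-.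
  move=> H; apply: ns => u; rewrite inE mem_cat inE => /predU1P[->|/H ->//].
  by rewrite eqxx orbT.
have [u ut'] : exists u, u \in tau by case: (tau) taun0 => // u ? _; exists u; rewrite inE eqxx.
apply: (@conn_cone _ _ _ u); last exact: face_closed_del.
- move=> s [[Fs ns] nv].
  have nv' : v \notin s by apply/negP => vs; apply: nv => w; rewrite inE => /eqP ->.
  have uv : v != u by apply: contraNneq vt => ->.
  split; last by move=> /(_ v); rewrite !inE eqxx (negPf uv) (negPf nv') => /(_ isT).
  split; first by rewrite /= inE ut' orbT.
  by move=> /(_ v); rewrite !inE eqxx (negPf uv) (negPf nv') => /(_ isT).
- by split=> [|/(_ v)]; [split=> // /(_ v)|]; rewrite inE eqxx => /(_ isT).
Qed.

Lemma face_closed_link F (tau : seq V) : face_closed F -> face_closed (link F tau).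
Proof.
move=> cF s t ts [Fs /hasPn ns]; split.
  by apply: cF Fs => v; rewrite !mem_cat => /orP[/ts->|->]; rewrite ?orbT.
by apply/hasPn => v /ts/ns.
Qed.

Lemma conn_link_boundary F tau e : face_closed F -> F tau -> uniq tau -> tau != [::] ->
  conn R (link F tau) e -> conn R (link_boundary F tau) (e + size tau).-1.
Proof.
move=> cF Ft ut tau0 cL.
apply: conn_ext (conn_boundary_join (face_closed_link cF) _ ut tau0 _ cL).
- move=> s; split=> -[Fs ns]; split=> //.
    have [Fs' _] := Fs; apply: cF Fs' => v; rewrite !mem_cat mem_filter.
    by case: (boolP (v \in tau)); rewrite ?orbT.
  split; last by apply/hasPn => v; rewrite mem_filter => /andP[].
  by apply: cF Fs => v; rewrite !mem_cat mem_filter => /orP[/andP[_ ->]|->]; rewrite ?orbT.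
- by split.
- by move=> s [].
Qed.

Definition full_on (X : pred V) F : complex V := fun s => F s /\ all X s.

Lemma face_closed_full_on X F : face_closed F -> face_closed (full_on X F).
Proof.
move=> cF s t ts [Fs /allP Xs]; split; first exact: cF Fs.
by apply/allP => v /ts/Xs.
Qed.

(** The link of [tau] inside the link of [w] is the link of [rcons tau w], so the hypothesis of the
    enlargement lemmas passes to the link of [w] with [e] lowered by one. *)
Lemma conn_link_link (X : pred V) F (w : V) e : face_closed F -> ~~ X w ->
  (forall tau, uniq tau -> tau != [::] -> F tau -> ~~ has X tau ->
     conn R (full_on X (link F tau)) (e - size tau)) ->
  forall tau, uniq tau -> link F [:: w] tau -> ~~ has X tau ->
    conn R (full_on X (link (link F [:: w]) tau)) (e.-1 - size tau).
Proof.
move=> cF nXw cX tau ut [Ft nw] nX.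
have nwt : w \notin tau by apply: contra nw => wt; apply/hasP; exists w; rewrite ?inE.
have ut' : uniq (rcons tau w) by rewrite rcons_uniq nwt.
have Ft' : F (rcons tau w) by rewrite -cats1.
have nX' : ~~ has X (rcons tau w) by rewrite has_rcons negb_or nXw.
have tn : rcons tau w != [::] by case: (tau).
have := cX _ ut' tn Ft' nX'; rewrite size_rcons subnS -subn1 -subnDA addnC subnDA subn1.
apply: conn_ext => s; rewrite /full_on /link -cats1 catA.
split=> -[] [].
  move=> Fs /hasPn ns Xs; split=> //; split.
    split=> //; rewrite has_cat negb_or nw andbT.
    by apply/hasPn => u /ns; rewrite /= mem_cat negb_or => /andP[].
  by apply/hasPn => u /ns; rewrite /= mem_cat negb_or => /andP[].
move=> [Fs]; rewrite has_cat negb_or => /andP[/hasPn n1 _] /hasPn n2 Xs; split=> //; split=> //.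
by apply/hasPn => u us; rewrite /= mem_cat negb_or; apply/andP; split; [exact: n2|exact: n1].
Qed.

Lemma link_boundary_full_on (X : pred V) (ws : seq V) F (w : V) s :
  ~~ X w -> w \notin ws ->
  full_on (fun v => X v || (v \in ws)) (link F [:: w]) s <->
  link_boundary (full_on (fun v => X v || (v \in w :: ws)) F) [:: w] s.
Proof.
move=> nXw nwws; rewrite /full_on /link /link_boundary.
split.
  move=> [[Fs /hasPn nw] /allP Xs]; split; last first.
    by move=> /(_ w); rewrite inE eqxx => /(_ isT) /nw; rewrite /= inE eqxx.
  split=> //; rewrite all_cat all_seq1 mem_head orbT andbT; apply/allP => v vs.
  by rewrite inE; case/orP: (Xs v vs) => ->; rewrite ?orbT.
move=> [[Fs Xs] nw].
have nws : w \notin s by apply/negP => ws'; apply: nw => u; rewrite inE => /eqP ->.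
split.
  split=> //; apply/hasPn => v vs; rewrite /= inE; by apply: contraNneq nws => <-.
move: Xs; rewrite all_cat => /andP[/allP Xs _]; apply/allP => v vs.
have := Xs v vs; rewrite inE => /or3P[->//|/eqP E|->]; last by rewrite orbT.
by rewrite -E vs in nws.
Qed.

(** A new vertex [w] is removed by pushing off it: its deletion is the complex for the shorter list,
    and its link is a complex of the same kind inside [link F [:: w]]. The induction is over all [F]
    in order to cover both. *)
Lemma conn_full_on_enlarge (X : pred V) (ws : seq V) F e : face_closed F ->
  (forall tau, uniq tau -> F tau -> ~~ has X tau ->
     conn R (full_on X (link F tau)) (e - size tau)) ->
  F [::] ->
  conn R (full_on (fun v => X v || (v \in ws)) F) e.
Proof.
elim: ws F e => [|w ws IH] F e cF cX F0.
  have := cX [::] isT F0 isT; rewrite subn0; apply: conn_ext => s.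
  rewrite /full_on /link cats0; split=> -[].
    by move=> [Fs _] Xs; split=> //; apply: sub_all Xs => v ->.
  move=> Fs Xs; split; last by apply: sub_all Xs => v; rewrite in_nil orbF.
  by split=> //; apply/hasPn.
have [triv|] := boolP [|| X w, w \in ws | ~~ `[< F [:: w] >]].
  apply: conn_ext (IH F e cF cX F0) => s; split=> -[Fs /allP Xs]; split=> //; apply/allP => v vs.
    by rewrite inE; case/orP: (Xs v vs) => ->; rewrite ?orbT.
  have := Xs v vs; rewrite inE => /or3P[->//|/eqP E|->]; last by rewrite orbT.
  case/or3P: triv => [Xw|wws|/asboolPn[]]; first by rewrite E Xw.
    by rewrite E wws orbT.
  by apply: cF Fs => u; rewrite inE => /eqP ->; rewrite -E.
rewrite !negb_or negbK => /and3P[nXw nwws /asboolP Fw].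
have cF0 := @face_closed_full_on (fun v => X v || (v \in w :: ws)) F cF.
apply: (@conn_del _ [:: w]) => //.
  have cL : face_closed (link F [:: w]) by exact: face_closed_link.
  have L0 : link F [:: w] [::] by split.
  have cX' := conn_link_link cF nXw (fun tau ut _ => cX tau ut).
  apply: conn_ext (IH _ e.-1 cL cX' L0) => s; exact: link_boundary_full_on.
apply: conn_ext (IH F e cF cX F0) => s; split.
  move=> [Fs /allP Xs]; split.
    split=> //; apply/allP => v vs; rewrite inE; by case/orP: (Xs v vs) => ->; rewrite ?orbT.
  move=> /(_ w); rewrite inE eqxx => /(_ isT) /Xs; by rewrite (negPf nXw) (negPf nwws).
move=> [[Fs /allP Xs] nw]; split=> //; apply/allP => v vs.
have := Xs v vs; rewrite inE => /or3P[->//|/eqP E|->]; last by rewrite orbT.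
by exfalso; apply: nw => u; rewrite inE => /eqP ->; rewrite -E.
Qed.

Lemma smap_finite (T : topologicalType) (A : set T) (X : pred V) F (f : T -> V -> R) :
  simplicial_map A F f ->
  exists ws : seq V, simplicial_map A (full_on (fun v => X v || (v \in ws)) F) f.
Proof.
move=> [[S [uS wS]] Ff cf]; exists S; split=> //; first by exists S.
move=> x Ax s sp; split; first exact: (Ff x Ax).
apply/allP => v /sp fv; apply/orP; right; apply/negPn/negP => vS.
by have [_ /(_ v vS) E _] := wS x Ax; rewrite E ltxx in fv.
Qed.

(** A given map has finite common support, so it involves only finitely many vertices outside
    [X]. *)
Theorem conn_enlarge (X : pred V) F e : face_closed F -> F [::] ->
  (forall tau, uniq tau -> F tau -> ~~ has X tau ->
     conn R (full_on X (link F tau)) (e - size tau)) ->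
  conn R F e.
Proof.
move=> cF F0 cX N lo hi lohi dim f sf.
have [ws sf'] := smap_finite X sf.
have [g [sg gf]] := conn_full_on_enlarge (ws := ws) cF cX F0 lohi dim sf'.
by exists g; split=> //; apply: smap_mono sg => s [].
Qed.

(** Relative form, for a full subcomplex on [X] that becomes contractible only inside a larger
    complex: pushing a map off the vertices outside [X] reduces its extension problem in [G] to that
    of maps into [full_on X F]. *)
Theorem extends_enlarge (X : pred V) F G e N (lo hi : 'rV[R]_N.+1) f :
  face_closed F -> F [::] -> (forall s, F s -> G s) ->
  (forall tau, uniq tau -> tau != [::] -> F tau -> ~~ has X tau ->
     conn R (full_on X (link F tau)) (e - size tau)) ->
  (forall i, lo ord0 i <= hi ord0 i) -> (box_dim lo hi < e)%N ->
  (forall f1, simplicial_map (box_boundary lo hi) (full_on X F) f1 -> extends G lo hi f1) ->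
  simplicial_map (box_boundary lo hi) F f -> extends G lo hi f.
Proof.
move=> cF F0 FG cX lohi dim extX sf.
have [ws {}sf] := smap_finite X sf.
elim: ws f sf => [|w ws IH] f sf.
  apply: extX; apply: smap_mono sf => s [Fs Xs]; split=> //.
  by apply: sub_all Xs => v; rewrite in_nil orbF.
have [triv|] := boolP [|| X w, w \in ws | ~~ `[< F [:: w] >]].
  apply: IH; apply: smap_mono sf => s [Fs /allP Xs]; split=> //; apply/allP => v vs.
  have := Xs v vs; rewrite inE => /or3P[->//|/eqP E|->]; last by rewrite orbT.
  case/or3P: triv => [Xw|wws|/asboolPn[]]; first by rewrite E Xw.
    by rewrite E wws orbT.
  by apply: cF Fs => u; rewrite inE => /eqP ->; rewrite -E.
rewrite !negb_or negbK => /and3P[nXw nwws /asboolP Fw].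
have cF0 := @face_closed_full_on (fun v => X v || (v \in w :: ws)) F cF.
have cLink : conn R (link_boundary (full_on (fun v => X v || (v \in w :: ws)) F) [:: w]) e.-1.
  have cL : face_closed (link F [:: w]) by exact: face_closed_link.
  have L0 : link F [:: w] [::] by split.
  have := conn_full_on_enlarge (ws := ws) cL (conn_link_link cF nXw cX) L0.
  by apply: conn_ext => s; exact: link_boundary_full_on.
have dim' : (box_dim lo hi < e.-1.+1)%N by rewrite prednK //; exact: leq_trans dim.
have [//|//|f1 [sf1 H]] := push_off_sphere cF0 _ _ lohi dim' cLink sf.
apply: H; first by move=> s [/FG].
apply: IH; apply: smap_mono sf1 => s [[Fs /allP Xs] nw]; split=> //; apply/allP => v vs.
have := Xs v vs; rewrite inE => /or3P[->//|/eqP E|->]; last by rewrite orbT.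
by exfalso; apply: nw => u; rewrite inE => /eqP ->; rewrite -E.
Qed.

End ConnBasics.


(** All vertices used by [C] lie in the image of the injection [i], so maps are read through [i] and
    fillings carried back with weight 0 elsewhere. It serves to identify the part of a link in the
    kernel of a functional with a link one rank lower. *)
Lemma conn_relabel (R : realType) (V V' : eqType) (C : complex V) (C' : complex V')
    (i : V' -> V) (j : V -> V') e :
  face_closed C -> cancel i j -> (forall s, C s -> forall v, v \in s -> i (j v) = v) ->
  (forall s, C (map i s) <-> C' s) -> conn R C' e -> conn R C e.
Proof.
move=> cC ij Cij CC' cC' N lo hi lohi dim f [[S [uS wS]] Ff cf].
have iinj : injective i by exact: can_inj ij.
pose f' x v' := f x (i v').
have ftriv x v : box_boundary lo hi x -> i (j v) != v -> f x v = 0.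
  move=> bx ijv; have [t0 _ _] := wS x bx; apply/eqP; rewrite eq_le t0 andbT leNgt.
  apply/negP => fv; case/eqP: ijv; apply: (Cij [:: v]); last by rewrite inE.
  by apply: (Ff x bx) => u; rewrite inE => /eqP ->.
pose S0 := [seq v <- S | i (j v) == v].
have uS0 : uniq (map j S0).
  rewrite map_inj_in_uniq ?filter_uniq // => v w; rewrite !mem_filter.
  by move=> /andP[/eqP E _] /andP[/eqP E' _] jvw; rewrite -E -E' jvw.
have sf' : simplicial_map (box_boundary lo hi) C' f'.
  split.
  - exists (map j S0); split=> // x bx; have [t0 tS t1] := wS x bx; split.
    + by move=> v; exact: t0.
    + move=> v' v'S; apply: tS; apply/negP => iS; case/mapP: v'S; exists (i v'); last by rewrite ij.
      by rewrite mem_filter iS ij eqxx.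
    + rewrite big_map big_filter -t1 [RHS](bigID (fun v => i (j v) == v)) /=.
      rewrite [X in _ = _ + X]big1 => [|v ijv]; last exact: ftriv.
      by rewrite addr0; apply: eq_bigr => v /eqP E; rewrite /f' E.
  - move=> x bx s sp; apply/CC'; apply: (Ff x bx) => v /mapP[v' v's ->].
    exact: sp.
  - by move=> v'; exact: cf.
have [g' [[[S' [uS' wS']] Fg' cg'] g'f']] := cC' N lo hi lohi dim f' sf'.
exists (fun x v => if i (j v) == v then g' x (j v) else 0); split; last first.
  move=> x bx; apply/funext => v; case: eqVneq => [E|ijv]; last by rewrite ftriv.
  by rewrite g'f' // /f' E.
split.
- exists (map i S'); split; first by rewrite map_inj_uniq.
  move=> x bx; have [t0 tS t1] := wS' x bx; split.
  + by move=> v; case: ifP.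
  + move=> v vS; case: eqVneq => // E; apply: tS; apply: contra vS => jS.
    by apply/mapP; exists (j v).
  + by rewrite big_map -t1; apply: eq_bigr => v' _; rewrite ij eqxx.
- move=> x bx s sp.
  have E : map i (map j s) = s.
    rewrite -map_comp; apply: map_id_in => v /sp /=.
    by case: eqVneq; rewrite ?ltxx.
  rewrite -E; apply/CC'; apply: (Fg' x bx) => v' /mapP[v /sp + ->].
  by case: eqVneq; rewrite ?ltxx.
- move=> v /=; case: (i (j v) == v); last exact: cont_on_cst.
  exact: cg'.
Qed.

(** * Comparison with the coherent topology *)

Lemma ptws_cvg (R : realType) (V : eqType) (T : Type) (F : set_system T) (g : T -> {ptws V -> R})
    (t : {ptws V -> R}) : Filter F ->
  (forall v, g x v @[x --> F] --> t v) -> g @ F --> t.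
Proof.
move=> FF H; apply/cvg_sup => v U [B [[W oW <-] /= Wt] sub].
have HW : F [set x | W (g x v)] := H v W (open_nbhs_nbhs (conj oW Wt)).
suff : F [set x | U (g x)] by [].
by apply: filterS HW => x Wx; exact: sub.
Qed.

Lemma ptws_eval (R : realType) (V : eqType) (v : V) :
  continuous (fun t : {ptws V -> R} => t v).
Proof. exact: (@proj_continuous V (fun=> R) v). Qed.

Section Coherent.
Variables (V : eqType) (X : complex V).
Hypothesis cX : face_closed X.
Local Notation R := RbaseSymbolsImpl_R__canonical__reals_Real.

Lemma geo_simplex_weights (s : seq V) (t : V -> RR) : uniq s -> geo_simplex s t <-> weights_on (s : seq V) (t : V -> R).
Proof. by move=> us; split=> [[? [? ?]]|[? ? ?]]; split. Qed.

Lemma open_coord_lt (Y : topologicalType) (h : Y -> R) (a : R) : continuous h -> open [set t | h t < a].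
Proof.
move=> ch; have -> : [set t | h t < a] = h @^-1` [set y | y < a] by [].
by apply: open_comp; [move=> x _; exact: ch | exact: open_lt].
Qed.

(** All values lie on faces spanned by sublists of one finite list [S], hence finitely many
    conditions arise near [x]. A closed face containing [f x] is handled by coherent openness; any
    other closed face is avoided by all nearby values. *)
Lemma smap_continuous_into (T : topologicalType) (A : set T) (f : T -> {ptws V -> RR}) :
  @simplicial_map R _ V A X f -> continuous_into A X f.
Proof.
move=> [[S [uS wS]] Xf cf].
have supp x : A x -> X [seq v <- S | 0 < f x v] /\ geo_simplex [seq v <- S | 0 < f x v] (f x).
  move=> Ax; have [t0 tS t1] := wS x Ax; split.
    by apply: (Xf x Ax) => v; rewrite mem_filter => /andP[].
  have z v : v \notin [seq v <- S | 0 < f x v] -> f x v = 0.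
    rewrite mem_filter negb_and => /orP[|/tS//]; rewrite -leNgt => le0.
    by apply/eqP; rewrite eq_le le0 t0.
  split; [exact: z | split=> //].
  rewrite -t1; symmetry; apply: sum_enlarge => //; first exact: filter_uniq.
  by move=> v; rewrite mem_filter => /andP[].
split.
  move=> _ [x Ax <-]; have [Xs gs] := supp x Ax.
  by exists [seq v <- S | 0 < f x v]; split=> //; split=> //; exact: filter_uniq.
move=> U [UX Uopen].
exists (interior [set y | A y -> U (f y)]); split; first exact: open_interior.
apply/seteqP; split=> x [h Ax]; split=> //=; last by have := interior_subset h; exact.
rewrite /interior /=.
have H (m : (size S).-tuple bool) : nbhs x [set y | A y -> X (mask m S) ->
    geo_simplex (mask m S) (f y) -> U (f y)].
  have [Xs|nX] := pselect (X (mask m S)); last by apply: (@filterE _ (nbhs x)) => y _ /nX.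
  have us : uniq (mask m S) by exact: mask_uniq.
  have [gx|ngx] := pselect (geo_simplex (mask m S) (f x)).
    have [W [oW UW]] := Uopen _ Xs us.
    have [Wx _] : (W `&` geo_simplex (mask m S)) (f x) by rewrite -UW; split.
    have fc : f y @[y --> within A (nbhs x)] --> f x.
      by apply: ptws_cvg => v; exact: cf.
    have := fc W (open_nbhs_nbhs (conj oW Wx)); rewrite /nbhs /= /within /=.
    apply: filterS => y Wy Ay _ gy.
    have : (U `&` geo_simplex (mask m S)) (f y) by rewrite UW; split=> //; exact: Wy.
    by case.
  have [v [vs fv]] : exists v, v \notin mask m S /\ 0 < f x v.
    apply: contrapT => nv; apply: ngx; have [t0 tS t1] := wS x Ax.
    have z v : v \notin mask m S -> f x v = 0.
      move=> vs; apply/eqP; rewrite eq_le t0 andbT leNgt; apply/negP => fv.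
      by apply: nv; exists v.
    split=> //; split=> //; rewrite -t1; symmetry; apply: sum_enlarge => // v.
    exact: mem_mask.
  have /cvgr_gt/(_ _ fv) := cf v x Ax; rewrite near_withinE.
  apply: filterS => y fy Ay _ [z _]; have := fy Ay.
  by rewrite z // ltxx.
suff : nbhs x [set y | A y -> U (f y)] by [].
have HF := @filter_forall _ _ _ (nbhs x) (nbhs_filter x) H.
apply: filterS HF => y Hy Ay.
have [Xs gs] := supp y Ay.
have sm : size [seq (0 < f y v) | v <- S] == size S by rewrite size_map.
by have := Hy (Tuple sm) Ay; rewrite /= -filter_mask; apply.
Qed.

(** The image has finite support, as for compact subsets of a CW complex: otherwise points with ever
    new vertices give an increasing open cover that has no finite subcover. Each weight is then
    continuous because bounding its variation defines a coherent open set. *)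
Lemma continuous_into_smap (T : topologicalType) (A : set T) (f : T -> {ptws V -> RR}) :
  compact A -> continuous_into A X f -> @simplicial_map R _ V A X f.
Proof.
move=> cA [fX fo].
have real x : A x -> exists s : seq V, [/\ X s, uniq s & weights_on (s : seq V) (f x : V -> R)].
  by move=> Ax; have [|s [Xs [us gs]]] := fX (f x); [exists x | exists s; split=> //; apply/geo_simplex_weights].
have [S HS] : exists S : seq V, forall x, A x -> forall v, v \notin S -> f x v = 0.
  apply: contrapT => nS.
  have H (S : seq V) : exists xv : T * V * seq V,
      [/\ A xv.1.1, xv.1.2 \notin S, f xv.1.1 xv.1.2 != 0 & [/\ X xv.2, uniq xv.2 &
       weights_on (xv.2 : seq V) (f xv.1.1 : V -> R)]].
    apply: contrapT => nH; apply: nS; exists S => x Ax v vS; apply: contrapT => fv.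
    by have [s Hs] := real x Ax; apply: nH; exists (x, v, s); split=> //; apply/eqP.
  have [c Hc] := choice H.
  (* [St n] collects the supports of the first [n] chosen points, which makes the vertices [pv n]
     pairwise distinct. *)
  pose St := fix St n : seq V := if n is n'.+1 then St n' ++ (c (St n')).2 else [::].
  pose px n := (c (St n)).1.1; pose pv n := (c (St n)).1.2.
  have Stmono m n : (m <= n)%N -> {subset St m <= St n}.
    elim: n => [|n IH]; first by rewrite leqn0 => /eqP ->.
    rewrite leq_eqVlt => /predU1P[->//|/IH sub] v /sub vS.
    by rewrite /= mem_cat vS.
  have pvS n : pv n \in St n.+1.
    have [_ _ fv [_ _ [_ tS _]]] := Hc (St n); rewrite /= mem_cat; apply/orP; right.
    by apply/negPn/negP => /tS E; rewrite E eqxx in fv.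
  have pvinj m n : pv m = pv n -> m = n.
    move=> E; wlog mn : m n E / (m < n)%N => [W|].
      by case: (ltngtP m n) => // h; [exact: W | symmetry; exact: W].
    have := Stmono _ _ mn _ (pvS m); rewrite E.
    by have [_ /negPf] := Hc (St n); rewrite /pv => -> .
  have pA n : A (px n) by have [] := Hc (St n).
  have ppos n : 0 < f (px n) (pv n).
    have [_ _ fv [_ _ [t0 _ _]]] := Hc (St n).
    by rewrite lt_neqAle eq_sym fv t0.
  have bnd (s : seq V) : exists B, forall n, pv n \in s -> (n < B)%N.
    elim: s => [|v s [B HB]]; first by exists 0%N.
    have [[m Em]|nm] := pselect (exists m, pv m = v); last first.
      exists B => n; rewrite inE => /predU1P[E|/HB//].
      by exfalso; apply: nm; exists n.
    exists (maxn B m.+1) => n; rewrite inE leq_max => /predU1P[E|/HB->//].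
    by rewrite (pvinj n m) ?ltnS ?leqnn ?orbT // E Em.
  (* A simplex contains only finitely many [pv n], so on it these conditions reduce to finitely
     many. The sets increase with [m] and cover the realization, yet [f (px m)] is never in
     [U m]. *)
  pose U m : set {ptws V -> RR} := [set t | realization X t /\
    forall n, (m <= n)%N -> t (pv n) < f (px n) (pv n)].
  have Uopen m : coherent_open X (U m).
    split; first by move=> t [].
    move=> s Xs us; have [B HB] := bnd s.
    exists [set t | forall n : 'I_B, (m <= n)%N -> t (pv n) < f (px n) (pv n)]; split.
      rewrite openE => t Wt; rewrite /interior /=.
      apply: (@filter_forall _ _ (fun (n : 'I_B) (t' : {ptws V -> RR}) =>
        (m <= n)%N -> t' (pv n) < f (px n) (pv n)) (nbhs t) (nbhs_filter t)) => n.
      have [mn|nm] := leqP m n; last by apply: (@filterE _ (nbhs t)) => y.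
      have : nbhs t [set t' : {ptws V -> RR} | t' (pv n) < f (px n) (pv n)].
        apply: open_nbhs_nbhs; split; last exact: Wt.
        by apply: open_coord_lt; exact: (@ptws_eval R).
      by apply: filterS => y.
    apply/seteqP; split=> t [Ht gt]; split=> //=; first by move=> n mn; case: Ht => _; apply.
    split; first by exists s.
    move=> n mn; have [ns|ns] := boolP (pv n \in s); first exact: (Ht (Ordinal (HB n ns))).
    by have [-> //] := gt; exact: ppos.
  have /compact_near_coveringP cov := cA.
  have : \forall m \near \oo, A `<=` [set x | A x -> U m (f x)].
    apply: cov => x Ax.
    have [s [Xs us ws]] := real x Ax; have [B HB] := bnd s.
    have Ux : U B (f x).
      split; first by exists s; split=> //; split=> //; apply/geo_simplex_weights.
      move=> n Bn; have [_ -> //] := ws; apply/negP => /HB; by rewrite ltnNge Bn.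
    have [Q [oQ EQ]] := fo _ (Uopen B).
    have [Qx _] : (Q `&` A) x by rewrite -EQ; split.
    exists (Q, [set m | (B <= m)%N]) => /=.
      by split; [exact: open_nbhs_nbhs | exact: nbhs_infty_ge].
    move=> [y m] /= [Qy Bm] Ay.
    have [[rf lt_f] _] : (f @^-1` U B `&` A) y by rewrite EQ.
    by split=> // n mn; apply: lt_f; exact: leq_trans mn.
  case=> m _ /(_ m (leqnn m)) /(_ (px m) (pA m) (pA m)) [_ /(_ m (leqnn m))].
  by rewrite ltxx.
split.
- exists (undup S); split; first exact: undup_uniq.
  move=> x Ax; have [s [Xs us [t0 ts t1]]] := real x Ax.
  have tS v : v \notin undup S -> f x v = 0 by rewrite mem_undup; exact: HS.
  split=> //; rewrite -t1.
  have uU : uniq (undup (undup S ++ s)) by exact: undup_uniq.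
  rewrite -(sum_enlarge (undup_uniq S) uU _ tS); last by move=> v vS; rewrite mem_undup mem_cat vS.
  by apply: sum_enlarge => // v vs; rewrite mem_undup mem_cat vs orbT.
- move=> x Ax s sp; have [s' [Xs us [t0 ts t1]]] := real x Ax.
  apply: cX Xs => v /sp fv; apply/negPn/negP => /ts E.
  by rewrite E ltxx in fv.
- move=> v x Ax; apply/cvgrPdist_lt => e e0; rewrite near_withinE.
  pose U : set {ptws V -> RR} := [set t | realization X t /\ `|f x v - t v| < e].
  have Uopen : coherent_open X U.
    split; first by move=> t [].
    move=> s Xs us; exists [set t | `|f x v - t v| < e]; split.
      apply: open_coord_lt; apply: cont_on_setT; apply: cont_on_norm.
      apply: cont_onB; first exact: cont_on_cst.
      by apply: cont_on_continuous; exact: (@ptws_eval R).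
    by apply/seteqP; split=> t; [move=> [[_ ?] ?] | move=> [? ?]; split=> //; split=> //; exists s].
  have [Q [oQ EQ]] := fo _ Uopen.
  have Qx : Q x.
    have : (Q `&` A) x; last by case.
    rewrite -EQ; split=> //; split; last by rewrite subrr normr0.
    by apply: fX; exists x.
  have : nbhs x Q by exact: open_nbhs_nbhs.
  apply: filterS => y Qy Ay.
  by have [[_ ?] _] : (f @^-1` U `&` A) y by rewrite EQ.
Qed.

End Coherent.


(** * From cubes to round spheres and disks *)

Section SphereDisk.
Variables (R : realType) (d : nat).
Implicit Types x y : 'rV[R]_d.+1.

Definition sq_norm x : R := \sum_(i < d.+1) x ord0 i ^+ 2.
Definition sup_norm x : R := \big[Num.max/0]_(i < d.+1) `|x ord0 i|.

Let lo : 'rV[R]_d.+1 := const_mx (-1).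
Let hi : 'rV[R]_d.+1 := const_mx 1.

Let lohi i : lo ord0 i <= hi ord0 i.
Proof. by rewrite !mxE; lra. Qed.

Let cube_dim : box_dim lo hi = d.+1.
Proof.
rewrite -[RHS]card_ord; apply: eq_card => i; rewrite !inE !mxE.
by rewrite (@lt_trans _ _ 0) ?ltr01 // oppr_lt0 ltr01.
Qed.

Lemma cont_sq_norm A : cont_on A sq_norm.
Proof.
by apply: cont_on_sum => i; apply: cont_onM; exact: cont_on_coord.
Qed.

Let cont_sup_norm A : cont_on A sup_norm.
Proof. by apply: cont_on_bigmax => i; apply: cont_on_norm; exact: cont_on_coord. Qed.

Let sup_attained x : exists i, sup_norm x = `|x ord0 i|.
Proof.
have [i _ E] := @eq_bigmax _ _ _ 0 ord0 predT (fun i : 'I_d.+1 => `|x ord0 i|) isT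
  (fun i _ => normr_ge0 _).
by exists i; exact: E.
Qed.

(** The bound [d.+1%:R^-1] keeps the formula continuous at 0. Points of the unit sphere have at
    least this sup norm, so there the map is the radial projection to the boundary of the cube. *)
Let to_cube x := (Num.max (sup_norm x) d.+1%:R^-1)^-1 *: x.
Let to_sphere y := (Num.sqrt (sq_norm y))^-1 *: y.

Let m_gt0 x : 0 < Num.max (sup_norm x) d.+1%:R^-1.
Proof. by rewrite lt_max invr_gt0 ltr0n orbT. Qed.

Let sup_sphere x : sq_norm x = 1 -> d.+1%:R^-1 <= sup_norm x.
Proof.
move=> sx; rewrite leNgt; apply/negP => lt_x.
have D1 : (1 : R) <= d.+1%:R by rewrite ler1n.
have n0 : 0 <= sup_norm x by exact: bigmax_ge_id.
have le_sq : sq_norm x <= d.+1%:R * sup_norm x ^+ 2.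
  have -> : d.+1%:R * sup_norm x ^+ 2 = \sum_(i < d.+1) sup_norm x ^+ 2.
    by rewrite big_const cardE size_enum_ord iter_addr_0 mulr_natl.
  apply: ler_sum => i _; rewrite -[x ord0 i ^+ 2]real_normK ?num_real //.
  by rewrite ler_pXn2r ?nnegrE //; exact: le_bigmax.
move: lt_x; rewrite -[_^-1]mul1r ltr_pdivlMr ?ltr0n // => lt_x.
by rewrite sx in le_sq; nra.
Qed.

(** On the sphere [to_sphere] undoes [to_cube]. Filling [f \o to_sphere] over the cube and composing
    with [to_cube] therefore fills [f] over the disk. *)
Lemma sphere_extends (V : eqType) (F : complex V) e (f : 'rV[R]_d.+1 -> V -> R) :
  conn R F e -> (d.+1 < e)%N ->
  simplicial_map [set x | sq_norm x = 1] F f ->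
  exists g, simplicial_map [set x | sq_norm x <= 1] F g /\
    forall x, sq_norm x = 1 -> g x = f x.
Proof.
move=> cF de sf.
have bd_pos y : box_boundary lo hi y -> 0 < sq_norm y.
  move=> [_ [i [_ yi]]]; apply: (@lt_le_trans _ _ (y ord0 i ^+ 2)).
    by case: yi => ->; rewrite mxE ?sqrrN expr1n ltr01.
  by rewrite /sq_norm (bigD1 i) //= lerDl sumr_ge0 // => j _; exact: sqr_ge0.
have sq_scale (a : R) x : sq_norm (a *: x) = a ^+ 2 * sq_norm x.
  by rewrite /sq_norm mulr_sumr; apply: eq_bigr => i _; rewrite mxE exprMn.
have ts y : box_boundary lo hi y -> sq_norm (to_sphere y) = 1.
  move=> /bd_pos y0; rewrite sq_scale exprVn sqr_sqrtr ?mulVf ?gt_eqF //; exact: ltW.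
have sfts : simplicial_map (box_boundary lo hi) F (f \o to_sphere).
  apply: smap_comp sf; first exact: ts.
  move=> y By; apply: cvgZ; last exact: cvg_within.
  apply: (cont_onV _ _ By).
    by move=> z /bd_pos z0; rewrite gt_eqF // sqrtr_gt0.
  apply: (cont_on_comp (B := setT)) => //.
    by move=> z Bz; exact: (cont_sq_norm Bz).
  by apply: cont_on_continuous => z; exact: sqrt_continuous.
have cde : (box_dim lo hi < e)%N by rewrite cube_dim.
have [g [sg gf]] := cF d lo hi lohi cde _ sfts.
have tc_box x : box lo hi (to_cube x).
  move=> i; rewrite !mxE -ler_norml normrM gtr0_norm ?invr_gt0 // ler_pdivrMl //.
  by rewrite mulr1 le_max; apply/orP; left; exact: le_bigmax.
exists (g \o to_cube); split.
  apply: smap_comp sg; first by move=> x _; exact: tc_box.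
  move=> x Dx; apply: cvgZ; last exact: cvg_within.
  apply: (cont_onV _ _ Dx); first by move=> z _; rewrite gt_eqF.
  by apply: cont_on_max; [exact: cont_sup_norm | exact: cont_on_cst].
move=> x sx.
have n0 : 0 < sup_norm x by apply: lt_le_trans (sup_sphere sx); rewrite invr_gt0 ltr0n.
have tcx : to_cube x = (sup_norm x)^-1 *: x.
  by rewrite /to_cube (max_idPl _) //; exact: sup_sphere.
have Bx : box_boundary lo hi (to_cube x).
  split; first exact: tc_box.
  have [i E] := sup_attained x.
  exists i; split; first by rewrite !mxE; lra.
  rewrite tcx !mxE E.
  have xi0 : x ord0 i != 0 by rewrite -normr_gt0 -E.
  by case: (ger0P (x ord0 i)) => _; [right|left]; rewrite ?invrN ?mulNr mulVf.
rewrite /= gf //=; congr f.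
rewrite /to_sphere tcx sq_scale sx mulr1 sqrtr_sqr ger0_norm ?invr_ge0 1?ltW // invrK.
by rewrite scalerA divff ?scale1r // gt_eqF.
Qed.

End SphereDisk.

Section ConnectedUpto.
Local Notation R := RbaseSymbolsImpl_R__canonical__reals_Real.

Lemma compact_sphere d : compact (unit_sphere d).
Proof.
have sub : unit_sphere d `<=` box (const_mx (-1) : 'rV[R]_d.+1) (const_mx 1).
  move=> x /= sx i; rewrite !mxE -ler_norml.
  have : x ord0 i ^+ 2 <= 1.
    rewrite -sx (bigD1 i) //= lerDl sumr_ge0 // => j _; exact: sqr_ge0.
  by rewrite -[X in _ <= X](expr1n _ 2) -real_normK ?num_real // ler_pXn2r ?nnegrE.
have cl : closed (unit_sphere d).
  have c : continuous (@sq_norm R d) by apply: cont_on_setT; exact: cont_sq_norm.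
  by apply: (closed_comp _ (@closed_eq R 1)) => x _; exact: c.
exact: (subclosed_compact cl (compact_box _ _) sub).
Qed.

Theorem conn_connected_upto (V : eqType) (X : complex V) (e : nat) (m : int) :
  face_closed X -> conn R X e -> m + 2 <= e%:Z -> connected_upto X m.
Proof.
move=> cX cc me; split=> [m1|d dm f fi].
  have e0 : (0 < e)%N by lia.
  (* A box of dimension 0 has empty boundary, so filling it produces a point of the realization. *)
  pose z : 'rV[R]_1 := 0.
  have zdim : (box_dim z z < e)%N.
    by rewrite /box_dim eq_card0 // => i; rewrite !inE ltxx.
  have E0 (x : 'rV[R]_1) : ~ box_boundary z z x by move=> [_ [i []]]; rewrite ltxx.
  have s0 : simplicial_map (box_boundary z z) X (fun _ _ => 0 : R).
    split; [by exists [::]; split=> // x /E0 | by move=> x /E0 | by move=> v x /E0].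
  have [g [sg _]] := cc 0%N z z (fun i => lexx _) zdim _ s0.
  have [+ _] := smap_continuous_into (f := g) sg.
  by move=> /(_ (g z)) H; exists (g z); apply: H; exists z => // i; rewrite lexx.
have sf := continuous_into_smap cX (@compact_sphere d) fi.
have de : (d.+1 < e)%N by lia.
have [g [sg gf]] := sphere_extends cc de sf.
by exists g; split=> //; exact: smap_continuous_into.
Qed.

End ConnectedUpto.

(** * Unimodular families *)

(** The last two entries are merged into the combination [s] and the shorter condition is applied.
    In the long family the entry [r k] is kept, and a multiple of it supplies the part of [t i * s]
    that does not come from the last entry. *)
Lemma SR_step (R : comNzRingType) k : (0 < k)%N -> SR k R -> SR k.+1 R.
Proof.
case: k => // k _ hSR r [a]; rewrite !big_ord_recr /= => ar.
pose s := a k * r k + a k.+1 * r k.+1.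
pose r' i := if (i < k)%N then r i else s.
have [|t [b]] := hSR r'.
  exists (fun i => if (i < k)%N then a i else 1); rewrite big_ord_recr /= /r' ltnn mul1r /s addrA -ar.
  by congr (_ + _ + _); apply: eq_bigr => i _; rewrite ltn_ord.
rewrite /= /r' ltnn => bt.
exists (fun i => if (i < k)%N then t i * a k.+1 else 0).
exists (fun i => if (i < k)%N then b i else - ((\sum_(j < k) b j * t j) * a k)).
rewrite big_ord_recr /= ltnn mul0r subr0 -[RHS]bt.
have -> : - ((\sum_(j < k) b j * t j) * a k) * r k = \sum_(j < k) - (b j * t j * (a k * r k)).
  by rewrite sumrN -mulr_suml mulNr !mulrA.
rewrite -big_split; apply: eq_bigr => i _; rewrite /= !ltn_ord /s; ring.
Qed.

Lemma SR_le (R : comNzRingType) k l : (0 < k)%N -> (k <= l)%N -> SR k R -> SR l R.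
Proof.
move=> k0; elim: l => [|l IH]; first by rewrite leqn0 => /eqP E; rewrite E in k0.
rewrite leq_eqVlt => /predU1P[<-//|kl] hSR; apply: SR_step; last exact: IH.
exact: leq_trans k0 kl.
Qed.

Section Umod.
Variable R : comNzRingType.

Definition ev n (v : 'rV[R]_n) (phi : 'cV[R]_n) : R := (v *m phi) ord0 ord0.

Lemma evDl n (v w : 'rV[R]_n) phi : ev (v + w) phi = ev v phi + ev w phi.
Proof. by rewrite /ev mulmxDl mxE. Qed.

Lemma evZl n a (v : 'rV[R]_n) phi : ev (a *: v) phi = a * ev v phi.
Proof. by rewrite /ev -scalemxAl mxE. Qed.

Lemma evBl n (v w : 'rV[R]_n) phi : ev (v - w) phi = ev v phi - ev w phi.
Proof. by rewrite evDl -scaleN1r evZl mulN1r. Qed.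

Lemma ev0l n (phi : 'cV[R]_n) : ev 0 phi = 0.
Proof. by rewrite /ev mul0mx mxE. Qed.

Lemma evDr n (v : 'rV[R]_n) phi psi : ev v (phi + psi) = ev v phi + ev v psi.
Proof. by rewrite /ev mulmxDr mxE. Qed.

Lemma evZr n a (v : 'rV[R]_n) phi : ev v (a *: phi) = a * ev v phi.
Proof. by rewrite /ev -scalemxAr mxE. Qed.

Lemma evBr n (v : 'rV[R]_n) phi psi : ev v (phi - psi) = ev v phi - ev v psi.
Proof. by rewrite evDr -scaleN1r evZr mulN1r. Qed.

Lemma ev0r n (v : 'rV[R]_n) : ev v 0 = 0.
Proof. by rewrite /ev mulmx0 mxE. Qed.

Lemma ev_suml n (I : Type) (s : seq I) (F : I -> 'rV[R]_n) phi :
  ev (\sum_(i <- s) F i) phi = \sum_(i <- s) ev (F i) phi.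
Proof.
by elim: s => [|i s IH]; rewrite ?big_nil ?ev0l // !big_cons evDl IH.
Qed.

Lemma ev_sumr n (I : Type) (s : seq I) (F : I -> 'cV[R]_n) v :
  ev v (\sum_(i <- s) F i) = \sum_(i <- s) ev v (F i).
Proof.
by elim: s => [|i s IH]; rewrite ?big_nil ?ev0r // !big_cons evDr IH.
Qed.

Lemma ev_mul m n (v : 'rV[R]_m) (A : 'M[R]_(m, n)) phi : ev (v *m A) phi = ev v (A *m phi).
Proof. by rewrite /ev mulmxA. Qed.

Lemma mulmx_ev n p (v : 'rV[R]_n) (phi : 'cV[R]_n) (w : 'rV[R]_p) :
  v *m (phi *m w) = ev v phi *: w.
Proof. by rewrite mulmxA [v *m phi]mx11_scalar mul_scalar_mx. Qed.

Lemma ev_delta n (v : 'rV[R]_n) i : ev v (delta_mx i ord0) = v ord0 i.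
Proof. by rewrite /ev -colE mxE. Qed.

(* Pointwise existence of dual functionals: for a duplicate-free list this
   says that the vectors are a basis of a direct summand. *)
Definition umod n : complex 'rV[R]_n := fun s =>
  forall v, v \in s -> exists phi, ev v phi = 1 /\ forall w, w \in s -> w != v -> ev w phi = 0.
Arguments umod n : clear implicits.

Lemma face_closed_umod n : face_closed (umod n).
Proof.
move=> s t ts us v /ts /us [phi [phi1 phi0]]; exists phi; split=> // w /ts; exact: phi0.
Qed.

Lemma umod_nil n : umod n [::].
Proof. by []. Qed.

Lemma umod_interpolate n (s : seq 'rV[R]_n) (c : 'rV[R]_n -> R) : umod n s ->
  exists phi, forall v, v \in s -> ev v phi = c v.
Proof.
move=> us.
have H (v : 'rV[R]_n) : exists phi, v \in s -> ev v phi = 1 /\ forall w, w \in s -> w != v -> ev w phi = 0.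
  by case: (boolP (v \in s)) => [/us [phi Hphi]|_]; [exists phi | exists 0].
have [psi Hpsi] := choice H.
exists (\sum_(v <- undup s) c v *: psi v) => v vs; rewrite ev_sumr.
have vu : v \in undup s by rewrite mem_undup.
rewrite (bigD1_seq v) ?undup_uniq //= evZr (proj1 (Hpsi v vs)) mulr1.
rewrite big_seq_cond big1 ?addr0 // => w /andP[]; rewrite mem_undup => ws wv.
by rewrite evZr (proj2 (Hpsi w ws)) ?mulr0 // eq_sym.
Qed.

Lemma link_link (V : eqType) (F : complex V) (t v s : seq V) : ~~ has (mem v) t ->
  link (link F v) t s <-> link F (t ++ v) s.
Proof.
move=> tv; rewrite /link catA has_cat (negPf tv) orbF; split.
  move=> [[Fs nv] nt]; split=> //; apply/hasPn => u us; rewrite /= mem_cat negb_or.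
  by rewrite (hasPn nt _ us) (hasPn nv _ us).
move=> [Fs /hasPn n]; split; first split=> //; apply/hasPn => u /n;
  by rewrite /= mem_cat negb_or => /andP[].
Qed.

(** * Splitting off one vector of a unimodular family *)

Section Reduction.
Variables (n : nat) (I : 'M[R]_(n, n.+1)) (J : 'M[R]_(n.+1, n)).
Variables (lam : 'cV[R]_n.+1) (w : 'rV[R]_n.+1).
Hypotheses (IJ : I *m J = 1%:M) (JI : J *m I = 1%:M - lam *m w) (w_lam : ev w lam = 1).

(** Here [I] embeds R^n as the kernel of [lam] and [J] projects along [w]. The composite
    [I *m (lam *m w)] is [I - I *m J *m I = 0], and [lam] cancels [w] on the right. *)
Lemma splitting_lam : I *m lam = 0.
Proof.
have wl : w *m lam = 1%:M by rewrite [LHS]mx11_scalar -/(ev w lam) w_lam.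
have : I *m (lam *m w) = 0.
  have -> : lam *m w = 1%:M - J *m I by rewrite JI opprB addrC subrK.
  by rewrite mulmxBr mulmx1 mulmxA IJ mul1mx subrr.
by move=> /(congr1 (fun A => A *m lam)); rewrite mulmxA -!mulmxA wl mulmx1 mul0mx.
Qed.

Lemma splitting_w : w *m J = 0.
Proof.
have : w *m (J *m I) = 0 by rewrite JI mulmxBr mulmx1 mulmx_ev w_lam scale1r subrr.
by move=> /(congr1 (fun A => A *m J)); rewrite -!mulmxA IJ mulmx1 mul0mx.
Qed.

Lemma splitting_back x : x *m J *m I = x - ev x lam *: w.
Proof. by rewrite -mulmxA JI mulmxBr mulmx1 mulmx_ev. Qed.

Lemma splittingK : cancel (fun y : 'rV[R]_n => y *m I) (fun x => x *m J).
Proof. by move=> y; rewrite -mulmxA IJ mulmx1. Qed.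

Variable eta : seq 'rV[R]_n.+1.
Hypotheses (weta : w \notin eta) (ueta : umod n.+1 (w :: eta)).

Lemma splitting_inj : {in eta &, injective (fun x => x *m J)}.
Proof.
move=> x y xe ye /= xyJ; apply/eqP/negPn/negP => xy.
have [phi [phi1 phi0]] : exists phi, ev x phi = 1 /\
    forall z, z \in w :: eta -> z != x -> ev z phi = 0.
  by apply: ueta; rewrite inE xe orbT.
have : ev (x *m J *m I) phi = ev (y *m J *m I) phi by rewrite xyJ.
rewrite !splitting_back !evBl !evZl phi1 (phi0 w) ?inE ?eqxx //; last first.
  by apply: contraNneq weta => ->.
rewrite (phi0 y) ?inE ?ye ?orbT //; last by rewrite eq_sym.
by rewrite !mulr0 !subr0 => /eqP; rewrite oner_eq0.
Qed.

Lemma umod_splitting (s : seq 'rV[R]_n) :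
  link (umod n.+1) (w :: eta) [seq y *m I | y <- s] <->
  link (umod n) [seq x *m J | x <- eta] s.
Proof.
have wJ := splitting_w; have Il := splitting_lam.
have Iinj : injective (fun y : 'rV[R]_n => y *m I) by exact: can_inj splittingK.
split=> -[us /hasPn dis].
  have disI y x : y \in s -> x \in w :: eta -> y *m I != x.
    move=> ys xe; have := dis (y *m I) (map_f _ ys).
    by apply: contraNneq => ->.
  have inI y : y \in s -> y *m I \in [seq y *m I | y <- s] ++ w :: eta.
    by move=> ys; rewrite mem_cat; apply/orP; left; apply/mapP; exists y.
  have inE' x : x \in w :: eta -> x \in [seq y *m I | y <- s] ++ w :: eta.
    by move=> xe; rewrite mem_cat xe orbT.
  have we : w \in w :: eta by rewrite inE eqxx.
  have ee x : x \in eta -> x \in w :: eta by move=> xe; rewrite inE xe orbT.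
  split.
    move=> v; rewrite mem_cat => /orP[vs|/mapP[x xe ->]].
      have [phi [phi1 phi0]] := us _ (inI v vs).
      exists (I *m phi); rewrite -ev_mul; split=> // y.
      rewrite mem_cat -ev_mul => /orP[ys yv|/mapP[x xe ->] _].
        by apply: phi0; [exact: inI | rewrite (inj_eq Iinj)].
      rewrite splitting_back evBl evZl !phi0 ?mulr0 ?subr0 //; try exact: inE'; try exact: inE' (ee _ xe);
        by rewrite eq_sym disI // ee.
    have [phi [phi1 phi0]] := us _ (inE' x (ee x xe)).
    have wx : w != x by apply: contraNneq weta => ->.
    have wphi : ev w phi = 0 by apply: phi0 => //; exact: inE'.
    exists (I *m phi); rewrite -ev_mul splitting_back evBl evZl wphi mulr0 subr0; split=> // y.
    rewrite mem_cat -ev_mul => /orP[ys _|/mapP[z ze ->] zx].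
      by apply: phi0; [exact: inI | rewrite disI // ee].
    rewrite splitting_back evBl evZl wphi mulr0 subr0 phi0 //; first exact: inE' (ee _ ze).
    by apply: contraNneq zx => ->.
  apply/hasPn => y ys; apply/negP => /= /mapP[x xe yx].
  have [phi [phi1 phi0]] := us _ (inI y ys).
  have : ev (y *m I) phi = ev (x *m J *m I) phi by rewrite yx.
  rewrite phi1 splitting_back evBl evZl !phi0 ?mulr0 ?subr0; try exact: inE'; try exact: inE' (ee _ xe).
  - by move/eqP; rewrite oner_eq0.
  - by rewrite eq_sym disI // ee.
  - by rewrite eq_sym disI // ee.
have etaJ x : x \in eta -> x *m J \in s ++ [seq x *m J | x <- eta].
  by move=> xe; rewrite mem_cat; apply/orP; right; apply/mapP; exists x.
have sJ y : y \in s -> y \in s ++ [seq x *m J | x <- eta] by move=> ys; rewrite mem_cat ys.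
have evJ (phi : 'cV[R]_n) y : ev (y *m I) (J *m phi) = ev y phi.
  by rewrite -ev_mul -mulmxA IJ mulmx1.
have ewJ (phi : 'cV[R]_n) : ev w (J *m phi) = 0 by rewrite -ev_mul wJ ev0l.
have disJ y x : y \in s -> x \in eta -> y != x *m J.
  by move=> ys xe; have := dis y ys; apply: contraNneq => ->; apply/mapP; exists x.
split; last first.
  apply/hasPn => _ /mapP[y ys ->]; rewrite /= inE negb_or; apply/andP; split.
    apply/negP => /eqP yw.
    have : ev (y *m I) lam = 1 by rewrite yw.
    by rewrite ev_mul Il ev0r => /esym /eqP; rewrite oner_eq0.
  by apply/negP => ye; have := disJ y _ ys ye; rewrite splittingK eqxx.
move=> v; rewrite mem_cat inE => /or3P[/mapP[y ys ->]|/eqP ->|ve].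
- have [phi [phi1 phi0]] := us _ (sJ y ys).
  exists (J *m phi); rewrite evJ; split=> // z.
  rewrite mem_cat inE => /or3P[/mapP[y' y's ->]|/eqP -> _|ze _].
  + by rewrite (inj_eq Iinj) evJ => yy'; apply: phi0 => //; exact: sJ.
  + exact: ewJ.
  + by rewrite -ev_mul phi0 //; [exact: etaJ | rewrite eq_sym disJ].
(* The functional dual to [w] is [lam] corrected to vanish on [eta]. The values of [lam] on [eta]
   are well defined on the projections because projecting is injective on [eta]. *)
- have [c Hc] : exists c : 'rV[R]_n -> R, forall x, x \in eta -> c (x *m J) = ev x lam.
    have H (y : 'rV[R]_n) : exists c : R, forall x, x \in eta -> x *m J = y -> c = ev x lam.
      have [[x [xe xy]]|nx] := pselect (exists x, x \in eta /\ x *m J = y).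
        by exists (ev x lam) => x' x'e x'y; rewrite (splitting_inj xe x'e) //= xy x'y.
      by exists 0 => x xe xy; exfalso; apply: nx; exists x.
    have [c Hc] := choice H; exists c => x xe; exact: Hc.
  have [phi Hphi] := umod_interpolate
    (fun y => if y \in [seq x *m J | x <- eta] then c y else 0) us.
  exists (lam - J *m phi); rewrite evBr w_lam ewJ subr0; split=> // z.
  rewrite mem_cat inE => /or3P[/mapP[y ys ->] _|/eqP ->|ze _]; last 2 first.
  + by rewrite eqxx.
  + have zJ : z *m J \in [seq x *m J | x <- eta] by apply/mapP; exists z.
    by rewrite evBr -ev_mul Hphi ?etaJ // zJ Hc // subrr.
  rewrite evBr evJ Hphi ?sJ // ev_mul Il ev0r sub0r ifF ?oppr0 //.
  by apply/negbTE; exact: (dis y ys).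
- have [phi [phi1 phi0]] := us _ (etaJ v ve).
  exists (J *m phi); rewrite -ev_mul; split=> // z.
  rewrite mem_cat inE => /or3P[/mapP[y ys ->] _|/eqP -> _|ze zv].
  + by rewrite evJ; apply: phi0; [exact: sJ | exact: disJ].
  + exact: ewJ.
  + rewrite -ev_mul phi0 //; first exact: etaJ.
    by apply: contraNneq zv => /(splitting_inj ze ve) ->.
Qed.

Lemma umod_image : umod n [seq x *m J | x <- eta].
Proof.
have [+ _] := umod_splitting [::]; case; first by split=> //=; exact: ueta.
by [].
Qed.

Lemma uniq_image : uniq eta -> uniq [seq x *m J | x <- eta].
Proof. by move=> ue; rewrite map_inj_in_uniq //; exact: splitting_inj. Qed.

End Reduction.

(** As [h] is inverse to [g], the rows of [h] other than row [a] form a basis of the kernel of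
    [lam]. The factor [1 - lam *m w] turns the projection along row [a] of [h] into the projection
    along [w]. *)
Lemma splitting_exists n (g h : 'M[R]_n.+1) (a : 'I_n.+1) (w : 'rV[R]_n.+1) :
  g *m h = 1%:M -> h *m g = 1%:M -> let lam := g *m delta_mx a ord0 in
  ev w lam = 1 ->
  let I := row' a h in let J := (1%:M - lam *m w) *m col' a g in
  I *m J = 1%:M /\ J *m I = 1%:M - lam *m w.
Proof.
move=> gh hg lam wl I J.
have IE : I = row' a 1%:M *m h.
  by apply/matrixP => i j; rewrite !mxE -[h in LHS]mul1mx mxE; apply: eq_bigr => l _; rewrite !mxE.
have PE : col' a g = g *m col' a 1%:M.
  by apply/matrixP => i j; rewrite !mxE -[g in LHS]mulmx1 mxE; apply: eq_bigr => l _; rewrite !mxE.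
have Il : I *m lam = 0.
  rewrite IE /lam -mulmxA (mulmxA h) hg mul1mx; apply/matrixP => i j; rewrite !mxE (bigD1 a) //= big1.
    by rewrite !mxE [lift _ _ == _]eq_sym (negPf (neq_lift _ _)) mul0r addr0.
  by move=> l la; rewrite !mxE (negPf la) mulr0.
have EP : row' a 1%:M *m col' a 1%:M = 1%:M :> 'M[R]_n.
  apply/matrixP => i j; rewrite !mxE (bigD1 (lift a i)) //= big1; last first.
    by move=> l li; rewrite !mxE eq_sym (negPf li) mul0r.
  by rewrite !mxE eqxx mul1r addr0 (inj_eq lift_inj).
have PE' : col' a 1%:M *m row' a 1%:M = 1%:M - (delta_mx a ord0 : 'cV[R]_n.+1) *m (delta_mx ord0 a : 'rV[R]_n.+1).
  apply/matrixP => i j; rewrite mul_delta_mx !mxE.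
  have [i' ->|->] := unliftP a i.
    rewrite (bigD1 i') //= big1 => [|l li]; last first.
      by rewrite !mxE (inj_eq lift_inj) eq_sym (negPf li) mul0r.
    by rewrite !mxE eqxx mul1r addr0 [lift _ _ == a]eq_sym (negPf (neq_lift _ _)) subr0.
  rewrite big1 => [|l _]; last by rewrite !mxE (negPf (neq_lift _ _)) mul0r.
  by rewrite eqxx eq_sym subrr.
split.
  rewrite /J mulmxA mulmxBr mulmx1 mulmxA Il mul0mx subr0 PE IE.
  by rewrite -mulmxA (mulmxA h) hg mul1mx EP.
have wg : w *m lam = 1%:M by rewrite [LHS]mx11_scalar -/(ev w lam) wl.
pose u : 'rV[R]_n.+1 := (delta_mx ord0 a : 'rV[R]_n.+1) *m h.
have K : g *m col' a 1%:M *m (row' a 1%:M *m h) = 1%:M - lam *m u.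
  rewrite -mulmxA (mulmxA (col' a _)) PE' mulmxBl mul1mx mulmxBr gh.
  by rewrite -mulmxA (mulmxA g).
rewrite /J PE IE -mulmxA K mulmxBr mulmx1 mulmxBl mul1mx.
by rewrite -(mulmxA lam w) (mulmxA w lam) wg mul1mx subrr subr0.
Qed.

End Umod.
Arguments umod {R} n.


(** * Splittings and vertices from the stable range condition *)

Section Slab.
Variable R : comNzRingType.

Lemma evE n (v : 'rV[R]_n) phi : ev v phi = \sum_i v ord0 i * phi i ord0.
Proof. by rewrite /ev mxE. Qed.

Lemma transvection_mul n (c : 'cV[R]_n) (t : 'rV[R]_n) : ev t c = 0 ->
  (1%:M - c *m t) *m (1%:M + c *m t) = 1%:M /\ (1%:M + c *m t) *m (1%:M - c *m t) = 1%:M.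
Proof.
move=> tc; have E : c *m t *m (c *m t) = 0.
  by rewrite -mulmxA mulmx_ev tc scale0r mulmx0.
split.
  by rewrite mulmxDr mulmx1 mulmxBl mul1mx E subr0 subrK.
by rewrite mulmxBr mulmx1 mulmxDl mul1mx E addr0 addrK.
Qed.

Lemma unimodular_ev n (w : 'rV[R]_n.+1) phi : ev w phi = 1 ->
  unimodular n.+1 (fun i => w ord0 (inord i)).
Proof.
move=> wphi; exists (fun i => phi (inord i) ord0); rewrite -wphi evE.
by apply: eq_bigr => i _; rewrite inord_val mulrC.
Qed.

(** The functional [lam] is found as a column of a product of transvections fixing the
    last-coordinate functional [dm], so an entry of [w] other than the last must be made 1. The
    condition is used twice: the last entry is absorbed into the others, then the entry [q], after
    which the [q] leading entries are unimodular and can correct the entry [q] to 1. *)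
Lemma slab_splitting q (w : 'rV[R]_q.+2) phi : SR q.+1 R -> SR q.+2 R -> ev w phi = 1 ->
  exists (I : 'M[R]_(q.+1, q.+2)) (J : 'M[R]_(q.+2, q.+1)) lam,
  [/\ I *m J = 1%:M, J *m I = 1%:M - lam *m w, ev w lam = 1 &
      forall x : 'rV[R]_q.+1, (x *m I) ord0 ord_max = x ord0 ord_max].
Proof.
move=> SR1 SR2 /unimodular_ev /SR2 /= [t /SR1 /= [t' [d dE]]].
pose r i : R := w ord0 (inord i).
pose r' i := r i - t i * r q.+1.
have {}dE : \sum_(i < q) d i * (r' i - t' i * r' q) = 1 by exact: dE.
pose y : 'I_q.+2 := inord q.
have yq : y = q :> nat by rewrite inordK.
have y_max : (y == ord_max) = false by apply/negP => /eqP/(congr1 val); rewrite /= yq; lia.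
pose t1 : 'rV[R]_q.+2 := \row_i (if (i < q.+1)%N then t i else 0).
pose t2 : 'rV[R]_q.+2 := \row_i (if (i < q)%N then t' i else 0).
pose D : 'cV[R]_q.+2 := \col_i (if (i < q)%N then (1 - r' q) * d i else 0).
pose dm : 'cV[R]_q.+2 := delta_mx ord_max ord0.
pose dy : 'cV[R]_q.+2 := delta_mx y ord0.
pose dy' : 'rV[R]_q.+2 := delta_mx ord0 y.
have t1m : ev t1 dm = 0 by rewrite ev_delta mxE ltnn.
have t2y : ev t2 dy = 0 by rewrite ev_delta mxE yq ltnn.
have t2m : ev t2 dm = 0 by rewrite ev_delta mxE /= ltnNge leqnSn.
have dyD : ev dy' D = 0 by rewrite /ev -rowE !mxE yq ltnn.
have dydm : ev dy' dm = 0 by rewrite ev_delta !mxE eq_sym y_max andbF.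
have [g1h1 h1g1] := transvection_mul t1m.
have [g2h2 h2g2] := transvection_mul t2y.
have [h3g3 g3h3] := transvection_mul dyD.
set g1 := 1%:M - dm *m t1 in g1h1 h1g1; set h1 := 1%:M + dm *m t1 in g1h1 h1g1.
set g2 := 1%:M - dy *m t2 in g2h2 h2g2; set h2 := 1%:M + dy *m t2 in g2h2 h2g2.
set h3 := 1%:M - D *m dy' in g3h3 h3g3; set g3 := 1%:M + D *m dy' in g3h3 h3g3.
have gh : (g1 *m g2 *m g3) *m (h3 *m h2 *m h1) = 1%:M.
  rewrite -!mulmxA (mulmxA g3) g3h3 mul1mx (mulmxA g2) g2h2 mul1mx; exact: g1h1.
have hg : (h3 *m h2 *m h1) *m (g1 *m g2 *m g3) = 1%:M.
  rewrite -!mulmxA (mulmxA h1) h1g1 mul1mx (mulmxA h2) h2g2 mul1mx; exact: h3g3.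
have hdm : (h3 *m h2 *m h1) *m dm = dm.
  have e (c : 'cV[R]_q.+2) (s : 'rV[R]_q.+2) : ev s dm = 0 -> c *m s *m dm = 0.
    by move=> sm; rewrite -mulmxA [s *m dm]mx11_scalar -/(ev s dm) sm raddf0 mulmx0.
  have d1 : h1 *m dm = dm by rewrite /h1 mulmxDl mul1mx e ?addr0.
  have d2 : h2 *m dm = dm by rewrite /h2 mulmxDl mul1mx e ?addr0.
  have d3 : h3 *m dm = dm by rewrite /h3 mulmxBl mul1mx e ?subr0.
  by rewrite -!mulmxA d1 d2 d3.
have wlam : ev w ((g1 *m g2 *m g3) *m dy) = 1.
  have -> : (g1 *m g2 *m g3) *m dy = g1 *m (g2 *m (dy + D)).
    rewrite -!mulmxA; congr (_ *m (_ *m _)); rewrite /g3 mulmxDl mul1mx -mulmxA.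
    rewrite [dy' *m dy]mx11_scalar -/(ev dy' dy) ev_delta !mxE !eqxx /=.
    by rewrite mulmx1.
  rewrite -!ev_mul.
  have w1E i : (i < q.+1)%N -> (w *m g1) ord0 (inord i) = r' i.
    move=> iq; rewrite mulmxBr mulmx1 mulmx_ev ev_delta !mxE inordK; last lia.
    rewrite iq /r' /r mulrC; congr (_ - _ * w _ _).
    by apply: val_inj; rewrite /= inordK.
  set w1 := w *m g1 in w1E *.
  have w1y : w1 ord0 y = r' q by exact: w1E.
  have w2E (i : 'I_q.+2) : (w1 *m g2) ord0 i = w1 ord0 i - (if (i < q)%N then t' i else 0) * r' q.
    by rewrite mulmxBr mulmx1 mulmx_ev ev_delta w1y !mxE mulrC.
  rewrite evDr ev_delta evE w2E yq ltnn mul0r subr0 w1y.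
  rewrite !big_ord_recr /= !w2E /= !mxE ltnn ltnNge leqnSn /= !mulr0 !addr0.
  have -> : \sum_(i < q) (w1 *m g2) ord0 (widen_ord (leqnSn q.+1) (widen_ord (leqnSn q) i)) *
      D (widen_ord (leqnSn q.+1) (widen_ord (leqnSn q) i)) ord0 =
      (1 - r' q) * \sum_(i < q) d i * (r' i - t' i * r' q).
    rewrite mulr_sumr; apply: eq_bigr => i _; rewrite w2E [D _ _]mxE /= ltn_ord.
    rewrite -(w1E i); last by rewrite ltnS ltnW.
    have -> : inord i = widen_ord (leqnSn q.+1) (widen_ord (leqnSn q) i) :> 'I_q.+2.
      by apply: val_inj; rewrite /= inordK //; have := ltn_ord i; lia.
    ring.
  by rewrite dE mulr1 addrC subrK.
have [IJ JI] := splitting_exists gh hg wlam.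
exists (row' y (h3 *m h2 *m h1)), ((1%:M - (g1 *m g2 *m g3) *m dy *m w) *m col' y (g1 *m g2 *m g3)),
  ((g1 *m g2 *m g3) *m dy); split=> // x.
rewrite -[LHS]ev_delta -[RHS]ev_delta ev_mul; congr ev.
have -> : row' y (h3 *m h2 *m h1) *m delta_mx ord_max ord0 = row' y (h3 *m h2 *m h1 *m dm).
  by apply/matrixP => i j; rewrite !mxE; apply: eq_bigr => l _; rewrite !mxE.
rewrite hdm; apply/matrixP => i j; rewrite (ord1 j) !mxE eqxx !andbT; congr (_%:R); congr nat_of_bool.
rewrite -!val_eqE /= /bump yq; have := ltn_ord i; case: (leqP q i) => h /=; lia.
Qed.

(** With [t] and [d] from the stable range condition, [x = (t, 1)] is annihilated by a functional
    taking the value 1 at [w]; the last coordinate, corrected by this functional, is dual to [x].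
    This gives a vertex in the link of [w] when only nonemptiness is asked. *)
Lemma umod_pair n (w : 'rV[R]_n.+1) phi : SR n.+1 R -> ev w phi = 1 ->
  exists x : 'rV[R]_n.+1, [/\ x ord0 ord_max = 1, x != w & umod n.+1 [:: x; w]].
Proof.
move=> hSR /unimodular_ev /hSR /= [t [d dE]].
pose r i : R := w ord0 (inord i).
have {}dE : \sum_(i < n) d i * (r i - t i * r n) = 1 by exact: dE.
pose x : 'rV[R]_n.+1 := \row_i (if (i < n)%N then t i else 1).
pose lam : 'cV[R]_n.+1 := \col_i (if (i < n)%N then d i else - \sum_(j < n) d j * t j).
have xmax : x ord0 ord_max = 1 by rewrite mxE ltnn.
have rE (i : 'I_n) : w ord0 (widen_ord (leqnSn n) i) = r i.
  by congr (w _ _); apply: val_inj; rewrite /= inordK // ltnS ltnW.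
have rn : w ord0 ord_max = r n by congr (w _ _); apply: val_inj; rewrite /= inordK.
have wlam : ev w lam = 1.
  rewrite evE big_ord_recr /= mxE ltnn rn -dE mulrN mulr_sumr -sumrB.
  by apply: eq_bigr => i _; rewrite mxE /= ltn_ord rE; ring.
have xlam : ev x lam = 0.
  rewrite evE big_ord_recr /= !mxE ltnn mul1r -sumrB big1 // => i _.
  by rewrite !mxE /= ltn_ord mulrC subrr.
have xw : x != w by apply/eqP => E; move: xlam; rewrite E wlam => /eqP; rewrite oner_eq0.
exists x; split=> // v; rewrite !inE => /orP[] /eqP ->.
  exists (delta_mx ord_max ord0 - r n *: lam); split.
    by rewrite evBr evZr ev_delta xlam xmax mulr0 subr0.
  move=> z; rewrite !inE => /orP[] /eqP -> //; first by rewrite eqxx.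
  by rewrite evBr evZr ev_delta wlam rn mulr1 subrr.
exists lam; split=> // z; rewrite !inE => /orP[] /eqP -> //.
by rewrite eqxx.
Qed.

End Slab.

(** * Connectivity of the complex of unimodular families *)

Section UmodConn.
Variables (R : comNzRingType) (K : realType) (k : nat).
Hypotheses (hk : (2 <= k)%N) (hSR : SR k R).

Definition slab n : pred 'rV[R]_n.+1 :=
  fun x => (x ord0 ord_max == 0) || (x ord0 ord_max == 1).

(** The index of [conn] is shifted by 2, and truncated subtraction is harmless because [conn] at 0
    is vacuous. *)
Definition links_conn n := forall v : seq 'rV[R]_n, uniq v -> umod n v ->
  conn K (link (umod n) v) (n + 2 - size v - k).

(** The index is one less than the rank: a last coordinate has to exist. *)
Definition slab_links_conn n := forall v : seq 'rV[R]_n.+1, uniq v -> umod n.+1 v ->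
  conn K (full_on (@slab n) (link (umod n.+1) v)) (n.+1 + 2 - size v - k).

Lemma umod_eq_mem n (s t : seq 'rV[R]_n) : s =i t -> umod n s -> umod n t.
Proof. by move=> st; apply: face_closed_umod => v; rewrite st. Qed.

(** For [tau] outside the slab, the link of [tau] in the link of [v] is the link of [tau ++ v],
    whose part in the slab is controlled by hypothesis. *)
Lemma links_of_slab_links n : slab_links_conn n -> links_conn n.+1.
Proof.
move=> S v uv hv; have cF := @face_closed_link _ (umod n.+1) v (@face_closed_umod R n.+1).
apply: (@conn_enlarge _ _ (@slab n)) => //.
move=> tau ut [htau /hasPn dis] _.
have uvt : uniq (tau ++ v) by rewrite cat_uniq ut uv andbT; apply/hasPn => x xv; apply: contraL xv => /dis.
have := S _ uvt htau; rewrite size_cat.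
have -> : (n.+1 + 2 - (size tau + size v) - k = n.+1 + 2 - size v - k - size tau)%N by lia.
have dis' : ~~ has (mem v) tau by apply/hasPn.
by apply: conn_ext => s; split=> -[Fs Xs]; split=> //; apply/(link_link (umod n.+1) s dis').
Qed.

Lemma link_eq_mem (V : eqType) (F : complex V) (s t u : seq V) : face_closed F -> s =i t ->
  link F s u -> link F t u.
Proof.
move=> cF st [Fu dis]; split; first by apply: cF Fu => x; rewrite !mem_cat st.
by apply/hasPn => x xu; rewrite /= -st; exact: (hasPn dis).
Qed.

(** A slab simplex without vertices of last coordinate 0 has last coordinate 1 throughout. The
    last-coordinate functional then splits off its first vertex, and the other vertices project to a
    unimodular family in R^n. What remains after pushing lies in the star of [em], taken within the
    slab. *)
Lemma slab_links_nil n : links_conn n -> conn K (full_on (@slab n) (link (umod n.+1) [::])) (n.+1 + 2 - k).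
Proof.
move=> T; set F := full_on _ _.
have cU := @face_closed_umod R n.+1.
have cF : face_closed F by apply: face_closed_full_on; exact: face_closed_link.
have FE s : F s <-> umod n.+1 s /\ all (@slab n) s.
  rewrite /F /full_on /link cats0; split=> [[[? _] ?]|[? ?]]; split=> //; split=> //.
  by apply/hasPn.
pose dm : 'cV[R]_n.+1 := delta_mx ord_max ord0.
pose em : 'rV[R]_n.+1 := delta_mx ord0 ord_max.
have em_dm : ev em dm = 1 by rewrite ev_delta mxE !eqxx.
pose Z : pred 'rV[R]_n.+1 := fun x => x ord0 ord_max == 0.
move=> N lo hi lohi dim f sf.
have F0 : F [::] by apply/FE; split.
apply: (@extends_enlarge _ _ Z F F (n.+1 + 2 - k)) sf => //.
- move=> [//|w eta] ut _ /FE[htau Xtau] nZ.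
  have max1 x : x \in w :: eta -> x ord0 ord_max = 1.
    move=> xt; have := allP Xtau x xt; rewrite /slab -/(Z x).
    by rewrite (negPf (hasPn nZ x xt)) /= => /eqP.
  have /andP[weta ueta] : (w \notin eta) && uniq eta by [].
  have w_dm : ev w (1%:M *m dm) = 1 by rewrite mul1mx ev_delta max1 // inE eqxx.
  have [] := splitting_exists (mulmx1 (1%:M : 'M[R]_n.+1)) (mulmx1 1%:M) w_dm.
  set I := row' _ _; set J := _ *m col' _ _; rewrite mul1mx -/dm => IJ JI.
  rewrite mul1mx in w_dm.
  have Il := splitting_lam IJ JI w_dm.
  have cJ : conn K (link (umod n) [seq x *m J | x <- eta]) (n.+1 + 2 - k - size (w :: eta)).
    have := T _ (uniq_image JI weta htau ueta) (umod_image IJ JI w_dm weta htau).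
    by rewrite size_map /=; have -> : (n + 2 - size eta - k = n.+1 + 2 - k - (size eta).+1)%N by lia.
  apply: (@conn_relabel _ _ _ _ _ (fun y => y *m I) (fun x => x *m J)) cJ.
  + by apply: face_closed_full_on; exact: face_closed_link.
  + exact: splittingK.
  + move=> s [_ /allP Zs] v vs; rewrite (splitting_back JI) ev_delta (eqP (Zs v vs)).
    by rewrite scale0r subr0.
  + move=> s; rewrite -(umod_splitting IJ JI w_dm weta htau); split.
      by move=> [[/FE[us _] dis] _]; split.
    move=> [us dis].
    have Zs : all Z [seq y *m I | y <- s].
      apply/allP => _ /mapP[y _ ->]; rewrite /Z -[X in X == _]ev_delta ev_mul -/dm Il ev0r.
      exact: eqxx.
    split=> //; split=> //; apply/FE; split=> //; rewrite all_cat Xtau andbT.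
    by apply: sub_all Zs => x; rewrite /slab /Z => ->.
- move=> f1 sf1.
  pose St : complex 'rV[R]_n.+1 := fun s => umod n.+1 (em :: s) /\ all (@slab n) s.
  have StF s : St s -> F s.
    by move=> [us Xs]; apply/FE; split=> //; apply: cU us => x; rewrite inE => ->; rewrite orbT.
  apply: (extends_mono StF).
  have ZSt s : full_on Z F s -> St s.
    move=> [/FE[us Xs] /allP Zs]; split=> //.
    have sdm x : x \in s -> ev x dm = 0 by move=> /Zs /eqP; rewrite ev_delta.
    move=> v; rewrite inE => /predU1P[->|vs].
      exists dm; split=> // z; rewrite inE => /predU1P[->|/sdm//].
      by rewrite eqxx.
    have [phi [phi1 phi0]] := us v vs.
    exists (phi - ev em phi *: dm); rewrite evBr evZr sdm // mulr0 subr0; split=> // z.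
    rewrite inE => /predU1P[-> _|zs zv]; rewrite evBr evZr; first by rewrite em_dm mulr1 subrr.
    by rewrite sdm // mulr0 subr0; exact: phi0.
  apply: (@conn_cone _ _ St em (n.+1 + 2 - k)) => //.
  + move=> s [us Xs]; split; first by apply: umod_eq_mem us => x; rewrite !inE orbA orbb.
    by rewrite /= Xs andbT /slab mxE !eqxx orbT.
  + split=> //; apply: cU (_ : umod n.+1 (em :: [::])) => //.
    move=> v; rewrite inE => /eqP ->; exists dm; split=> // z.
    by rewrite inE => /eqP ->; rewrite eqxx.
  + move=> s t ts [us /allP Xs]; split; last by apply/allP => x /ts/Xs.
    by apply: cU us => x; rewrite !inE => /predU1P[->|/ts ->]; rewrite ?eqxx ?orbT.
  + exact: smap_mono ZSt sf1.
Qed.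

(** If [k <= n], the kernel of the functional from [slab_splitting] is a copy of R^n respecting the
    last coordinate, so its links are slab links one rank lower. If [k = n.+1], one of the two
    stable range conditions is not at hand, but then only nonemptiness of the link of a single
    vertex is claimed. *)
Lemma slab_links_step n : links_conn n -> (forall q, n = q.+1 -> slab_links_conn q) ->
  slab_links_conn n.
Proof.
move=> T S [|w v0] uv hv; first by rewrite subn0; exact: slab_links_nil.
have [->|e0] := posnP (n.+1 + 2 - size (w :: v0) - k); first exact: conn0.
have cU := @face_closed_umod R n.+1.
have [phi [phi1 _]] := hv w (mem_head _ _).
have kn : (k <= n.+1)%N by move: e0 => /=; lia.
have k0 : (0 < k)%N by lia.
have SRn := SR_le k0 kn hSR.
set F := full_on _ _.
have cF : face_closed F by apply: face_closed_full_on; exact: face_closed_link.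
have [kn'|nk] := leqP k n; last first.
  have v00 : v0 = [::] by apply: size0nil; move: e0 => /=; lia.
  have -> : (n.+1 + 2 - size (w :: v0) - k = 1)%N by rewrite v00 /=; lia.
  have [x [x1 xw ux]] := umod_pair SRn phi1.
  apply: (@conn1 _ _ _ x) => //; split; last by rewrite /= /slab x1 eqxx orbT.
  rewrite v00; split; first exact: ux.
  by rewrite /= orbF inE (negPf xw).
have [q nq] : exists q, n = q.+1 by exists n.-1; lia.
subst n.
have SRq := SR_le k0 kn' hSR.
have [I [J [lam [IJ JI wlam Imax]]]] := slab_splitting SRq SRn phi1.
have Il := splitting_lam IJ JI wlam.
pose X' : pred 'rV[R]_q.+2 := fun x => ev x lam == 0.
have F0 : F [::] by split=> //; split.
apply: (@conn_enlarge _ _ X') => //.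
move=> tau ut [[htau dis] Xtau] nX'.
have /andP[wv0 uv0] : (w \notin v0) && uniq v0 by [].
pose eta := tau ++ v0.
have mem_eta : w :: eta =i tau ++ w :: v0.
  by move=> x; rewrite /eta !inE !mem_cat !inE orbCA.
have ueta : uniq eta.
  rewrite cat_uniq ut uv0 andbT; apply/hasPn => x xv; apply/negP => xt.
  by have := hasPn dis x xt; rewrite /= inE xv orbT.
have weta : w \notin eta.
  rewrite mem_cat negb_or wv0 andbT; apply/negP => wt.
  by have := hasPn dis w wt; rewrite /= inE eqxx.
have heta : umod q.+2 (w :: eta) by apply: umod_eq_mem htau => x; rewrite mem_eta.
have cJ : conn K (full_on (@slab q) (link (umod q.+1) [seq x *m J | x <- eta]))
    (q.+2 + 2 - size (w :: v0) - k - size tau).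
  have := S q erefl _ (uniq_image JI weta heta ueta) (umod_image IJ JI wlam weta heta).
  rewrite size_map size_cat /=.
  by have -> : (q.+1 + 2 - (size tau + size v0) - k = q.+2 + 2 - (size v0).+1 - k - size tau)%N by lia.
apply: (@conn_relabel _ _ _ _ _ (fun y => y *m I) (fun x => x *m J)) cJ.
- by apply: face_closed_full_on; exact: face_closed_link.
- exact: splittingK.
- move=> s [_ /allP Xs] v vs; rewrite (splitting_back JI) (eqP (Xs v vs)).
  by rewrite scale0r subr0.
- move=> s.
  have slabE : all (@slab q.+1) [seq y *m I | y <- s] = all (@slab q) s.
    by rewrite all_map; apply: eq_all => y; rewrite /= /slab Imax.
  have Xs : all X' [seq y *m I | y <- s].
    by apply/allP => _ /mapP[y _ ->]; rewrite /X' ev_mul Il ev0r.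
  have linkE : link (link (umod q.+2) (w :: v0)) tau [seq y *m I | y <- s] <->
      link (umod q.+1) [seq x *m J | x <- eta] s.
    rewrite -(umod_splitting IJ JI wlam weta heta) (link_link _ _ dis).
    by split; apply: link_eq_mem => // x; rewrite mem_eta.
  split.
    move=> [[[h1 h2] h3] _]; split; last first.
      by move: h2; rewrite all_cat slabE => /andP[].
    by apply/linkE; split.
  move=> [/linkE [h1 h2] h3]; split=> //; split=> //; split=> //.
  by rewrite all_cat slabE h3 Xtau.
Qed.

(** The slab in R^(n+1) controls the full complex in R^(n+1), which is the input at the empty
    simplex for the slab in R^(n+2); hence a joint induction. *)
Theorem umod_links_conn n : links_conn n.
Proof.
suff H : links_conn n /\ slab_links_conn n by case: H.
elim: n => [|n [T S]].
  have T0 : links_conn 0.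
    by move=> v _ _; have -> : (0 + 2 - size v - k = 0)%N by lia; exact: conn0.
  by split=> //; apply: slab_links_step.
have T' : links_conn n.+1 by exact: links_of_slab_links.
by split=> //; apply: slab_links_step => // q [<-].
Qed.

End UmodConn.


(** * Partial bases *)

Section Spanned.
Variables (R : comNzRingType) (n : nat).
Implicit Types (x y v : 'rV[R]_n) (b s t : seq 'rV[R]_n).

Definition lin_closed (P : 'rV[R]_n -> Prop) : Prop :=
  P 0 /\ forall a x y, P x -> P y -> P (a *: x + y).

(** Taking the smallest linearly closed predicate avoids coefficients; [spanned_cat] and
    [spanned_uniq] recover them where they matter. *)
Definition spanned b x : Prop :=
  forall P, lin_closed P -> (forall v, v \in b -> P v) -> P x.

Lemma spanned_mem b v : v \in b -> spanned b v.
Proof. by move=> vb P _; apply. Qed.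

Lemma spanned_closed b : lin_closed (spanned b).
Proof.
split=> [P []//|a x y sx sy P Pc Pb]; have [_ h] := Pc.
by apply: h; [exact: sx | exact: sy].
Qed.

Lemma spanned_trans b b' x : (forall v, v \in b -> spanned b' v) -> spanned b x -> spanned b' x.
Proof. by move=> bb' sx; apply: sx => //; exact: spanned_closed. Qed.

Lemma spanned_sub b b' x : {subset b <= b'} -> spanned b x -> spanned b' x.
Proof. by move=> bb'; apply: spanned_trans => v /bb'; exact: spanned_mem. Qed.

Lemma spanned0 b : spanned b 0.
Proof. by case: (spanned_closed b). Qed.

Lemma spannedZ b a x : spanned b x -> spanned b (a *: x).
Proof.
by move=> sx; have [s0 h] := spanned_closed b; rewrite -[_ *: x]addr0; exact: h.
Qed.

Lemma spannedD b x y : spanned b x -> spanned b y -> spanned b (x + y).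
Proof. by move=> sx sy; have [_ h] := spanned_closed b; rewrite -[x]scale1r; exact: h. Qed.

Lemma spannedB b x y : spanned b x -> spanned b y -> spanned b (x - y).
Proof. by move=> sx sy; rewrite -scaleN1r; apply: spannedD => //; exact: spannedZ. Qed.

Lemma spanned_sum b (I : eqType) (r : seq I) (F : I -> 'rV[R]_n) :
  (forall i, i \in r -> spanned b (F i)) -> spanned b (\sum_(i <- r) F i).
Proof.
elim: r => [|i r IH] sF; first by rewrite big_nil; exact: spanned0.
rewrite big_cons; apply: spannedD; first by apply: sF; rewrite inE eqxx.
by apply: IH => j jr; apply: sF; rewrite inE jr orbT.
Qed.

Lemma spanned_cat s t x : spanned (s ++ t) x ->
  exists y, spanned s y /\ exists c : nat -> R, x = y + \sum_(i < size t) c i *: t`_i.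
Proof.
pose P x := exists y, spanned s y /\ exists c : nat -> R, x = y + \sum_(i < size t) c i *: t`_i.
move=> sx; apply: (sx P); first split.
- exists 0; split; first exact: spanned0.
  by exists (fun=> 0); rewrite big1 ?addr0 // => i _; rewrite scale0r.
- move=> a _ _ [y [sy [c ->]]] [y' [sy' [c' ->]]].
  exists (a *: y + y'); split; first by apply: spannedD => //; exact: spannedZ.
  exists (fun i => a * c i + c' i); rewrite scalerDr addrACA; congr (_ + _).
  by rewrite scaler_sumr -big_split; apply: eq_bigr => i _; rewrite /= scalerDl scalerA.
move=> v; rewrite mem_cat => /orP[vs|vt].
  exists v; split; first exact: spanned_mem.
  by exists (fun=> 0); rewrite big1 ?addr0 // => i _; rewrite scale0r.
exists 0; split; first exact: spanned0.
exists (fun i => (i == index v t)%:R); have it : (index v t < size t)%N by rewrite index_mem.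
rewrite add0r (bigD1 (Ordinal it)) //= eqxx scale1r nth_index // big1 ?addr0 // => i.
by rewrite -val_eqE /= => /negPf ->; rewrite scale0r.
Qed.

Lemma spanned_uniq s y : uniq s -> spanned s y -> exists a : 'rV[R]_n -> R, y = \sum_(v <- s) a v *: v.
Proof.
pose P y := exists a : 'rV[R]_n -> R, y = \sum_(v <- s) a v *: v.
move=> us sy; apply: (sy P); first split.
- by exists (fun=> 0); rewrite big1 // => v _; rewrite scale0r.
- move=> a _ _ [c ->] [c' ->]; exists (fun v => a * c v + c' v).
  by rewrite scaler_sumr -big_split; apply: eq_bigr => i _; rewrite /= scalerDl scalerA.
move=> v vs; exists (fun u => (u == v)%:R).
rewrite (bigD1_seq v) //= eqxx scale1r big1 ?addr0 // => u /negPf ->.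
by rewrite scale0r.
Qed.

Lemma ev_spanned0 s y phi : (forall v, v \in s -> ev v phi = 0) -> spanned s y -> ev y phi = 0.
Proof.
move=> s0; move=> sy; apply: (sy (fun y => ev y phi = 0)) => //; split; first exact: ev0l.
by move=> a x z xp zp; rewrite evDl evZl xp zp mulr0 addr0.
Qed.

Definition row_basis b : Prop := size b = n /\ forall x, spanned b x.

Local Notation pb := (partial_basis_complex R n).

Lemma face_closed_pb : face_closed pb.
Proof. by move=> s t ts [M [N [MN [NM H]]]]; exists M, N; split=> //; split=> // v /ts/H. Qed.

Lemma ev_row_col (M N : 'M[R]_n) i j : ev (row i M) (col j N) = (M *m N) i j.
Proof. by rewrite evE mxE; apply: eq_bigr => l _; rewrite !mxE. Qed.

Lemma row_inj_inv (M N : 'M[R]_n) : M *m N = 1%:M -> injective (fun i => row i M).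
Proof.
move=> MN i j ij; apply/eqP/negPn/negP => nij.
have : ev (row i M) (col i N) = ev (row j M) (col i N) by rewrite ij.
by rewrite !ev_row_col MN !mxE eqxx eq_sym (negPf nij) => /eqP; rewrite oner_eq0.
Qed.

(** Spanning by [n] vectors gives a left inverse of their matrix, which over a commutative ring is a
    two-sided inverse. *)
Lemma basis_matrix b : row_basis b -> exists M N : 'M[R]_n,
  [/\ M *m N = 1%:M, N *m M = 1%:M & forall i : 'I_n, row i M = b`_i].
Proof.
move=> [sb spb]; pose M : 'M[R]_n := \matrix_(i < n) b`_i.
have H (i : 'I_n) : exists c : nat -> R, delta_mx ord0 i = \sum_(j < n) c j *: b`_j.
  have [y [sy [c ->]]] := spanned_cat (s := [::]) (spb (delta_mx ord0 i)).
  exists c; rewrite sb; suff -> : y = 0 by rewrite add0r.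
  by apply: (sy (fun z => z = 0)) => //; split=> // a x z -> ->; rewrite scaler0 addr0.
have [c Hc] := choice H.
pose N : 'M[R]_n := \matrix_(i, j) c i j.
have NM : N *m M = 1%:M.
  apply/row_matrixP => i; rewrite row_mul mulmx_sum_row row1 Hc.
  by apply: eq_bigr => j _; rewrite !mxE rowK.
by exists M, N; split=> //; [exact: mulmx1C | move=> i; rewrite rowK].
Qed.

Lemma basis_pb b s : row_basis b -> {subset s <= b} -> pb s.
Proof.
move=> bb sb; have [M [N [MN NM rM]]] := basis_matrix bb; have [szb _] := bb.
exists M, N; split=> //; split=> // v /sb vb.
have iv : (index v b < n)%N by rewrite -[X in (_ < X)%N]szb index_mem.
by exists (Ordinal iv); rewrite rM nth_index.
Qed.

Lemma basis_uniq b : row_basis b -> uniq b.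
Proof.
move=> bb; have [M [N [MN NM rM]]] := basis_matrix bb; have [szb _] := bb.
apply/(uniqP 0) => i j; rewrite !inE szb => ni nj ij.
suff : Ordinal ni = Ordinal nj by case.
by apply: (row_inj_inv MN); rewrite !rM.
Qed.

Lemma pb_basis s : pb s -> uniq s -> exists ws, row_basis (s ++ ws).
Proof.
move=> [M [N [MN [NM H]]]] us.
pose rows := [seq row i M | i <- enum 'I_n].
have urows : uniq rows by rewrite map_inj_uniq ?enum_uniq //; exact: row_inj_inv MN.
have srows : {subset s <= rows}.
  by move=> v /H [i ->]; apply/mapP; exists i => //; rewrite mem_enum.
pose ws := [seq v <- rows | v \notin s].
have mem_ws : s ++ ws =i rows.
  move=> v; rewrite mem_cat mem_filter; case: (boolP (v \in s)) => //= vs.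
  by rewrite srows.
have uws : uniq (s ++ ws).
  rewrite cat_uniq us filter_uniq // andbT; apply/hasPn => v.
  by rewrite mem_filter => /andP[].
exists ws; split.
  rewrite (perm_size (uniq_perm uws urows mem_ws)) size_map size_enum_ord //.
move=> x; rewrite -[x]mulmx1 -NM mulmxA mulmx_sum_row.
have -> : \sum_i (x *m N) ord0 i *: row i M = \sum_(i <- index_enum 'I_n) (x *m N) ord0 i *: row i M by [].
apply: spanned_sum => i _; apply: spannedZ; apply: spanned_mem.
by rewrite mem_ws; apply/mapP; exists i => //; rewrite mem_enum.
Qed.

Lemma pb_umod s : pb s -> umod n s.
Proof.
move=> [M [N [MN [NM H]]]] v vs; have [i vi] := H v vs.
exists (col i N); split; first by rewrite vi ev_row_col MN mxE eqxx.
move=> w ws wv; have [j wj] := H w ws; rewrite wj ev_row_col MN mxE.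
by case: eqVneq => // ij; case/eqP: wv; rewrite wj ij vi.
Qed.

Lemma pb_nil : pb [::].
Proof. by exists 1%:M, 1%:M; rewrite mulmx1; split=> //; split. Qed.

Variable k : nat.
Hypotheses (hk : (2 <= k)%N) (hSR : SR k R).

(* Transitivity of elementary matrices on unimodular columns of length at
   least [k]: the coefficients of [x] in the complement [ws] are unimodular. *)
Lemma basis_exchange s ws x phi : row_basis (s ++ ws) -> (k <= size ws)%N ->
  (forall v, v \in s -> ev v phi = 0) -> ev x phi = 1 ->
  exists ws', row_basis (s ++ x :: ws').
Proof.
move=> [sz spb] kw s0 x1.
have [y [sy [b xE]]] := spanned_cat (spb x).
case szw : (size ws) kw xE => [|r] kw xE; first by lia.
have [|t [d dE]] := @SR_le R k r.+1 (ltnW hk) kw hSR b.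
  exists (fun i => ev ws`_i phi); rewrite -x1 xE evDl (ev_spanned0 s0 sy) add0r ev_suml.
  by apply: eq_bigr => i _; rewrite evZl mulrC.
rewrite /= in dE.
(* Adding [A] to the last vector changes the other coefficients of [x] to the unimodular
   [b j - t j * b r]. Subtracting multiples of [wr] from the other vectors, with [d] as multipliers,
   then makes the coefficient of [wr] equal to 1, so that [x] can replace [wr]. *)
pose A := \sum_(j < r) t j *: ws`_j.
pose wr := ws`_r + A.
pose nw j := ws`_j - (d j * (1 - b r)) *: wr.
have {}xE : x - y = \sum_(j < r) b j *: ws`_j + b r *: ws`_r.
  by rewrite xE big_ord_recr /= addrAC subrr add0r.
have E : \sum_(j < r) (b j - t j * b r) *: nw j =
    \sum_(j < r) b j *: ws`_j - b r *: A - (1 - b r) *: wr.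
  have -> : (1 - b r) *: wr = \sum_(j < r) (d j * (b j - t j * b r)) *: ((1 - b r) *: wr).
    by rewrite -scaler_suml dE scale1r.
  rewrite /A scaler_sumr -!sumrB; apply: eq_bigr => j _.
  rewrite /nw scalerBr !scalerA scalerBl; congr (_ - _ - _); first by rewrite mulrC.
  by congr (_ *: _); ring.
have wrE : wr = x - y - \sum_(j < r) (b j - t j * b r) *: nw j.
  rewrite E xE /wr; clear.
  move: (\sum_(j < r) b j *: ws`_j) A (b r) (ws`_r) => B A' c w.
  by apply/rowP => i; rewrite !mxE; ring.
pose ws' := mkseq nw r.
exists ws'.
have swr : spanned (s ++ x :: ws') wr.
  rewrite wrE; apply: spannedB; first apply: spannedB.
  - by apply: spanned_mem; rewrite mem_cat inE eqxx orbT.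
  - by apply: spanned_sub sy => v vs; rewrite mem_cat vs.
  - apply: spanned_sum => j _.
    apply: spannedZ; apply: spanned_mem; rewrite mem_cat inE; apply/or3P; apply: Or33.
    by apply/mapP; exists (j : nat); rewrite // mem_iota ltn_ord.
have snw j : (j < r)%N -> spanned (s ++ x :: ws') ws`_j.
  move=> jr; have -> : ws`_j = nw j + (d j * (1 - b r)) *: wr by rewrite subrK.
  apply: spannedD; last exact: spannedZ.
  apply: spanned_mem; rewrite mem_cat inE; apply/or3P; apply: Or33.
  by apply/mapP; exists j; rewrite // mem_iota.
split.
  by have := sz; rewrite !size_cat szw /= size_mkseq.
move=> z; apply: spanned_trans (spb z) => v; rewrite mem_cat => /orP[vs|vw].
  by apply: spanned_mem; rewrite mem_cat vs.
have iw : (index v ws < r.+1)%N by rewrite -szw index_mem.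
rewrite -(nth_index 0 vw); move: iw; rewrite ltnS leq_eqVlt => /predU1P[->|]; last exact: snw.
have -> : ws`_r = wr - A by rewrite addrK.
apply: spannedB => //; apply: spanned_sum => j _; apply: spannedZ; exact: snw.
Qed.

End Spanned.


(** * Completing unimodular families to bases *)

Section PartialBases.
Variables (R : comNzRingType) (n k : nat).
Hypotheses (hk : (2 <= k)%N) (hSR : SR k R).
Local Notation pb := (partial_basis_complex R n).

(** When the next vector is added, the complement of the previous ones in a basis still has at least
    [k] members, which is what [basis_exchange] requires. *)
Lemma umod_pb s : umod n s -> uniq s -> (size s + k <= n.+1)%N -> pb s.
Proof.
elim: s => [|x s IH] us /= uniq_s sk; first exact: pb_nil.
have /andP[xs us'] := uniq_s.
have ps : pb s.
  apply: IH => //; last by lia.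
  by apply: face_closed_umod us => v vs; rewrite inE vs orbT.
have [ws bws] := pb_basis ps us'.
have [phi [phi1 phi0]] := us x (mem_head _ _).
have kw : (k <= size ws)%N by have [] := bws; rewrite size_cat; lia.
have [|ws' bws'] := basis_exchange hk hSR bws kw _ phi1.
  by move=> v vs; apply: phi0; [rewrite inE vs orbT | apply: contraNneq xs => <-].
apply: basis_pb bws' _ => v; rewrite inE mem_cat inE => /predU1P[->|->//].
by rewrite eqxx orbT.
Qed.

(** Write [v0] over a basis [s ++ ws] with coefficients [a] and [b]. The facet omitting [v] can be
    completed once [v] has coefficient 1 in [v0], for then [v0] replaces [v]. The difficulty is that
    a single [u] must serve all facets. *)
Lemma boundary_cone_vertex s v0 : umod n (v0 :: s) -> uniq (v0 :: s) ->
  (size s + k = n.+1)%N ->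
  exists u, [/\ u \notin s, pb (u :: s) & forall v, v \in s -> pb (u :: v0 :: rem v s)].
Proof.
move=> us /= /andP[v0s uniq_s] sk.
have ps : pb s.
  apply: umod_pb => //; last by lia.
  by apply: face_closed_umod us => v vs; rewrite inE vs orbT.
have [ws [sz spb]] := pb_basis ps uniq_s.
have [phi [phi1 phi0]] := us v0 (mem_head _ _).
have {}phi0 v : v \in s -> ev v phi = 0.
  by move=> vs; apply: phi0; [rewrite inE vs orbT | apply: contraNneq v0s => <-].
have [y [sy [b v0E]]] := spanned_cat (spb v0).
have [a yE] := spanned_uniq uniq_s sy.
pose c i := ev ws`_i phi.
have bc : \sum_(i < size ws) b i * c i = 1.
  rewrite -phi1 v0E evDl (ev_spanned0 phi0 sy) add0r ev_suml.
  by apply: eq_bigr => i _; rewrite evZl.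
case: ws sz spb b v0E c bc => [|w ws] sz spb b v0E c bc.
  by move: sz; rewrite cats0; lia.
have {}sz : (size s + (size ws).+1 = n)%N by have := sz; rewrite size_cat.
(* The correction that brings the coefficient of one [v] to 1 is made for all [v] in [s]
   simultaneously; for a given facet the excess terms involve only members of that facet. *)
pose z := \sum_(v <- s) (1 - a v) *: v.
pose u := w - c 0%N *: z.
have bu : row_basis (s ++ u :: ws).
  split; first by rewrite size_cat.
  have ss v : v \in s -> spanned (s ++ u :: ws) v.
    by move=> vs; apply: spanned_mem; rewrite mem_cat vs.
  move=> x; apply: spanned_trans (spb x) => v; rewrite mem_cat inE.
  case/or3P => [/ss//|/eqP ->|vw]; last by apply: spanned_mem; rewrite mem_cat inE vw !orbT.
  have -> : w = u + c 0%N *: z by rewrite subrK.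
  apply: spannedD; first by apply: spanned_mem; rewrite mem_cat inE eqxx orbT.
  by apply: spannedZ; apply: spanned_sum => l ls; apply: spannedZ; exact: ss.
exists u; split.
- have := basis_uniq bu; rewrite cat_uniq /= negb_or => /and3P[_ /andP[] //].
- by apply: basis_pb bu _ => v; rewrite inE mem_cat inE => /predU1P[->|->//]; rewrite eqxx orbT.
move=> v vs.
(* Since [sum b_j c_j = 1], expressing [v0] through these vectors raises the coefficient of [v] from
   [a v] to 1. The vector [nw 0] equals [u] modulo the rest of [s]. *)
pose nw j := (w :: ws)`_j - (c j * (1 - a v)) *: v.
pose B := rem v s ++ v0 :: u :: mkseq (fun j => nw j.+1) (size ws).
have mem_rem l : l \in s -> l != v -> spanned B l.
  move=> ls lv; apply: spanned_mem; rewrite mem_cat (mem_rem_uniq _ uniq_s) inE /=.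
  by rewrite lv ls.
have sB_rem (F : 'rV[R]_n -> R) : spanned B (\sum_(l <- rem v s) F l *: l).
  apply: spanned_sum => l lr; apply: spannedZ; apply: spanned_mem.
  by rewrite mem_cat lr.
have zE : z = (1 - a v) *: v + \sum_(l <- rem v s) (1 - a l) *: l by rewrite /z (big_rem v).
have {}yE : y = a v *: v + \sum_(l <- rem v s) a l *: l by rewrite yE (big_rem v).
have su : spanned B u by apply: spanned_mem; rewrite mem_cat !inE eqxx !orbT.
have sv0 : spanned B v0 by apply: spanned_mem; rewrite mem_cat !inE eqxx !orbT.
have snw j : (j < (size ws).+1)%N -> spanned B (nw j).
  case: j => [|j] jw.
    have -> : nw 0%N = u + c 0%N *: \sum_(l <- rem v s) (1 - a l) *: l.
      by rewrite /nw /u zE /= scalerDr scalerA opprD addrA subrK.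
    by apply: spannedD => //; exact: spannedZ.
  apply: spanned_mem; rewrite mem_cat !inE; apply/or4P; apply: Or44.
  by apply/mapP; exists j; rewrite // mem_iota.
have vE : v = v0 - \sum_(l <- rem v s) a l *: l - \sum_(j < (size ws).+1) b j *: nw j.
  have -> : \sum_(j < (size ws).+1) b j *: nw j =
      \sum_(j < (size ws).+1) b j *: (w :: ws)`_j - (1 - a v) *: v.
    have -> : (1 - a v) *: v = \sum_(j < (size ws).+1) (b j * c j) *: ((1 - a v) *: v).
      by rewrite -scaler_suml bc scale1r.
    by rewrite -sumrB; apply: eq_bigr => j _; rewrite /nw scalerBr !scalerA mulrA.
  rewrite [in RHS]v0E yE; clear.
  move: (\sum_(l <- rem v s) a l *: l) (\sum_(j < size (w :: ws)) _) (a v) => C D e.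
  by apply/rowP => i; rewrite !mxE; ring.
have sv : spanned B v.
  rewrite vE; apply: spannedB; first exact: spannedB.
  by apply: spanned_sum => j _; apply: spannedZ; apply: snw.
have bB : row_basis B.
  split.
    rewrite size_cat /= size_mkseq size_rem //.
    by case: (s) vs sz => [//|l s'] _ /=; lia.
  move=> x; apply: spanned_trans (spb x) => l; rewrite mem_cat => /orP[ls|lw].
    by have [->|] := eqVneq l v; [exact: sv | exact: mem_rem].
  have il : (index l (w :: ws) < (size ws).+1)%N by rewrite -[X in (_ < X)%N]/(size (w :: ws)) index_mem.
  rewrite -(nth_index 0 lw).
  have -> : (w :: ws)`_(index l (w :: ws)) = nw (index l (w :: ws)) + (c (index l (w :: ws)) * (1 - a v)) *: v.
    by rewrite subrK.
  by apply: spannedD; [exact: snw | exact: spannedZ].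
apply: basis_pb bB _ => l; rewrite !inE mem_cat !inE.
by case/or3P => ->; rewrite ?orbT.
Qed.

Lemma pb_size s : pb s -> uniq s -> (size s <= n)%N.
Proof.
move=> ps us; have [ws [sz _]] := pb_basis ps us.
by rewrite -[X in (_ <= X)%N]sz size_cat leq_addr.
Qed.

End PartialBases.

(** * Connectivity of the partial basis complex *)

Section PartialBasisConn.
Variables (R : comNzRingType) (K : realType) (n k : nat).
Hypotheses (hk : (2 <= k)%N) (hSR : SR k R).
Local Notation pb := (partial_basis_complex R n).

Theorem conn_partial_basis : conn K pb (n + 2 - k).
Proof.
set e := (n + 2 - k)%N.
have cU := @face_closed_umod R n; have cpb := @face_closed_pb R n.
have connU : conn K (@umod R n) e.
  have := @umod_links_conn R K k hk hSR n [::] isT (@umod_nil R n); rewrite /= subn0.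
  apply: conn_ext => s; rewrite /link cats0; split=> [[]//|us]; split=> //.
  by apply/hasPn.
move=> N lo hi lohi dim f sf.
have [g [[[S [uS wS]] Ug cg] gf]] := connU N lo hi lohi dim f (smap_mono (@pb_umod R n) sf).
have [_ pf _] := sf.
pose bad (s : seq 'rV[R]_n) := umod n s /\ ~ pb s.
(* [Z L] lies between [pb] and the unimodular complex on [S]: the bad simplices listed
   in [L] have been removed. *)
pose Z (L : seq (seq 'rV[R]_n)) : complex 'rV[R]_n := fun s =>
  pb s \/ [/\ umod n s, {subset s <= S} & forall t, t \in L -> bad t -> ~ {subset t <= s}].
have cZ L : face_closed (Z L).
  move=> s t ts [ps|[us sS sL]]; [left; exact: cpb ps | right; split].
  - exact: cU us.
  - by move=> v /ts/sS.
  - by move=> r rL br rt; apply: (sL r rL br) => v /rt/ts.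
have step L : (forall s, s \in L -> uniq s) ->
    exists g, simplicial_map (box lo hi) (Z L) g /\ forall x, box_boundary lo hi x -> g x = f x.
  elim: L => [|t L IH] uL.
    exists g; split=> //; split=> //; first by exists S.
    move=> x bx s sp; right; split=> //; first exact: (Ug x bx).
    move=> v /sp gv; apply/negPn/negP => vS.
    by have [_ /(_ v vS) E _] := wS x bx; rewrite E ltxx in gv.
  have [|g0 [sg0 g0f]] := IH; first by move=> s sL; apply: uL; rewrite inE sL orbT.
  have ut := uL t (mem_head _ _).
  have skip : (bad t -> forall s, Z L s -> {subset t <= s} -> pb s) ->
      exists g, simplicial_map (box lo hi) (Z (t :: L)) g /\
        forall x, box_boundary lo hi x -> g x = f x.
    move=> H; exists g0; split=> //; apply: smap_mono sg0 => s Zs.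
    have [ps|nps] := pselect (pb s); first by left.
    case: (Zs) => [//|[us sS sL]]; right; split=> // r.
    by rewrite inE => /predU1P[-> bt ts|/sL//]; apply: nps; exact: H.
  have [bt|nbt] := pselect (bad t); last by apply: skip => /nbt.
  have [Zt|nZt] := pselect (Z L t); last first.
    by apply: skip => _ s Zs ts; exfalso; apply: nZt; exact: cZ Zs.
  have [ut' npt] := bt.
  have t0 : t != [::] by apply/eqP => E; apply: npt; rewrite E; exact: pb_nil.
  (* Shorter unimodular families are partial bases by [umod_pb]. *)
  have et : (e <= size t)%N.
    rewrite leqNgt; apply/negP => te; apply: npt; apply: (umod_pb hk hSR) => //.
    by move: te; rewrite /e ltn_subRL addn2 ltnS addnC.
  have [u Hu] : exists u, size t = e -> [/\ u \notin t & forall s, {subset s <= u :: t} -> ~ {subset t <= s} -> pb s].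
    have [te|te] := eqVneq (size t) e; last by exists 0 => E; case/eqP: te.
    case: t te ut ut' npt {uL skip bt Zt t0 et} => [|v0 t] te ut ut' npt.
      by case: npt; exact: pb_nil.
    have tk : (size t + k = n.+1)%N by move: te dim; rewrite /= /e; lia.
    have [u [ut0 pu pv]] := boundary_cone_vertex hk hSR ut' ut tk.
    have uv0 : u != v0 by apply/eqP => E; move: pu; rewrite E => /npt.
    exists u => _; split; first by rewrite inE negb_or uv0.
    move=> s su nts.
    have [v [vt vs]] : exists v, v \in v0 :: t /\ v \notin s.
      apply: contrapT => H; apply: nts => v vt; apply/negPn/negP => vs.
      by apply: H; exists v.
    move: vt; rewrite inE => /predU1P[E|vt].
      apply: cpb pu => l ls; have := su l ls; rewrite !inE => /or3P[->//|/eqP l0|->]; last by rewrite orbT.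
      by rewrite E -l0 ls in vs.
    apply: cpb (pv v vt) => l ls; have := su l ls; rewrite !inE => /or3P[->//|->|lt]; rewrite ?orbT //.
    have /andP[_ ut1] := ut; rewrite (mem_rem_uniq _ ut1) inE lt andbT.
    by rewrite (_ : l != v) ?orbT //; apply: contraNneq vs => <-.
  (* If [size t > e], the boundary of [t] is connected enough by itself. If [size t = e], adjoining
     the simplex [u :: t] makes the link of [t] nonempty and supplies the missing degree; the faces
     of [u :: t] not containing [t] are partial bases and survive the push. *)
  pose Z' : complex 'rV[R]_n := fun s => Z L s \/ (size t = e /\ {subset s <= u :: t}).
  have cZ' : face_closed Z'.
    move=> s r rs [Zs|[te su]]; first by left; exact: cZ Zs.
    by right; split=> // v /rs/su.
  have connL : conn K (link_boundary Z' t) e.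
    have Zt' : Z' t by left.
    have [te|te] := eqVneq (size t) e.
      have [ut0 _] := Hu te.
      have c1 : conn K (link Z' t) 1.
        apply: (@conn1 _ _ _ u); first exact: face_closed_link.
        split; last by rewrite /= orbF.
        by right; split.
      by have := conn_link_boundary cZ' Zt' ut t0 c1; rewrite te.
    have := conn_link_boundary cZ' Zt' ut t0 (@conn0 K _ (link Z' t)).
    by apply: conn_le; rewrite add0n; move: te et; lia.
  have sg0' : simplicial_map (box lo hi) Z' g0 by apply: smap_mono sg0 => s; left.
  have [g1 [sg1 g1g0]] := push_off_rel cZ' t0 ut lohi dim connL sg0'.
  exists g1; split.
    apply: smap_mono sg1 => s [Zs nts].
    case: Zs => [Zs|[te su]]; last by left; have [_ H] := Hu te; exact: H.
    case: Zs => [ps|[us sS sL]]; [by left | right; split=> // r].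
    by rewrite inE => /predU1P[->|/sL].
  move=> x bx; rewrite g1g0 ?g0f //; first by case: bx.
  have [S0 [_ /(_ x bx) [f0 _ _]]] := smap_weights sf.
  (* On the boundary the filling equals [f], whose supports are partial bases. As [t] is not one,
     some vertex of [t] has weight 0 there, and the push leaves the value unchanged. *)
  apply: contrapT => H; apply: npt; apply: (pf x bx) => v vt.
  rewrite lt_neqAle f0 andbT eq_sym; apply/eqP => E; apply: H.
  by exists v => //; rewrite g0f.
have [|g1 [sg1 g1f]] := step [seq mask (tval m) S | m : (size S).-tuple bool].
  by move=> _ /mapP[m _ ->]; exact: mask_uniq.
exists g1; split=> //; apply: smap_mono sg1 => s [//|[us sS sL]].
apply: contrapT => nps.
pose t := [seq v <- S | v \in s].
have ts : t =i s by move=> v; rewrite mem_filter andbC; case: (boolP (v \in s)) => [/sS ->|]; rewrite ?andbF.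
have sm : size [seq (v \in s) | v <- S] == size S by rewrite size_map.
apply: (sL t).
- apply/mapP; exists (Tuple sm); first by rewrite mem_enum.
  by rewrite /= -filter_mask.
- split; first by apply: umod_eq_mem us => v; rewrite ts.
  by move=> pt; apply: nps; apply: cpb pt => v; rewrite ts.
- by move=> v; rewrite ts.
Qed.

End PartialBasisConn.

(** Fewer than [n] vectors are covered by [umod_pb]. For [n] vectors, all but the first have a
    single complementary basis vector [w], and the coefficient of [w] in the first is a unit, so the
    first replaces [w]. More than [n] cannot occur: the first [n] span, so a functional vanishing on
    them cannot be 1 on another member. *)
Lemma umod_pb2 (R : comNzRingType) n s : SR 2 R -> umod n s -> partial_basis_complex R n s.
Proof.
move=> hSR us.
have cU := @face_closed_umod R n.
suff H t : uniq t -> umod n t -> partial_basis_complex R n t.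
  have : partial_basis_complex R n (undup s).
    apply: H; first exact: undup_uniq.
    by apply: cU us => v; rewrite mem_undup.
  by apply: face_closed_pb => v; rewrite mem_undup.
have full (t' : seq 'rV[R]_n) : uniq t' -> umod n t' -> size t' = n -> row_basis t'.
  case: t' => [|v0 t'].
    move=> _ _ n0; split=> // x.
    have -> : x = 0 by apply/rowP => -[i lt_i]; exfalso; move: lt_i; rewrite -[X in (_ < X)%N]n0.
    exact: spanned0.
  move=> /= /andP[v0t ut] ut' tn.
  have pt : partial_basis_complex R n t'.
    apply: (umod_pb (k := 2)) => //; last by lia.
    by apply: cU ut' => v vt; rewrite inE vt orbT.
  have [ws [sz spb]] := pb_basis pt ut.
  have [phi [phi1 phi0]] := ut' v0 (mem_head _ _).
  have {}phi0 v : v \in t' -> ev v phi = 0.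
    by move=> vt; apply: phi0; [rewrite inE vt orbT | apply: contraNneq v0t => <-].
  have [y [sy [b v0E]]] := spanned_cat (spb v0).
  case: ws sz spb v0E => [|w [|w' ws]]; rewrite size_cat /=; try lia.
  rewrite big_ord1 /= => _ spb v0E.
  have bc : b 0%N * ev w phi = 1.
    by rewrite -phi1 v0E evDl (ev_spanned0 phi0 sy) add0r evZl.
  have sy' : spanned (v0 :: t') y by apply: spanned_sub sy => v vt; rewrite inE vt orbT.
  have sv0 : spanned (v0 :: t') v0 by apply: spanned_mem; rewrite inE eqxx.
  split=> // x; apply: spanned_trans (spb x) => v; rewrite mem_cat inE => /orP[vt|/eqP ->].
    by apply: spanned_mem; rewrite inE vt orbT.
  have -> : w = ev w phi *: (v0 - y).
    by rewrite v0E addrAC subrr add0r scalerA mulrC bc scale1r.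
  by apply: spannedZ; exact: spannedB.
move=> ut uU.
have [tn|tn|tn] := ltngtP (size t) n.
- by apply: (umod_pb (k := 2)) => //; rewrite addn2 ltnS.
- have szt : size (take n t) = n by rewrite size_takel // ltnW.
  have [_ spb] := full (take n t) (take_uniq n ut) (cU _ _ (@mem_take n _ t) uU) szt.
  pose x := t`_n.
  have xt : x \in t by exact: mem_nth.
  have [phi [phi1 phi0]] := uU x xt.
  have : ev x phi = 0.
    apply: ev_spanned0 (spb x) => v vt; apply: phi0; first exact: mem_take vt.
    apply/eqP => vx; move: ut; rewrite -(cat_take_drop n t) cat_uniq => /and3P[_ /hasPn h _].
    have /h : x \in drop n t by rewrite (drop_nth 0) // inE eqxx.
    by rewrite /= -vx vt.
  by rewrite phi1 => /eqP; rewrite oner_eq0.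
- by apply: basis_pb (full t ut uU tn) _.
Qed.

(** * Dimension of links and the Cohen-Macaulay property *)

Section Dimension.
Variables (R : comNzRingType) (n : nat).
Local Notation pb := (partial_basis_complex R n).

(** The complement of [s] in a basis is a simplex of the link of the maximal possible size. *)
Lemma has_dim_link_pb (s : seq 'rV[R]_n) : pb s -> uniq s ->
  has_dim (link pb s) (n%:Z - (size s)%:Z - 1).
Proof.
move=> ps us; split; last first.
  move=> t [pts /hasPn dis] ut.
  have : uniq (t ++ s).
    rewrite cat_uniq ut us andbT; apply/hasPn => v vs; apply: contraL vs => /dis.
    exact.
  move=> /(pb_size pts); rewrite size_cat.
  by move: (size t) (size s) => a b; lia.
have [ws bws] := pb_basis ps us.
have := basis_uniq bws; rewrite cat_uniq => /and3P[_ dis uws].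
exists ws; split; last first.
  split=> //; have [] := bws; rewrite size_cat.
  by move: (size ws) (size s) => a b; lia.
split; last exact: dis.
by apply: basis_pb bws _ => v; rewrite !mem_cat orbC.
Qed.

End Dimension.

Theorem mainTheorem10 (R : comNzRingType) (k : nat) (hk : (2 <= k)%N)
    (hSR : SR k R) (n : nat) (hn : (1 <= n)%N) :
  connected_upto (partial_basis_complex R n) (n%:Z - k%:Z) /\
  (k = 2%N -> cohen_macaulay (partial_basis_complex R n) (n%:Z - 1)).
Proof.
have conn_pb : connected_upto (partial_basis_complex R n) (n%:Z - k%:Z).
  apply: (conn_connected_upto (@face_closed_pb R n) (conn_partial_basis hk hSR)).
  by lia.
split=> // k2; subst k.
split; first split.
- have := has_dim_link_pb (@pb_nil R n) isT; rewrite /= subr0.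
  have E (s : seq 'rV[R]_n) : link (partial_basis_complex R n) [::] s <-> partial_basis_complex R n s.
    by rewrite /link cats0; split=> [[]//|ps]; split=> //; apply/hasPn.
  move=> [[s [/E ps us]] H]; split; first by exists s.
  by move=> t /E; exact: H.
- by have -> : n%:Z - 1 - 1 = n%:Z - 2%:Z by lia.
move=> s ps us s0.
have sz := pb_size ps us.
split.
  have := has_dim_link_pb ps us.
  by have -> : n%:Z - 1 - ((size s)%:Z - 1) - 1 = n%:Z - (size s)%:Z - 1 by lia.
have cL := face_closed_link (tau := s) (@face_closed_pb R n).
(* For [k = 2] the link of [s] is the same in both complexes, so the connectivity of links of
   unimodular families applies directly. *)
have cU := @umod_links_conn R _ 2 hk hSR n s us (pb_umod ps).
apply: (conn_connected_upto cL (e := (n + 2 - size s - 2)%N)); last by lia.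
apply: conn_ext (cU _) => t; split=> -[h1 h2]; split=> //; first exact: umod_pb2.
exact: pb_umod.
Qed.
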